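(* Let $M \geq 0$ be a real number. There exists a (small) $\mu_0>0$, not depending on $t$ or $y$, such that for all real $\mu$ with $0 \leq \mu \leq \mu_0$, all $r\in\mathbb{R}$ with $|r|\leq M$, and $y>0$ real, with $t = y \cosh \mu$ and $\nu=r+it$, one has, as $y\to\infty$, $$\begin{aligned} K_\nu(y) = & \ \frac {\pi \sqrt 2}{y^{1/3}}\, e^{-y \frac \pi 2 \cosh \mu + i r \frac \pi 2} \cosh\left(r \mu\right) \left(\frac \zeta {-\sinh^2 \mu} \right)^{1/4} \operatorname{Ai}\left( y^{2/3} \zeta \right) \\ & - \frac{ \pi \sqrt 2}{y^{2/3}}\, e^{-y \frac \pi 2 \cosh \mu + i r \frac \pi 2} \sinh\left(r \mu\right)\zeta^{-1/2} \left(\frac \zeta {-\sinh^2 \mu} \right)^{1/4} \operatorname{Ai}'\left( y^{2/3} \zeta \right) \\ &+ O\left(\frac{\operatorname{Ai}\left( y^{2/3} \zeta \right) e^{-y \frac \pi 2 \cosh \mu }}{y^{4/3}}\right) + O\left(\frac{\operatorname{Ai}'\left( y^{2/3} \zeta \right)e^{-y \frac \pi 2 \cosh \mu}}{y^{5/3}}\right),\end{aligned}$$ where $\zeta = -\left[\frac 3 2 \left(\mu \cosh \mu - \sinh \mu \right) \right]^{2/3}$ is a nonpositive real number, and the implied constants depend on $\mu_0$ and $M$ (so the estimate is uniform in such $\mu$ and $r$).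
   Context: $K_\nu$ denotes the $K$-Bessel function (modified Bessel function of the second kind), for $y>0$ and $\nu\in\mathbb{C}$ given by $K_\nu(y)=\frac12\int_{-\infty}^{\infty} e^{-y\cosh R+\nu R}\,dR$. $\operatorname{Ai}$ is the Airy function and $\operatorname{Ai}'$ its derivative. For $\mu>0$ one has $\zeta<0$, and $\zeta^{1/2}=i|\zeta|^{1/2}$ (principal branch), so $\zeta^{-1/2}=-i|\zeta|^{-1/2}$; the quantity $\zeta/(-\sinh^2\mu)$ is a positive real number and its fourth root is the positive one. At $\mu=0$ the coefficient expressions $\left(\zeta/(-\sinh^2\mu)\right)^{1/4}$ and $\sinh(r\mu)\,\zeta^{-1/2}$ are understood as their limits as $\mu\to0^+$. *)

(* Defs.v *)
From Stdlib Require Import Reals.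
From Coquelicot Require Import Coquelicot.
Local Open Scope R_scope.

Definition Cexp (z : C) : C :=
  Cmult (RtoC (exp (Re z))) (cos (Im z), sin (Im z)).

Definition BesselK (nu : C) (y : R) : C :=
  Cmult (RtoC (1 / 2))
    (RInt_gen (V := C_R_CompleteNormedModule)
       (fun u : R => Cexp (Cplus (RtoC (- y * cosh u)) (Cmult nu (RtoC u))))
       (Rbar_locally m_infty) (Rbar_locally p_infty)).

(* The integral is only conditionally convergent; [RInt_gen] is the limit of
   the Riemann integrals over [0, b] as b -> +oo. *)
Definition Ai (x : R) : R :=
  / PI * RInt_gen (V := R_CompleteNormedModule)
           (fun s : R => cos (s ^ 3 / 3 + x * s))
           (at_point 0) (Rbar_locally p_infty).

Definition Ai' (x : R) : R := Derive Ai x.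

(* [Rpower 0 a] is 1 in the standard library, hence the case distinction,
   which makes 0 to the power a equal to 0; meant for x >= 0 and a > 0. *)
Definition rpow (x a : R) : R := if Rlt_dec 0 x then Rpower x a else 0.

Definition zeta (mu : R) : R :=
  - rpow (3 / 2 * (mu * cosh mu - sinh mu)) (2 / 3).

(* Principal square root of the nonpositive real number [zeta mu]. *)
Definition zeta_sqrt (mu : R) : C :=
  Cmult Ci (RtoC (sqrt (Rabs (zeta mu)))).

(* [f] with its value at 0 replaced by its limit at 0 from the right. *)
Definition limit_at_0 {V : CompleteNormedModule R_AbsRing} (f : R -> V)
    (mu : R) : V :=
  if Req_EM_T mu 0
  then iota (fun v : V => filterlim f (at_right 0) (locally v))
  else f mu.

Definition coef_root (mu : R) : R :=
  limit_at_0 (V := R_CompleteNormedModule)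
    (fun m : R => rpow (zeta m / - (sinh m) ^ 2) (1 / 4)) mu.

Definition coef_sinh (r mu : R) : C :=
  limit_at_0 (V := C_R_CompleteNormedModule)
    (fun m : R => Cdiv (RtoC (sinh (r * m))) (zeta_sqrt m)) mu.

Definition exp_factor (r mu y : R) : C :=
  Cexp (Cplus (RtoC (- y * (PI / 2) * cosh mu))
              (Cmult Ci (RtoC (r * (PI / 2))))).

Definition main_Ai (r mu y : R) : C :=
  Cmult
    (Cmult (RtoC (PI * sqrt 2 / Rpower y (1 / 3))) (exp_factor r mu y))
    (RtoC (cosh (r * mu) * coef_root mu * Ai (Rpower y (2 / 3) * zeta mu))).

Definition main_Ai' (r mu y : R) : C :=
  Cmult
    (Cmult
       (Cmult (RtoC (PI * sqrt 2 / Rpower y (2 / 3))) (exp_factor r mu y))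
       (coef_sinh r mu))
    (RtoC (coef_root mu * Ai' (Rpower y (2 / 3) * zeta mu))).

Definition err_Ai (mu y : R) : R :=
  Ai (Rpower y (2 / 3) * zeta mu) * exp (- y * (PI / 2) * cosh mu)
  / Rpower y (4 / 3).

Definition err_Ai' (mu y : R) : R :=
  Ai' (Rpower y (2 / 3) * zeta mu) * exp (- y * (PI / 2) * cosh mu)
  / Rpower y (5 / 3).

(* Main.v *)
Require Import Defs.
From Stdlib Require Import Reals Lra Lia FunctionalExtensionality.
From Coquelicot Require Import Coquelicot.
Local Open Scope R_scope.

(* Idea. Fix t = 2 / e^3 and let y = t / cosh mu vary. In the variable ln cosh mu the Bessel
   equation for K_nu has the turning point mu = 0, which the Langer variable
   z = (3 (mu - tanh mu))^(2/3) straightens: with X = z / e^2, the function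
   a(mu) Ai(-X) + i e b(mu) Ai'(-X) satisfies the same equation up to a source with bounded
   amplitudes, and it is the claimed main term. At mu = 0 the value and the derivative of K_nu are
   expanded by shifting the contour to imaginary part pi/2 - e, where the integrand becomes the
   Airy integrand times a power series in e; they agree with those of the comparison function
   up to the factor 1 + i e^3 (r / 15 - r^3 / 6) and relative errors O(e^4). An energy estimate
   bounds the error for mu <= mu0 by O(e^4 (1 + X)^(1/4)), which is O(e^3 X^(-1/4)) since
   X = O(e^(-2)). As sqrt X Ai(-X)^2 + Ai'(-X)^2 / sqrt X is bounded below, such an error splits
   into the two stated terms, one for each of Ai and Ai'. *)

(** * Absolutely convergent integrals over the real line *)

(** The parameter t is held fixed because K_nu solves an ordinary differential equation in y only
    for constant nu. In ln cosh mu that equation is W'' = (r^2 + 4 i r / e^3 - 4 tanh(mu)^2 / e^6)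
    W. The middle term of the potential is what brings in the Ai' part: it couples the two
    amplitudes by transport equations, which R H cosh(r mu) and (R / H) sinh(r mu) / mu solve
    exactly (R and H are [langer_R] and [langer_H]). The obstacle lies at the far end of the range
    of mu. The energy inequalities do not see the decay X^(-1/4) of the solutions and lose a factor
    (1 + X)^(1/2), which can be as large as a multiple of 1 / e. An error of order e^3 at mu = 0
    would therefore be too big, and the data there are expanded one order further. Their e^3
    corrections turn out to be one common multiple of the comparison function, so that by linearity
    the multiple is carried along as a constant factor; dropping it at the end costs e^3 times the
    main term, which already has the shape of the stated error. *)

Definition lineint (f : R -> R) : R :=
  RInt_gen (V := R_CompleteNormedModule) f
    (Rbar_locally m_infty) (Rbar_locally p_infty).

Lemma ex_RInt_cont (f : R -> R) (a b : R) :
  (forall x, continuous f x) -> ex_RInt f a b.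
Proof. intros H. apply @ex_RInt_continuous. intros; apply H. Qed.

Lemma is_derive_exp_neg (x : R) : is_derive (fun u => - exp (- u)) x (exp (- x)).
Proof. auto_derive; trivial. ring. Qed.

Lemma RInt_exp_neg (a b : R) : RInt (fun x => exp (- x)) a b = exp (- a) - exp (- b).
Proof.
  apply is_RInt_unique.
  replace (exp (- a) - exp (- b)) with (minus (- exp (- b)) (- exp (- a)))
    by (unfold minus, plus, opp; simpl; ring).
  apply (is_RInt_derive (fun u => - exp (- u))).
  - intros; apply is_derive_exp_neg.
  - intros; apply (ex_derive_continuous (fun x => exp (- x))); auto_derive; trivial.
Qed.

Lemma RInt_tail_pos (f : R -> R) (K a b : R) :
  (forall x, continuous f x) -> (forall x, Rabs (f x) <= K * exp (- Rabs x)) ->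
  0 <= a <= b -> Rabs (RInt f a b) <= K * exp (- a).
Proof.
  intros Hc HK Hab.
  assert (K0 : 0 <= K).
  { generalize (HK 0). rewrite Rabs_R0, Ropp_0, exp_0. generalize (Rabs_pos (f 0)). lra. }
  apply Rle_trans with (RInt (fun x => K * exp (- x)) a b).
  - apply Rle_trans with (RInt (fun t => Rabs (f t)) a b).
    + apply abs_RInt_le; [lra | apply ex_RInt_cont; auto].
    + apply RInt_le; [lra | | |].
      * apply ex_RInt_cont. intros; apply continuous_comp; [auto | apply continuous_Rabs].
      * apply ex_RInt_cont. intros; apply (ex_derive_continuous (fun x => K * exp (- x))).
        auto_derive; trivial.
      * intros x Hx. rewrite <- (Rabs_pos_eq x) at 2 by lra. apply HK.
  - replace (RInt (fun x => K * exp (- x)) a b) with (K * (exp (- a) - exp (- b))).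
    + generalize (exp_pos (- b)). nra.
    + rewrite <- RInt_exp_neg. symmetry.
      apply (RInt_scal (V := R_CompleteNormedModule) (fun x => exp (- x)) a b K).
      apply ex_RInt_cont. intros; apply (ex_derive_continuous (fun x => exp (- x))).
      auto_derive; trivial.
Qed.

Lemma RInt_reflect (f : R -> R) (a b : R) :
  (forall x, continuous f x) -> RInt f a b = RInt (fun x => f (- x)) (- b) (- a).
Proof.
  intros Hc.
  symmetry. apply is_RInt_unique.
  assert (H : is_RInt f (-1 * - b + 0) (-1 * - a + 0) (- RInt f a b)).
  { replace (-1 * - b + 0) with b by ring. replace (-1 * - a + 0) with a by ring.
    apply (is_RInt_swap (V := R_NormedModule)).
    apply (RInt_correct (V := R_CompleteNormedModule)), ex_RInt_cont; auto. }
  apply (is_RInt_comp_lin (V := R_NormedModule)) in H.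
  apply (is_RInt_opp (V := R_NormedModule)) in H.
  replace (RInt f a b) with (opp (- RInt f a b)) by (unfold opp; simpl; ring).
  revert H. apply (is_RInt_ext (V := R_NormedModule)).
  intros x _. unfold scal, opp; simpl; unfold mult; simpl.
  replace (-1 * x + 0) with (- x) by ring. ring.
Qed.

Lemma RInt_tail_neg (f : R -> R) (K a b : R) :
  (forall x, continuous f x) -> (forall x, Rabs (f x) <= K * exp (- Rabs x)) ->
  a <= b <= 0 -> Rabs (RInt f a b) <= K * exp b.
Proof.
  intros Hc HK Hab. rewrite RInt_reflect by auto.
  replace b with (- - b) at 2 by ring.
  apply RInt_tail_pos; [| | lra].
  - intros x. apply (continuous_comp (fun x => - x) f); [| auto].
    apply (ex_derive_continuous (fun x => - x)). auto_derive; trivial.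
  - intros x. rewrite <- (Rabs_Ropp x). apply HK.
Qed.

(** Both intervals contain [-N, N], and each of the four outer pieces is a tail of size at most K
    exp(-N). This is the Cauchy criterion behind [lineint_spec] and the origin of its constant 4. *)
Lemma RInt_trunc_diff (f : R -> R) (K N a b a' b' : R) :
  (forall x, continuous f x) -> (forall x, Rabs (f x) <= K * exp (- Rabs x)) ->
  0 <= N -> a <= - N -> N <= b -> a' <= - N -> N <= b' ->
  Rabs (RInt f a b - RInt f a' b') <= 4 * K * exp (- N).
Proof.
  intros Hc HK HN Ha Hb Ha' Hb'.
  assert (Hcore : forall a b, a <= - N -> N <= b ->
     Rabs (RInt f a b - RInt f (- N) N) <= 2 * K * exp (- N)).
  { intros u v Hu Hv.
    rewrite <- (RInt_Chasles (V := R_CompleteNormedModule) f u (- N) v);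
      try apply ex_RInt_cont; auto.
    rewrite <- (RInt_Chasles (V := R_CompleteNormedModule) f (- N) N v);
      try apply ex_RInt_cont; auto.
    unfold plus; simpl.
    generalize (RInt_tail_neg f K u (- N) Hc HK ltac:(lra)).
    generalize (RInt_tail_pos f K N v Hc HK ltac:(lra)).
    unfold Rabs; repeat destruct Rcase_abs; lra. }
  generalize (Hcore a b Ha Hb) (Hcore a' b' Ha' Hb').
  unfold Rabs; repeat destruct Rcase_abs; lra.
Qed.

(** The second half is the working tool: N = 0 turns it into a bound for the integral, and large N
    replaces the improper integral by truncations in the lemmas that follow. *)
Lemma lineint_spec (f : R -> R) (K : R) :
  (forall x, continuous f x) -> (forall x, Rabs (f x) <= K * exp (- Rabs x)) ->
  is_RInt_gen f (Rbar_locally m_infty) (Rbar_locally p_infty) (lineint f) /\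
  (forall N a b, 0 <= N -> a <= - N -> N <= b ->
     Rabs (RInt f a b - lineint f) <= 4 * K * exp (- N)).
Proof.
  intros Hc HK.
  assert (K0 : 0 <= K).
  { generalize (HK 0). rewrite Rabs_R0, Ropp_0, exp_0. generalize (Rabs_pos (f 0)). lra. }
  assert (HF : forall N, filter_prod (Rbar_locally m_infty) (Rbar_locally p_infty)
      (fun ab : R * R => fst ab <= - N /\ N <= snd ab)).
  { intros N. exists (fun x => x < - N) (fun x => N < x).
    - exists (- N); auto.
    - exists N; auto.
    - simpl; intros; lra. }
  (* Since exp N >= 1 + N, the threshold 4 K / eps is already large enough. *)
  assert (HN : forall eps : posreal, exists N, 0 <= N /\ 4 * K * exp (- N) < eps).
  { intros eps. exists (4 * K / eps).
    assert (0 < eps) by apply cond_pos.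
    assert (0 <= 4 * K / eps).
    { apply Rmult_le_pos; [lra | apply Rlt_le, Rinv_0_lt_compat; auto]. }
    split; auto.
    rewrite exp_Ropp.
    apply Rmult_lt_reg_r with (exp (4 * K / eps)); [apply exp_pos|].
    rewrite Rmult_assoc, Rinv_l by (apply Rgt_not_eq, exp_pos).
    generalize (exp_ineq1_le (4 * K / eps)); intros.
    apply Rlt_le_trans with (eps * (1 + 4 * K / eps)).
    - field_simplify; lra.
    - apply Rmult_le_compat_l; lra. }
  destruct (proj1 (filterlim_locally_cauchy (U := R_CompleteNormedModule)
     (F := filter_prod (Rbar_locally m_infty) (Rbar_locally p_infty))
     (fun ab : R * R => RInt f (fst ab) (snd ab)))) as [l Hl].
  { intros eps. destruct (HN eps) as [N [N0 HNe]].
    exists (fun ab => fst ab <= - N /\ N <= snd ab). split; [apply HF|].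
    intros [a b] [a' b'] [H1 H2] [H3 H4]; simpl in *.
    unfold ball; simpl; unfold AbsRing_ball, abs, minus, plus, opp; simpl.
    eapply Rle_lt_trans; [| apply HNe].
    replace (RInt f a' b' + - RInt f a b) with (RInt f a' b' - RInt f a b) by ring.
    apply RInt_trunc_diff; auto. }
  assert (Hi : is_RInt_gen f (Rbar_locally m_infty) (Rbar_locally p_infty) l).
  { intros P HP. unfold filtermapi. specialize (Hl P HP). unfold filtermap in Hl.
    revert Hl. apply filter_imp. intros [a b] Hab. exists (RInt f a b). split; auto.
    apply (RInt_correct (V := R_CompleteNormedModule)), ex_RInt_cont; auto. }
  assert (El : lineint f = l).
  { exact (is_RInt_gen_unique (V := R_CompleteNormedModule) f l Hi). }
  split. { rewrite El; auto. }
  rewrite El. intros N a b HN0 Ha Hb.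
  apply le_epsilon. intros e He.
  assert (HB := Hl (ball l (mkposreal e He)) (locally_ball _ _)).
  unfold filtermap in HB.
  destruct (filter_ex _ (filter_and _ _ HB (HF N))) as [[a' b'] [H1 [H2 H3]]].
  simpl in *.
  unfold ball in H1; simpl in H1; unfold AbsRing_ball, abs, minus, plus, opp in H1; simpl in H1.
  generalize (RInt_trunc_diff f K N a b a' b' Hc HK HN0 Ha Hb H2 H3).
  revert H1. unfold Rabs; repeat destruct Rcase_abs; lra.
Qed.

Definition dominated (f : R -> R) : Prop :=
  (forall x, continuous f x) /\
  exists K, forall x, Rabs (f x) <= K * exp (- Rabs x).

Lemma lineint_bound (f : R -> R) (K : R) :
  (forall x, continuous f x) -> (forall x, Rabs (f x) <= K * exp (- Rabs x)) ->
  Rabs (lineint f) <= 4 * K.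
Proof.
  intros Hc HK. destruct (lineint_spec f K Hc HK) as [_ H].
  (* The truncation to the degenerate interval [0, 0] is zero, so its error is the integral
     itself. *)
  specialize (H 0 0 0 ltac:(lra) ltac:(lra) ltac:(lra)).
  rewrite (RInt_point (V := R_CompleteNormedModule)) in H.
  rewrite Ropp_0, exp_0 in H. unfold zero in H; simpl in H.
  rewrite Rminus_0_l, Rabs_Ropp in H. lra.
Qed.

Lemma dominated_is_RInt_gen (f : R -> R) :
  dominated f ->
  is_RInt_gen f (Rbar_locally m_infty) (Rbar_locally p_infty) (lineint f).
Proof. intros [Hc [K HK]]. apply (lineint_spec f K Hc HK). Qed.

Lemma exp_neg_small (K eps : R) :
  0 < eps -> exists N0, 0 <= N0 /\ forall N, N0 <= N -> K * exp (- N) <= eps.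
Proof.
  intros He. exists (Rabs K / eps).
  assert (0 <= Rabs K / eps).
  { apply Rmult_le_pos; [apply Rabs_pos | apply Rlt_le, Rinv_0_lt_compat; auto]. }
  split; auto. intros N HN.
  apply Rle_trans with (Rabs K * exp (- N)).
  { apply Rmult_le_compat_r; [apply Rlt_le, exp_pos | apply Rle_abs]. }
  rewrite exp_Ropp.
  apply Rmult_le_reg_r with (exp N); [apply exp_pos|].
  rewrite Rmult_assoc, Rinv_l by (apply Rgt_not_eq, exp_pos).
  generalize (exp_ineq1_le N); intros.
  assert (eps * (Rabs K / eps) <= eps * exp N) by (apply Rmult_le_compat_l; lra).
  replace (eps * (Rabs K / eps)) with (Rabs K) in H1 by (field; lra). lra.
Qed.

(** Domination already gives convergence, so symmetric truncations suffice to identify the value. *)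
Lemma lineint_unique (f : R -> R) (l : R) :
  dominated f ->
  (forall eps, 0 < eps -> exists N0, forall N, N0 <= N -> Rabs (RInt f (- N) N - l) <= eps) ->
  lineint f = l.
Proof.
  intros [Hc [K HK]] H. destruct (lineint_spec f K Hc HK) as [_ Hs].
  apply cond_eq. intros eps He.
  destruct (H (eps / 3) ltac:(lra)) as [N1 H1].
  destruct (exp_neg_small (4 * K) (eps / 3) ltac:(lra)) as [N2 [H20 H2]].
  set (N := Rmax N1 N2).
  assert (N1 <= N) by apply Rmax_l. assert (N2 <= N) by apply Rmax_r. clearbody N.
  specialize (H1 N ltac:(lra)). specialize (H2 N ltac:(lra)).
  specialize (Hs N (- N) N ltac:(lra) ltac:(lra) ltac:(lra)).
  revert H1 Hs. unfold Rabs; repeat destruct Rcase_abs; lra.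
Qed.

Lemma lineint_approx (f : R -> R) (eps : R) :
  dominated f -> 0 < eps ->
  exists N0, forall N, N0 <= N -> Rabs (RInt f (- N) N - lineint f) <= eps.
Proof.
  intros [Hc [K HK]] He. destruct (lineint_spec f K Hc HK) as [_ Hs].
  destruct (exp_neg_small (4 * K) eps He) as [N2 [H20 H2]].
  exists N2. intros N HN. eapply Rle_trans; [apply (Hs N); lra | auto].
Qed.

Lemma lineint_ext (f g : R -> R) : (forall x, f x = g x) -> lineint f = lineint g.
Proof.
  intros H. f_equal.
  apply FunctionalExtensionality.functional_extensionality; auto.
Qed.

Lemma dominated_plus (f g : R -> R) :
  dominated f -> dominated g -> dominated (fun x => f x + g x).
Proof.
  intros [Hf [K HK]] [Hg [L HL]]. split.
  - intros x. apply (continuous_plus (V := R_NormedModule) f g); auto.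
  - exists (K + L). intros x. eapply Rle_trans; [apply Rabs_triang|].
    rewrite Rmult_plus_distr_r. apply Rplus_le_compat; auto.
Qed.

Lemma dominated_scal (c : R) (f : R -> R) :
  dominated f -> dominated (fun x => c * f x).
Proof.
  intros [Hf [K HK]]. split.
  - intros x. apply (continuous_scal_r (V := R_NormedModule) c f); auto.
  - exists (Rabs c * K). intros x. rewrite Rabs_mult, Rmult_assoc.
    apply Rmult_le_compat_l; [apply Rabs_pos | auto].
Qed.

Lemma lineint_plus (f g : R -> R) :
  dominated f -> dominated g ->
  lineint (fun x => f x + g x) = lineint f + lineint g.
Proof.
  intros Hf Hg.
  exact (is_RInt_gen_unique (V := R_CompleteNormedModule) _ _
    (is_RInt_gen_plus _ _ _ _ (dominated_is_RInt_gen f Hf) (dominated_is_RInt_gen g Hg))).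
Qed.

Lemma lineint_scal (c : R) (f : R -> R) :
  dominated f -> lineint (fun x => c * f x) = c * lineint f.
Proof.
  intros Hf.
  exact (is_RInt_gen_unique (V := R_CompleteNormedModule) _ _
    (is_RInt_gen_scal _ c _ (dominated_is_RInt_gen f Hf))).
Qed.

Lemma dominated_ext (f g : R -> R) :
  (forall x, f x = g x) -> dominated f -> dominated g.
Proof.
  intros H. replace g with f; auto.
  apply FunctionalExtensionality.functional_extensionality; auto.
Qed.

Lemma RInt_FTC (F f : R -> R) (a b : R) :
  (forall x, is_derive F x (f x)) -> (forall x, continuous f x) ->
  RInt f a b = F b - F a.
Proof.
  intros HF Hf. apply is_RInt_unique.
  apply (is_RInt_derive (V := R_CompleteNormedModule) F f); auto.
Qed.

(** Integration by parts with vanishing boundary terms; through [cint_derive] it yields the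
    recurrences of the Airy and of the Bessel moments. *)
Lemma lineint_derive (F f : R -> R) :
  (forall x, is_derive F x (f x)) -> dominated f ->
  (exists K, forall x, Rabs (F x) <= K * exp (- Rabs x)) -> lineint f = 0.
Proof.
  intros HF Hf [K HK]. apply lineint_unique; auto. intros eps He.
  destruct (exp_neg_small (2 * K) eps He) as [N0 [H0 HN0]].
  exists N0. intros N HN. specialize (HN0 N HN).
  rewrite (RInt_FTC F) by (auto; apply Hf).
  generalize (HK N) (HK (- N)). rewrite Rabs_Ropp, (Rabs_pos_eq N) by lra.
  unfold Rabs; repeat destruct Rcase_abs; lra.
Qed.

Lemma lineint_dilate (f : R -> R) (c : R) :
  0 < c -> dominated f -> dominated (fun x => f (c * x)) ->
  lineint f = c * lineint (fun x => f (c * x)).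
Proof.
  intros Hc Hf Hg. apply lineint_unique; auto. intros eps He.
  destruct (lineint_approx (fun x => f (c * x)) (eps / c) Hg) as [N0 HN0].
  { apply Rmult_lt_0_compat; [auto | apply Rinv_0_lt_compat; auto]. }
  exists (c * N0). intros N HN.
  specialize (HN0 (N / c)).
  assert (HNc : N0 <= N / c).
  { apply Rmult_le_reg_l with c; auto. replace (c * (N / c)) with N by (field; lra). auto. }
  specialize (HN0 HNc).
  replace (RInt f (- N) N) with (c * RInt (fun x => f (c * x)) (- (N / c)) (N / c)).
  - rewrite <- Rmult_minus_distr_l, Rabs_mult, (Rabs_pos_eq c) by lra.
    replace eps with (c * (eps / c)) by (field; lra).
    apply Rmult_le_compat_l; [lra | auto].
  - symmetry. apply is_RInt_unique.
    replace (- N) with (c * (- (N / c)) + 0) by (field; lra).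
    replace N with (c * (N / c) + 0) at 2 by (field; lra).
    assert (Hi : ex_RInt f (c * - (N / c) + 0) (c * (N / c) + 0)) by (apply ex_RInt_cont, Hf).
    apply (RInt_correct (V := R_CompleteNormedModule)) in Hi.
    assert (Hj := Hi).
    apply (is_RInt_comp_lin (V := R_NormedModule)) in Hj.
    replace (c * RInt (fun x => f (c * x)) (- (N / c)) (N / c))
      with (RInt f (c * - (N / c) + 0) (c * (N / c) + 0)); auto.
    rewrite <- (is_RInt_unique (V := R_CompleteNormedModule) _ _ _ _ Hj).
    transitivity (RInt (fun x => c * f (c * x)) (- (N / c)) (N / c)).
    + apply RInt_ext. intros x _. rewrite Rplus_0_r. reflexivity.
    + apply (RInt_scal (V := R_CompleteNormedModule) (fun x => f (c * x))).
      apply ex_RInt_cont, Hg.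
Qed.

(** * Complex-valued integrands *)

Definition cint (f : R -> C) : C :=
  (lineint (fun x => Re (f x)), lineint (fun x => Im (f x))).

Definition Cdominated (f : R -> C) : Prop :=
  dominated (fun x => Re (f x)) /\ dominated (fun x => Im (f x)).

Definition Ccont (f : R -> C) : Prop :=
  (forall x, continuous (fun u => Re (f u)) x) /\
  (forall x, continuous (fun u => Im (f u)) x).

Lemma Cmod_le (z : C) : Cmod z <= Rabs (Re z) + Rabs (Im z).
Proof.
  destruct z as [a b]. unfold Cmod, Re, Im; simpl.
  apply Rsqr_incr_0_var.
  - rewrite Rsqr_sqrt by nra.
    unfold Rsqr. generalize (Rabs_pos a) (Rabs_pos b).
    rewrite !Rmult_1_r. intros.
    assert (Rabs a * Rabs a = a * a) by (rewrite <- Rabs_mult; apply Rabs_pos_eq; nra).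
    assert (Rabs b * Rabs b = b * b) by (rewrite <- Rabs_mult; apply Rabs_pos_eq; nra).
    nra.
  - generalize (Rabs_pos a) (Rabs_pos b); lra.
Qed.

Lemma Re_le (z : C) : Rabs (Re z) <= Cmod z.
Proof. apply Rle_trans with (2 := Rmax_Cmod z). apply Rmax_l. Qed.

Lemma Im_le (z : C) : Rabs (Im z) <= Cmod z.
Proof. apply Rle_trans with (2 := Rmax_Cmod z). apply Rmax_r. Qed.

Lemma Cdominated_intro (f : R -> C) (K : R) :
  Ccont f -> (forall x, Cmod (f x) <= K * exp (- Rabs x)) -> Cdominated f.
Proof.
  intros [H1 H2] H. split; split; auto; exists K; intros x;
    (eapply Rle_trans; [|apply H]); [apply Re_le | apply Im_le].
Qed.

Lemma cint_bound (f : R -> C) (K : R) :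
  Ccont f -> (forall x, Cmod (f x) <= K * exp (- Rabs x)) -> Cmod (cint f) <= 8 * K.
Proof.
  intros [H1 H2] H. eapply Rle_trans; [apply Cmod_le|]. unfold cint; simpl.
  replace (8 * K) with (4 * K + 4 * K) by ring.
  apply Rplus_le_compat; apply lineint_bound; auto; intros x;
    (eapply Rle_trans; [|apply H]); [apply Re_le | apply Im_le].
Qed.

Lemma cint_ext (f g : R -> C) : (forall x, f x = g x) -> cint f = cint g.
Proof. intros H. unfold cint. f_equal; apply lineint_ext; intros; rewrite H; auto. Qed.

Lemma Cdominated_ext (f g : R -> C) :
  (forall x, f x = g x) -> Cdominated f -> Cdominated g.
Proof.
  intros H. replace g with f; auto.
  apply FunctionalExtensionality.functional_extensionality; auto.
Qed.

Lemma Cdominated_plus (f g : R -> C) :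
  Cdominated f -> Cdominated g -> Cdominated (fun x => Cplus (f x) (g x)).
Proof. intros [H1 H2] [H3 H4]. split; simpl; apply dominated_plus; auto. Qed.

Lemma cint_plus (f g : R -> C) :
  Cdominated f -> Cdominated g ->
  cint (fun x => Cplus (f x) (g x)) = Cplus (cint f) (cint g).
Proof.
  intros [H1 H2] [H3 H4]. unfold cint, Cplus; simpl.
  f_equal; rewrite <- lineint_plus; auto.
Qed.

Lemma Cdominated_scal (c : C) (f : R -> C) :
  Cdominated f -> Cdominated (fun x => Cmult c (f x)).
Proof.
  intros [H1 H2]. destruct c as [a b]. split; simpl.
  - apply (dominated_ext (fun x => a * Re (f x) + - b * Im (f x))).
    { intros; unfold Re, Im; ring. }
    apply dominated_plus; apply dominated_scal; auto.
  - apply (dominated_ext (fun x => a * Im (f x) + b * Re (f x))).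
    { intros; unfold Re, Im; ring. }
    apply dominated_plus; apply dominated_scal; auto.
Qed.

Lemma cint_scal (c : C) (f : R -> C) :
  Cdominated f -> cint (fun x => Cmult c (f x)) = Cmult c (cint f).
Proof.
  intros [H1 H2]. destruct c as [a b]. unfold cint, Cmult; simpl. f_equal.
  - rewrite (lineint_ext _ (fun x => a * Re (f x) + - b * Im (f x)))
      by (intros; unfold Re, Im; ring).
    rewrite lineint_plus by (apply dominated_scal; auto).
    rewrite !lineint_scal by auto. ring.
  - rewrite (lineint_ext _ (fun x => a * Im (f x) + b * Re (f x)))
      by (intros; unfold Re, Im; ring).
    rewrite lineint_plus by (apply dominated_scal; auto).
    rewrite !lineint_scal by auto. ring.
Qed.

Lemma cint_dilate (f : R -> C) (c : R) :
  0 < c -> Cdominated f -> Cdominated (fun x => f (c * x)) ->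
  cint f = Cmult (RtoC c) (cint (fun x => f (c * x))).
Proof.
  intros Hc [H1 H2] [H3 H4]. unfold cint, Cmult, RtoC; simpl. f_equal.
  - rewrite (lineint_dilate _ c Hc H1 H3). ring.
  - rewrite (lineint_dilate _ c Hc H2 H4). ring.
Qed.

(** Balls of C are products of balls here, so both components may be handled separately. *)
Lemma cint_RInt_gen (f : R -> C) :
  Cdominated f ->
  RInt_gen (V := C_R_CompleteNormedModule) f
    (Rbar_locally m_infty) (Rbar_locally p_infty) = cint f.
Proof.
  intros [H1 H2].
  refine (is_RInt_gen_unique (V := C_R_CompleteNormedModule) f (cint f) _).
  apply dominated_is_RInt_gen in H1. apply dominated_is_RInt_gen in H2.
  intros P [eps HP].
  assert (B1 := H1 (ball (lineint (fun x => Re (f x))) eps) (locally_ball _ _)).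
  assert (B2 := H2 (ball (lineint (fun x => Im (f x))) eps) (locally_ball _ _)).
  unfold filtermapi in *.
  generalize (filter_and _ _ B1 B2). apply filter_imp.
  intros [a b] [[y1 [I1 P1]] [y2 [I2 P2]]].
  exists (y1, y2). split.
  - apply (is_RInt_fct_extend_pair (U := R_NormedModule) (V := R_NormedModule)); auto.
  - apply HP. split; auto.
Qed.

(** * Complex-valued functions of a real variable *)

Definition dC (f : R -> C) (x : R) (l : C) : Prop :=
  is_derive (fun u => Re (f u)) x (Re l) /\ is_derive (fun u => Im (f u)) x (Im l).

Lemma Ceq (a b : C) : Re a = Re b -> Im a = Im b -> a = b.
Proof. destruct a, b; unfold Re, Im; simpl; intros; subst; auto. Qed.

Lemma Ci2 : Cmult Ci Ci = RtoC (-1).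
Proof. apply Ceq; simpl; ring. Qed.

Lemma dC_eq (f : R -> C) (x : R) (l l' : C) : dC f x l -> l = l' -> dC f x l'.
Proof. intros; subst; auto. Qed.

Lemma dC_ext (f g : R -> C) (x : R) (l : C) : (forall u, f u = g u) -> dC f x l -> dC g x l.
Proof.
  intros H. replace g with f; auto.
  apply FunctionalExtensionality.functional_extensionality; auto.
Qed.

Lemma dC_const (c : C) (x : R) : dC (fun _ => c) x 0%C.
Proof. split; simpl; apply @is_derive_const. Qed.

Lemma dC_real (f : R -> R) (x l : R) : is_derive f x l -> dC (fun u => RtoC (f u)) x (RtoC l).
Proof. intros H. split; simpl; auto. apply @is_derive_const. Qed.

Lemma dC_plus (f g : R -> C) (x : R) (a b : C) :
  dC f x a -> dC g x b -> dC (fun u => Cplus (f u) (g u)) x (Cplus a b).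
Proof.
  intros [H1 H2] [H3 H4]. split; simpl.
  - apply (is_derive_plus (fun u => Re (f u)) (fun u => Re (g u))); auto.
  - apply (is_derive_plus (fun u => Im (f u)) (fun u => Im (g u))); auto.
Qed.

Lemma is_derive_multR (f g : R -> R) (x a b : R) :
  is_derive f x a -> is_derive g x b ->
  is_derive (fun u => f u * g u) x (a * g x + f x * b).
Proof.
  intros H1 H2. apply (is_derive_mult f g x a b H1 H2). intros; apply Rmult_comm.
Qed.

Lemma dC_mult (f g : R -> C) (x : R) (a b : C) :
  dC f x a -> dC g x b ->
  dC (fun u => Cmult (f u) (g u)) x (Cplus (Cmult a (g x)) (Cmult (f x) b)).
Proof.
  intros [H1 H2] [H3 H4]. split; simpl.
  - assert (K := is_derive_minus _ _ _ _ _ (is_derive_multR _ _ _ _ _ H1 H3)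
                   (is_derive_multR _ _ _ _ _ H2 H4)).
    unfold minus, plus, opp in K; simpl in K.
    unfold Re, Im in *.
    match goal with |- is_derive _ _ ?l => match type of K with is_derive _ _ ?l' =>
      replace l with l' by ring end end.
    exact K.
  - assert (K := is_derive_plus _ _ _ _ _ (is_derive_multR _ _ _ _ _ H1 H4)
                   (is_derive_multR _ _ _ _ _ H2 H3)).
    unfold plus in K; simpl in K.
    unfold Re, Im in *.
    match goal with |- is_derive _ _ ?l => match type of K with is_derive _ _ ?l' =>
      replace l with l' by ring end end.
    refine (is_derive_ext _ _ _ _ _ K). intros t. simpl. ring.
Qed.

Lemma dC_scal (c : C) (f : R -> C) (x : R) (a : C) :
  dC f x a -> dC (fun u => Cmult c (f u)) x (Cmult c a).
Proof.
  intros H. eapply dC_eq. { apply dC_mult; [apply dC_const | apply H]. }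
  simpl. ring.
Qed.

Lemma dC_Cexp (f : R -> C) (x : R) (a : C) :
  dC f x a -> dC (fun u => Cexp (f u)) x (Cmult a (Cexp (f x))).
Proof.
  intros [H1 H2].
  assert (dC (fun u => RtoC (exp (Re (f u)))) x (RtoC (Re a * exp (Re (f x))))).
  { apply dC_real. apply (is_derive_comp exp); auto. apply is_derive_exp. }
  assert (dC (fun u => (cos (Im (f u)), sin (Im (f u))))%C x
             (Im a * - sin (Im (f x)), Im a * cos (Im (f x)))).
  { split; simpl.
    - apply (is_derive_comp cos); auto. apply is_derive_cos.
    - apply (is_derive_comp sin); auto. apply is_derive_sin. }
  unfold Cexp. eapply dC_eq. { apply dC_mult; eauto. }
  apply Ceq; unfold Re, Im; simpl; ring.
Qed.

Lemma dC_pow (f : R -> C) (x : R) (a : C) (n : nat) :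
  dC f x a -> dC (fun u => Cpow (f u) (S n)) x (Cmult (RtoC (INR (S n))) (Cmult a (Cpow (f x) n))).
Proof.
  intros H. induction n.
  - apply (dC_ext f). { intros; rewrite Cpow_1_r; auto. }
    eapply dC_eq; [apply H |]. simpl. ring.
  - apply (dC_ext (fun u => Cmult (f u) (Cpow (f u) (S n)))).
    { intros; rewrite (Cpow_S _ (S n)); auto. }
    eapply dC_eq. { apply dC_mult; [apply H | apply IHn]. }
    rewrite !S_INR, !RtoC_plus, Cpow_S. ring.
Qed.

Lemma Ccont_dC (f f' : R -> C) : (forall x, dC f x (f' x)) -> Ccont f.
Proof.
  intros H. split; intros x; apply (ex_derive_continuous (V := R_NormedModule)).
  - exists (Re (f' x)). exact (proj1 (H x)).
  - exists (Im (f' x)). exact (proj2 (H x)).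
Qed.

Lemma Ccont_mult (f g : R -> C) : Ccont f -> Ccont g -> Ccont (fun x => Cmult (f x) (g x)).
Proof.
  intros [H1 H2] [H3 H4]. split; intros x; simpl.
  - apply (continuous_minus (V := R_NormedModule)
      (fun u => Re (f u) * Re (g u)) (fun u => Im (f u) * Im (g u)));
    apply (continuous_mult (K := R_AbsRing)); auto.
  - apply (continuous_plus (V := R_NormedModule)
      (fun u => Re (f u) * Im (g u)) (fun u => Im (f u) * Re (g u)));
    apply (continuous_mult (K := R_AbsRing)); auto.
Qed.

Lemma Ccont_plus (f g : R -> C) : Ccont f -> Ccont g -> Ccont (fun x => Cplus (f x) (g x)).
Proof.
  intros [H1 H2] [H3 H4]. split; intros x; simpl.
  - apply (continuous_plus (V := R_NormedModule) (fun u => Re (f u)) (fun u => Re (g u))); auto.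
  - apply (continuous_plus (V := R_NormedModule) (fun u => Im (f u)) (fun u => Im (g u))); auto.
Qed.

Lemma Ccont_const (c : C) : Ccont (fun _ => c).
Proof. apply (Ccont_dC _ (fun _ => 0%C)). intros; apply dC_const. Qed.

Lemma cint_derive (F f : R -> C) :
  (forall x, dC F x (f x)) -> Cdominated f ->
  (exists K, forall x, Cmod (F x) <= K * exp (- Rabs x)) -> cint f = 0%C.
Proof.
  intros HF [H1 H2] [K HK]. unfold cint. apply Ceq; simpl.
  - apply (lineint_derive (fun x => Re (F x))); [apply HF | auto |].
    exists K. intros; eapply Rle_trans; [apply Re_le | auto].
  - apply (lineint_derive (fun x => Im (F x))); [apply HF | auto |].
    exists K. intros; eapply Rle_trans; [apply Im_le | auto].
Qed.

(** For |h| below eps / (|B| + 1) the remainder B h^2 is smaller than eps |h|. *)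
Lemma is_derive_quad (f : R -> R) (x l d B : R) :
  0 < d -> (forall h, Rabs h < d -> Rabs (f (x + h) - f x - h * l) <= B * h ^ 2) ->
  is_derive f x l.
Proof.
  intros Hd H. apply is_derive_Reals. intros eps He.
  assert (HB : 0 < Rmin d (eps / (Rabs B + 1))).
  { apply Rmin_pos; auto. apply Rmult_lt_0_compat; auto. apply Rinv_0_lt_compat.
    generalize (Rabs_pos B); lra. }
  exists (mkposreal _ HB). simpl. intros h Hh0 Hh.
  assert (Hh1 := Rlt_le_trans _ _ _ Hh (Rmin_l _ _)).
  assert (Hh2 := Rlt_le_trans _ _ _ Hh (Rmin_r _ _)).
  specialize (H h Hh1).
  assert (0 < Rabs h) by (apply Rabs_pos_lt; auto).
  replace ((f (x + h) - f x) / h - l) with ((f (x + h) - f x - h * l) / h) by (field; auto).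
  unfold Rdiv. rewrite Rabs_mult, Rabs_inv.
  apply Rmult_lt_reg_r with (Rabs h); auto.
  rewrite Rmult_assoc, Rinv_l, Rmult_1_r by lra.
  eapply Rle_lt_trans; [apply H|].
  assert (Rabs h * (Rabs B + 1) < eps).
  { apply Rmult_lt_reg_r with (/ (Rabs B + 1)).
    - apply Rinv_0_lt_compat. generalize (Rabs_pos B); lra.
    - rewrite Rmult_assoc, Rinv_r by (generalize (Rabs_pos B); lra). unfold Rdiv in Hh2. lra. }
  assert (B <= Rabs B) by apply Rle_abs.
  replace (h ^ 2) with (Rabs h * Rabs h).
  - nra.
  - rewrite <- Rabs_mult, Rabs_pos_eq; nra.
Qed.

Lemma RtoC_m1 : RtoC (-1) = Copp 1%C.
Proof. apply Ceq; simpl; ring. Qed.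

Lemma RtoC_opp' (x : R) : RtoC (- x) = Copp (RtoC x).
Proof. apply Ceq; simpl; ring. Qed.

(** A second-order remainder dominated by B h^2 exp(-|s|) integrates to O(h^2), and [is_derive_quad]
    turns that into a derivative. In both applications the remainder comes from [Cexp_taylor] with
    two terms. *)
Lemma cint_param_derive (f : R -> R -> C) (g : R -> C) (x d B : R) :
  0 < d -> (forall h, Rabs h < d -> Cdominated (f (x + h))) -> Cdominated g ->
  (forall h s, Rabs h < d ->
     Cmod (Cminus (Cminus (f (x + h) s) (f x s)) (Cmult (RtoC h) (g s)))
       <= B * h ^ 2 * exp (- Rabs s)) ->
  dC (fun x => cint (f x)) x (cint g).
Proof.
  intros Hd Hf Hg H.
  assert (Hx : Cdominated (f x)).
  { replace x with (x + 0) by ring. apply Hf. rewrite Rabs_R0; auto. }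
  assert (Hcl : forall h, Rabs h < d ->
    Cmod (Cminus (Cminus (cint (f (x + h))) (cint (f x))) (Cmult (RtoC h) (cint g)))
      <= 8 * (B * h ^ 2)).
  { intros h Hh.
    assert (E : Cminus (Cminus (cint (f (x + h))) (cint (f x))) (Cmult (RtoC h) (cint g))
       = cint (fun s => Cplus (Cplus (f (x + h) s) (Cmult (RtoC (-1)) (f x s)))
            (Cmult (RtoC (- h)) (g s)))).
    { rewrite cint_plus, cint_plus, !cint_scal;
        auto using Cdominated_plus, Cdominated_scal.
      rewrite !RtoC_opp'. ring. }
    rewrite E. apply cint_bound.
    - assert (Cdominated (fun s => Cplus (Cplus (f (x + h) s) (Cmult (RtoC (-1)) (f x s)))
            (Cmult (RtoC (- h)) (g s)))) as [H1 H2]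
        by auto using Cdominated_plus, Cdominated_scal.
      split; [apply H1 | apply H2].
    - intros s. eapply Rle_trans; [|apply H; auto]. right. f_equal.
      rewrite !RtoC_opp'. ring. }
  split.
  - apply (is_derive_quad _ x _ d (8 * B)); auto. intros h Hh.
    eapply Rle_trans; [|eapply Rle_trans; [apply (Hcl h Hh)|lra]].
    eapply Rle_trans; [|apply Re_le]. right. f_equal. unfold Re; simpl. ring.
  - apply (is_derive_quad _ x _ d (8 * B)); auto. intros h Hh.
    eapply Rle_trans; [|eapply Rle_trans; [apply (Hcl h Hh)|lra]].
    eapply Rle_trans; [|apply Im_le]. right. f_equal. unfold Im; simpl. ring.
Qed.

(** * The complex exponential *)

Lemma Cexp_plus (a b : C) : Cexp (Cplus a b) = Cmult (Cexp a) (Cexp b).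
Proof.
  destruct a as [a1 a2], b as [b1 b2]. unfold Cexp, Cplus, Re, Im; simpl.
  rewrite exp_plus, cos_plus, sin_plus. apply Ceq; simpl; ring.
Qed.

Lemma Cexp_0 : Cexp 0 = 1%C.
Proof. unfold Cexp; simpl. rewrite exp_0, cos_0, sin_0. apply Ceq; simpl; ring. Qed.

Lemma Cmod_Cexp (z : C) : Cmod (Cexp z) = exp (Re z).
Proof.
  unfold Cexp. rewrite Cmod_mult, Cmod_R, Rabs_pos_eq by apply Rlt_le, exp_pos.
  replace (Cmod (cos (Im z), sin (Im z))) with 1; [ring|].
  unfold Cmod; simpl. rewrite !Rmult_1_r.
  generalize (sin2_cos2 (Im z)). unfold Rsqr. rewrite Rplus_comm. intros ->.
  symmetry; apply sqrt_1.
Qed.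

(** The index counts terms: [Cexp_poly n] stops at degree n - 1, so its error has order n. *)
Fixpoint Cexp_poly (n : nat) (z : C) : C :=
  match n with
  | O => 0%C
  | S n => Cplus (Cexp_poly n z) (Cmult (RtoC (/ INR (Factorial.fact n))) (Cpow z n))
  end.

Lemma dC_ray (z : C) (s : R) : dC (fun s => Cmult (RtoC s) z) s z.
Proof.
  eapply dC_eq.
  { apply dC_mult; [apply (dC_real (fun s => s)), @is_derive_id | apply dC_const]. }
  unfold one; simpl. ring.
Qed.

Lemma dC_Cexp_poly (n : nat) (z : C) (s : R) :
  dC (fun s => Cexp_poly (S n) (Cmult (RtoC s) z)) s
     (Cmult z (Cexp_poly n (Cmult (RtoC s) z))).
Proof.
  induction n.
  - apply (dC_ext (fun _ => 1%C)).
    { intros u. simpl. apply Ceq; simpl; field. }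
    eapply dC_eq; [apply dC_const|]. simpl; ring.
  - change (dC (fun s => Cplus (Cexp_poly (S n) (Cmult (RtoC s) z))
         (Cmult (RtoC (/ INR (Factorial.fact (S n)))) (Cpow (Cmult (RtoC s) z) (S n)))) s
       (Cmult z (Cplus (Cexp_poly n (Cmult (RtoC s) z))
         (Cmult (RtoC (/ INR (Factorial.fact n))) (Cpow (Cmult (RtoC s) z) n))))).
    eapply dC_eq.
    { apply dC_plus; [apply IHn |].
      apply dC_scal, (dC_pow (fun s => Cmult (RtoC s) z) s z n), dC_ray. }
    rewrite (Cmult_comm z (Cplus _ _)), Cmult_plus_distr_r.
    rewrite (Cmult_comm z (Cexp_poly n _)). f_equal.
    replace (/ INR (Factorial.fact (S n))) with (/ INR (S n) * / INR (Factorial.fact n)).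
    + rewrite !RtoC_mult.
      replace (Cmult (Cmult (RtoC (/ INR (S n))) (RtoC (/ INR (Factorial.fact n))))
        (Cmult (RtoC (INR (S n))) (Cmult z (Cpow (Cmult (RtoC s) z) n))))
        with (Cmult (RtoC (/ INR (S n) * INR (S n)))
          (Cmult (RtoC (/ INR (Factorial.fact n))) (Cmult z (Cpow (Cmult (RtoC s) z) n))))
        by (rewrite RtoC_mult; ring).
      rewrite Rinv_l by (apply not_0_INR; lia). ring.
    + change (Factorial.fact (S n)) with (S n * Factorial.fact n)%nat; rewrite mult_INR, Rinv_mult; auto.
Qed.

(** The factor 2 comes from applying the real mean value theorem to the two components
    separately. *)
Lemma Cmod_mvt (f f' : R -> C) (B : R) :
  (forall s, dC f s (f' s)) -> (forall s, 0 <= s <= 1 -> Cmod (f' s) <= B) ->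
  Cmod (Cminus (f 1) (f 0)) <= 2 * B.
Proof.
  intros H HB. eapply Rle_trans; [apply Cmod_le|].
  assert (Hm : forall g g' : R -> R, (forall s, is_derive g s (g' s)) ->
     (forall s, 0 <= s <= 1 -> Rabs (g' s) <= B) -> Rabs (g 1 - g 0) <= B).
  { intros g g' Hg Hg'. destruct (MVT_gen g 0 1 g') as [c [Hc E]].
    - intros; apply Hg.
    - intros x _. apply continuity_pt_filterlim, (ex_derive_continuous (V := R_NormedModule)).
      exists (g' x); auto.
    - rewrite E. rewrite Rmin_left, Rmax_right in Hc by lra.
      rewrite Rminus_0_r, Rmult_1_r. auto. }
  replace (2 * B) with (B + B) by ring. apply Rplus_le_compat.
  - apply (Hm (fun s => Re (f s)) (fun s => Re (f' s))); [apply H|].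
    intros; eapply Rle_trans; [apply Re_le | auto].
  - apply (Hm (fun s => Im (f s)) (fun s => Im (f' s))); [apply H|].
    intros; eapply Rle_trans; [apply Im_le | auto].
Qed.

(** Along the ray s z the derivative of the remainder of order n + 1 is z times the remainder of
    order n, so [Cmod_mvt] gives an induction. Each step costs a factor 2, whence 2^n instead of 1 /
    n!; the maximum covers both signs of Re z on the ray. *)
Lemma Cexp_taylor (n : nat) (z : C) :
  Cmod (Cminus (Cexp z) (Cexp_poly n z)) <= 2 ^ n * Cmod z ^ n * Rmax 1 (exp (Re z)).
Proof.
  revert z. induction n; intros z.
  - simpl. replace (Cminus (Cexp z) 0) with (Cexp z) by ring.
    rewrite Cmod_Cexp. generalize (Rmax_r 1 (exp (Re z))). lra.
  - set (f := fun s => Cminus (Cexp (Cmult (RtoC s) z)) (Cexp_poly (S n) (Cmult (RtoC s) z))).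
    assert (E : Cminus (Cexp z) (Cexp_poly (S n) z) = Cminus (f 1) (f 0)).
    { unfold f. replace (Cmult (RtoC 1) z) with z by ring.
      replace (Cmult (RtoC 0) z) with (RtoC 0) by ring.
      assert (E0 : forall k, Cexp_poly (S k) (RtoC 0) = 1%C).
      { induction k; [apply Ceq; simpl; field|].
        change (Cexp_poly (S (S k)) (RtoC 0)) with
          (Cplus (Cexp_poly (S k) (RtoC 0)) (Cmult (RtoC (/ INR (Factorial.fact (S k)))) (Cpow (RtoC 0) (S k)))).
        rewrite IHk, Cpow_S. ring. }
      rewrite E0, Cexp_0. ring. }
    rewrite E.
    replace (2 ^ S n * Cmod z ^ S n * Rmax 1 (exp (Re z)))
      with (2 * (Cmod z * (2 ^ n * Cmod z ^ n * Rmax 1 (exp (Re z))))) by (simpl; ring).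
    apply (Cmod_mvt f (fun s => Cmult z (Cminus (Cexp (Cmult (RtoC s) z)) (Cexp_poly n (Cmult (RtoC s) z))))).
    + intros s. unfold f. unfold Cminus.
      eapply dC_eq.
      { apply dC_plus; [apply dC_Cexp, dC_ray|].
        apply (dC_ext (fun s => Cmult (RtoC (-1)) (Cexp_poly (S n) (Cmult (RtoC s) z)))).
        { intros; ring. }
        apply dC_scal, dC_Cexp_poly. }
      rewrite RtoC_m1. ring.
    + intros s Hs. rewrite Cmod_mult. apply Rmult_le_compat_l; [apply Cmod_ge_0|].
      eapply Rle_trans; [apply IHn|].
      rewrite Cmod_mult, Cmod_R, Rabs_pos_eq by lra.
      assert (0 <= Cmod z) by apply Cmod_ge_0.
      apply Rmult_le_compat.
      * apply Rmult_le_pos; apply pow_le; [lra | apply Rmult_le_pos; lra].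
      * generalize (Rmax_l 1 (exp (Re (Cmult (RtoC s) z)))); lra.
      * apply Rmult_le_compat_l; [apply pow_le; lra | apply pow_incr; split].
        -- apply Rmult_le_pos; lra.
        -- rewrite <- (Rmult_1_l (Cmod z)) at 2. apply Rmult_le_compat_r; lra.
      * replace (Re (Cmult (RtoC s) z)) with (s * Re z) by (unfold Re; simpl; ring).
        destruct (Rle_dec 0 (Re z)).
        -- apply Rmax_case; [apply Rmax_l|].
           eapply Rle_trans; [|apply Rmax_r]. destruct (Req_dec (s * Re z) (Re z)) as [e|e].
           ++ rewrite e; lra.
           ++ apply Rlt_le, exp_increasing. nra.
        -- eapply Rle_trans; [|apply Rmax_l]. apply Rmax_case; [lra|].
           rewrite <- exp_0. destruct (Req_dec (s * Re z) 0) as [e|e].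
           ++ rewrite e; lra.
           ++ apply Rlt_le, exp_increasing. nra.
Qed.

(** * Shifting the line of integration *)

Lemma is_derive_continuity_pt (f : R -> R) (x l : R) : is_derive f x l -> continuity_pt f x.
Proof.
  intros H. apply derivable_continuous_pt. exists l. apply is_derive_Reals; auto.
Qed.

(** Cauchy's theorem for a rectangle in differential form: [W] is at once the th-derivative of U and
    the s-derivative of V, so lifting the horizontal side changes its integral only through the two
    vertical sides. *)
Lemma rect_derive (U V W : R -> R -> R) (a b theta : R) :
  (forall th s, is_derive (fun u => U u s) th (W th s)) ->
  (forall th s, is_derive (fun u => V th u) s (W th s)) ->
  (forall th s, continuity_2d_pt W th s) ->
  (forall th s, continuous (U th) s) ->
  is_derive (fun th => RInt (U th) a b) theta (V theta b - V theta a).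
Proof.
  intros HU HV HW Hc.
  assert (HWc : forall s, continuous (W theta) s).
  { intros s. apply continuity_pt_filterlim.
    intros e He. destruct (HW theta s (mkposreal e He)) as [d Hd].
    exists d. split; [apply cond_pos|]. intros y [_ Hy].
    simpl in *. unfold R_dist in *. apply Hd; auto. rewrite Rminus_diag, Rabs_R0. apply cond_pos. }
  replace (V theta b - V theta a) with (RInt (fun s => Derive (fun u => U u s) theta) a b).
  - apply is_derive_RInt_param.
    + apply filter_forall. intros th t _. exists (W th t). apply HU.
    + intros t _. apply (continuity_2d_pt_ext W); auto.
      intros x y. symmetry. apply is_derive_unique, HU.
    + apply filter_forall. intros th. apply ex_RInt_cont. apply Hc.
  - rewrite (RInt_ext _ (W theta)).
    + apply RInt_FTC; auto.
    + intros s _. apply is_derive_unique, HU.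
Qed.

(** The Gronwall arguments and most elementary inequalities below go through this lemma, often with
    a constant on one side. *)
Lemma derive_le_increment (f f' g g' : R -> R) (a b : R) :
  a <= b ->
  (forall x, a <= x <= b -> is_derive f x (f' x)) ->
  (forall x, a <= x <= b -> is_derive g x (g' x)) ->
  (forall x, a <= x <= b -> f' x <= g' x) -> f b - f a <= g b - g a.
Proof.
  intros Hab Hf Hg H.
  assert (Hd : forall x, a <= x <= b -> is_derive (fun x => g x - f x) x (g' x - f' x)).
  { intros x Hx. exact (is_derive_minus g f x _ _ (Hg x Hx) (Hf x Hx)). }
  destruct (MVT_gen (fun x => g x - f x) a b (fun x => g' x - f' x)) as [c [Hc E]].
  - rewrite Rmin_left, Rmax_right by auto. intros; apply Hd; lra.
  - rewrite Rmin_left, Rmax_right by auto. intros x Hx.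
    apply (is_derive_continuity_pt _ x (g' x - f' x)), Hd; lra.
  - rewrite Rmin_left, Rmax_right in Hc by auto. specialize (H c Hc). nra.
Qed.

Lemma derive_abs_le_increment (f f' g g' : R -> R) (a b : R) :
  a <= b ->
  (forall x, a <= x <= b -> is_derive f x (f' x)) ->
  (forall x, a <= x <= b -> is_derive g x (g' x)) ->
  (forall x, a <= x <= b -> Rabs (f' x) <= g' x) -> Rabs (f b - f a) <= g b - g a.
Proof.
  intros Hab Hf Hg H. apply Rabs_le. split.
  - cut (- f b - - f a <= g b - g a); [lra|].
    apply (derive_le_increment (fun x => - f x) (fun x => - f' x) g g'); auto.
    + intros x Hx. exact (is_derive_opp f x _ (Hf x Hx)).
    + intros x Hx. specialize (H x Hx). generalize (Rle_abs (- f' x)). rewrite Rabs_Ropp. lra.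
  - apply (derive_le_increment f f' g g'); auto.
    intros x Hx. specialize (H x Hx). generalize (Rle_abs (f' x)). lra.
Qed.

Lemma lineint_shift (U V W : R -> R -> R) (t1 t2 K : R) :
  (forall th s, is_derive (fun u => U u s) th (W th s)) ->
  (forall th s, is_derive (fun u => V th u) s (W th s)) ->
  (forall th s, continuity_2d_pt W th s) ->
  (forall th s, continuous (U th) s) ->
  t1 <= t2 -> dominated (U t1) -> dominated (U t2) ->
  (forall th s, t1 <= th <= t2 -> Rabs (V th s) <= K * exp (- Rabs s)) ->
  lineint (U t1) = lineint (U t2).
Proof.
  intros HU HV HW Hc Ht H1 H2 HK.
  apply lineint_unique; auto. intros eps He.
  destruct (lineint_approx _ (eps / 2) H2 ltac:(lra)) as [N1 HN1].
  destruct (exp_neg_small (2 * K * (t2 - t1)) (eps / 2) ltac:(lra)) as [N2 [HN20 HN2]].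
  exists (Rmax N1 N2). intros N HN.
  assert (L1 : N1 <= N) by (eapply Rle_trans; [apply Rmax_l | apply HN]).
  assert (L2 : N2 <= N) by (eapply Rle_trans; [apply Rmax_r | apply HN]).
  specialize (HN1 N L1). specialize (HN2 N L2).
  (* The rate of change in th consists of the vertical sides at s = N and s = -N, each at most K
     exp(-N). *)
  assert (D := derive_abs_le_increment (fun th => RInt (U th) (- N) N)
    (fun th => V th N - V th (- N)) (fun th => 2 * K * exp (- N) * th)
    (fun th => 2 * K * exp (- N)) t1 t2 Ht).
  assert (Rabs (RInt (U t2) (- N) N - RInt (U t1) (- N) N) <= eps / 2).
  { eapply Rle_trans; [apply D|].
    - intros th _. apply (rect_derive U V W); auto.
    - intros th _. auto_derive; trivial. ring.
    - intros th Hth. generalize (HK th N Hth) (HK th (- N) Hth).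
      rewrite Rabs_Ropp, (Rabs_pos_eq N) by lra.
      unfold Rabs; repeat destruct Rcase_abs; lra.
    - lra. }
  revert H HN1. unfold Rabs; repeat destruct Rcase_abs; lra.
Qed.

Lemma lineint_reflect (f : R -> R) :
  dominated f -> dominated (fun s => f (- s)) -> lineint f = lineint (fun s => f (- s)).
Proof.
  intros H1 H2. apply lineint_unique; auto. intros eps He.
  destruct (lineint_approx _ eps H2 He) as [N0 HN0]. exists N0. intros N HN.
  rewrite RInt_reflect by apply H1. rewrite Ropp_involutive. auto.
Qed.

Lemma lineint_odd (f : R -> R) :
  dominated f -> (forall s, f (- s) = - f s) -> lineint f = 0.
Proof.
  intros H Ho.
  assert (H' : dominated (fun s => f (- s))).
  { apply (dominated_ext (fun s => -1 * f s)); [|apply dominated_scal; auto].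
    intros; rewrite Ho; ring. }
  assert (E := lineint_reflect f H H').
  rewrite (lineint_ext (fun s => f (- s)) (fun s => -1 * f s)) in E by (intros; rewrite Ho; ring).
  rewrite lineint_scal in E by auto. lra.
Qed.

(** * The Airy integral on the line of imaginary part -1 *)

Definition low_line (s : R) : C := (s, -1).

(** With v = s - i the exponent -i (v^3 / 3 + x v) has real part 1/3 - s^2 - x, so on this line the
    Airy integral and all its moments converge like Gaussians. *)
Definition airy_phase (x s : R) : C :=
  Copp (Cmult Ci (Cplus (Cmult (RtoC (/ 3)) (Cpow (low_line s) 3)) (Cmult (RtoC x) (low_line s)))).

Definition airy_kernel (k : nat) (x s : R) : C :=
  Cmult (Cpow (low_line s) k) (Cexp (airy_phase x s)).

Definition airy_moment (k : nat) (x : R) : C := cint (airy_kernel k x).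

Lemma airy_phase_Re (x s : R) : Re (airy_phase x s) = / 3 - s ^ 2 - x.
Proof. unfold Re; simpl. field. Qed.

Lemma airy_phase_Im (x s : R) : Im (airy_phase x s) = - (s ^ 3 / 3 - s + x * s).
Proof. unfold Im; simpl. field. Qed.

Lemma dC_low_line (s : R) : dC low_line s 1%C.
Proof. split; simpl; [apply @is_derive_id | apply @is_derive_const]. Qed.

Lemma dC_airy_phase (x s : R) :
  dC (airy_phase x) s (Copp (Cmult Ci (Cplus (Cpow (low_line s) 2) (RtoC x)))).
Proof.
  unfold airy_phase.
  apply (dC_ext (fun s => Cmult (Copp Ci) (Cplus (Cmult (RtoC (/ 3)) (Cpow (low_line s) 3))
     (Cmult (RtoC x) (low_line s))))).
  { intros; ring. }
  eapply dC_eq.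
  { apply dC_scal, dC_plus; apply dC_scal.
    - apply (dC_pow low_line s 1%C 2), dC_low_line.
    - apply dC_low_line. }
  apply Ceq; unfold Re, Im; simpl; field.
Qed.

Lemma Ccont_low_line_pow (k : nat) : Ccont (fun s => Cpow (low_line s) k).
Proof.
  destruct k; [exact (Ccont_const 1%C)|].
  eapply Ccont_dC. intros s. apply (dC_pow low_line s 1%C k), dC_low_line.
Qed.

Lemma Ccont_airy_exp (x : R) : Ccont (fun s => Cexp (airy_phase x s)).
Proof. eapply Ccont_dC. intros s. apply dC_Cexp, dC_airy_phase. Qed.

Lemma Ccont_airy_kernel (k : nat) (x : R) : Ccont (airy_kernel k x).
Proof. apply Ccont_mult; [apply Ccont_low_line_pow | apply Ccont_airy_exp]. Qed.

Lemma exp_le (a b : R) : a <= b -> exp a <= exp b.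
Proof. intros [H|H]; [apply Rlt_le, exp_increasing; auto | subst; lra]. Qed.

(** Completing the square in |s| produces the constant; every exponential growth exp(c |s|) is thus
    absorbed, with the decay required by [dominated] left over. *)
Lemma gauss_dominated (c d s : R) :
  0 < d -> exp (c * Rabs s - d * s ^ 2) <= exp ((c + 1) ^ 2 / (4 * d)) * exp (- Rabs s).
Proof.
  intros Hd. rewrite <- exp_plus. apply exp_le.
  replace (s ^ 2) with (Rabs s ^ 2) by (rewrite RPow_abs; apply Rabs_pos_eq, pow2_ge_0).
  generalize (Rabs s). intros u.
  assert (0 <= d * (u - (c + 1) / (2 * d)) ^ 2).
  { apply Rmult_le_pos; [lra | apply pow2_ge_0]. }
  replace (d * (u - (c + 1) / (2 * d)) ^ 2)
    with (d * u ^ 2 - (c + 1) * u + (c + 1) ^ 2 / (4 * d)) in H by (field; lra).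
  lra.
Qed.

Lemma Cmod_low_line_pow (s : R) (k : nat) :
  Cmod (Cpow (low_line s) k) <= exp (INR k * Rabs s + INR k).
Proof.
  rewrite Cmod_pow.
  assert (Cmod (low_line s) <= exp (Rabs s)).
  { eapply Rle_trans; [apply Cmod_le|]. unfold Re, Im; simpl.
    replace (Rabs (-1)) with 1 by (rewrite Rabs_left; lra).
    generalize (exp_ineq1_le (Rabs s)). lra. }
  apply Rle_trans with (exp (INR k * Rabs s)).
  - replace (exp (INR k * Rabs s)) with (exp (Rabs s) ^ k).
    + apply pow_incr. split; [apply Cmod_ge_0 | auto].
    + induction k; [simpl; rewrite Rmult_0_l, exp_0; auto|].
      rewrite S_INR, Rmult_plus_distr_r, Rmult_1_l, exp_plus. simpl. rewrite IHk. ring.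
  - apply exp_le. generalize (pos_INR k). lra.
Qed.

Lemma airy_kernel_bound (k : nat) (x s : R) :
  Cmod (airy_kernel k x s) <= exp (INR k + / 3 - x) * exp (INR k * Rabs s - 1 * s ^ 2).
Proof.
  unfold airy_kernel. rewrite Cmod_mult, Cmod_Cexp, airy_phase_Re.
  apply Rle_trans with (exp (INR k * Rabs s + INR k) * exp (/ 3 - s ^ 2 - x)).
  - apply Rmult_le_compat_r; [apply Rlt_le, exp_pos | apply Cmod_low_line_pow].
  - right. rewrite <- !exp_plus. f_equal. ring.
Qed.

Lemma airy_kernel_dominated (k : nat) (x : R) : Cdominated (airy_kernel k x).
Proof.
  eapply Cdominated_intro; [apply Ccont_airy_kernel|].
  intros s. eapply Rle_trans; [apply airy_kernel_bound|].
  rewrite Rmult_comm.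
  eapply Rle_trans.
  - apply Rmult_le_compat_r; [apply Rlt_le, exp_pos | apply gauss_dominated; lra].
  - right. rewrite Rmult_assoc, (Rmult_comm (exp (- Rabs s))), <- Rmult_assoc. reflexivity.
Qed.

Lemma Cexp_poly_2 (z : C) : Cexp_poly 2 z = Cplus 1 z.
Proof. simpl. apply Ceq; unfold Re, Im; simpl; field. Qed.

(** Each derivative in x brings down -i v. The remainder of exp(-i h v) is quadratic in h v, so the
    kernel with two more powers of v dominates it. *)
Lemma airy_moment_derive (k : nat) (x : R) :
  dC (airy_moment k) x (Copp (Cmult Ci (airy_moment (S k) x))).
Proof.
  replace (Copp (Cmult Ci (airy_moment (S k) x)))
    with (cint (fun s => Cmult (Copp Ci) (airy_kernel (S k) x s))).
  2:{ rewrite cint_scal by apply airy_kernel_dominated. unfold airy_moment. ring. }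
  unfold airy_moment.
  apply (cint_param_derive (airy_kernel k) _ x 1
    (4 * exp 1 * exp (INR (k + 2) + / 3 - x) * exp ((INR (k + 2) + 1) ^ 2 / (4 * 1)))).
  - lra.
  - intros; apply airy_kernel_dominated.
  - apply Cdominated_scal, airy_kernel_dominated.
  - intros h s Hh.
    set (w := Copp (Cmult Ci (Cmult (RtoC h) (low_line s)))).
    assert (E : Cminus (Cminus (airy_kernel k (x + h) s) (airy_kernel k x s))
        (Cmult (RtoC h) (Cmult (Copp Ci) (airy_kernel (S k) x s)))
      = Cmult (airy_kernel k x s) (Cminus (Cexp w) (Cexp_poly 2 w))).
    { rewrite Cexp_poly_2. unfold airy_kernel.
      replace (airy_phase (x + h) s) with (Cplus (airy_phase x s) w).
      - rewrite Cexp_plus, Cpow_S. unfold w. ring.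
      - unfold w, airy_phase. rewrite RtoC_plus. ring. }
    rewrite E, Cmod_mult.
    assert (Ew : Cmod w = Rabs h * Cmod (low_line s)).
    { unfold w. rewrite Cmod_opp, !Cmod_mult, Cmod_Ci, Cmod_R. ring. }
    assert (Ht := Cexp_taylor 2 w). rewrite Ew in Ht.
    assert (Hm : Rmax 1 (exp (Re w)) <= exp 1).
    { assert (Re w = - h) by (unfold w, Re; simpl; ring). rewrite H.
      apply Rmax_case; [generalize (exp_ineq1_le 1); lra|].
      apply exp_le. generalize (Rle_abs (- h)). rewrite Rabs_Ropp. lra. }
    assert (Hk : Cmod (airy_kernel k x s) * Cmod (low_line s) ^ 2
        = Cmod (airy_kernel (k + 2) x s)).
    { unfold airy_kernel. rewrite !Cmod_mult, !Cmod_pow, pow_add. ring. }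
    apply Rle_trans with (4 * exp 1 * h ^ 2 * Cmod (airy_kernel (k + 2) x s)).
    + rewrite <- Hk.
      replace (4 * exp 1 * h ^ 2 * (Cmod (airy_kernel k x s) * Cmod (low_line s) ^ 2))
        with (Cmod (airy_kernel k x s) * (2 ^ 2 * (Rabs h * Cmod (low_line s)) ^ 2 * exp 1)).
      * apply Rmult_le_compat_l; [apply Cmod_ge_0|].
        eapply Rle_trans; [apply Ht|].
        apply Rmult_le_compat_l; [|auto].
        apply Rmult_le_pos; [lra | apply pow2_ge_0].
      * rewrite Rpow_mult_distr, <- (pow2_abs h). ring.
    + replace (4 * exp 1 * exp (INR (k + 2) + / 3 - x) * exp ((INR (k + 2) + 1) ^ 2 / (4 * 1)) *
        h ^ 2 * exp (- Rabs s)) with (4 * exp 1 * h ^ 2 * (exp (INR (k + 2) + / 3 - x) *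
        (exp ((INR (k + 2) + 1) ^ 2 / (4 * 1)) * exp (- Rabs s)))) by ring.
      apply Rmult_le_compat_l.
      { apply Rmult_le_pos; [|apply pow2_ge_0]. generalize (exp_pos 1); lra. }
      eapply Rle_trans; [apply airy_kernel_bound|].
      apply Rmult_le_compat_l; [apply Rlt_le, exp_pos | apply gauss_dominated; lra].
Qed.

Lemma Cdominated_bound (f : R -> C) : Cdominated f ->
  exists K, forall x, Cmod (f x) <= K * exp (- Rabs x).
Proof.
  intros [[_ [K HK]] [_ [L HL]]]. exists (K + L). intros x.
  eapply Rle_trans; [apply Cmod_le|]. rewrite Rmult_plus_distr_r.
  apply Rplus_le_compat; auto.
Qed.

Lemma dC_airy_kernel (k : nat) (x s : R) :
  dC (airy_kernel k x) s
    (Cplus (Cmult (RtoC (INR k)) (airy_kernel (pred k) x s))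
       (Cmult (Copp Ci) (Cplus (airy_kernel (k + 2) x s) (Cmult (RtoC x) (airy_kernel k x s))))).
Proof.
  assert (H := dC_Cexp _ _ _ (dC_airy_phase x s)).
  unfold airy_kernel. destruct k.
  - eapply dC_eq. { apply dC_mult; [apply (dC_const 1%C) | apply H]. }
    simpl. ring.
  - eapply dC_eq.
    { apply dC_mult; [apply (dC_pow low_line s 1%C k), dC_low_line | apply H]. }
    rewrite Cpow_add_r. simpl pred. rewrite Cpow_S. ring.
Qed.

(** The derivative of v^k exp(-i (v^3 / 3 + x v)) integrates to zero. For k = 0 the value of
    [pred 0] is harmless, its coefficient being 0. *)
Lemma airy_moment_rec (k : nat) (x : R) :
  Cplus (airy_moment (k + 2) x) (Cmult (RtoC x) (airy_moment k x))
  = Cmult (Copp Ci) (Cmult (RtoC (INR k)) (airy_moment (pred k) x)).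
Proof.
  assert (E : cint (fun s => Cplus (Cmult (RtoC (INR k)) (airy_kernel (pred k) x s))
       (Cmult (Copp Ci) (Cplus (airy_kernel (k + 2) x s) (Cmult (RtoC x) (airy_kernel k x s)))))
     = 0%C).
  { apply (cint_derive (airy_kernel k x)).
    - intros; apply dC_airy_kernel.
    - auto using Cdominated_plus, Cdominated_scal, airy_kernel_dominated.
    - apply Cdominated_bound, airy_kernel_dominated. }
  rewrite cint_plus, !cint_scal, cint_plus, cint_scal in E;
    auto using Cdominated_plus, Cdominated_scal, airy_kernel_dominated.
  fold (airy_moment (pred k) x) (airy_moment (k + 2) x) (airy_moment k x) in E.
  set (u := Cplus (airy_moment (k + 2) x) (Cmult (RtoC x) (airy_moment k x))) in *.
  set (m := Cmult (RtoC (INR k)) (airy_moment (pred k) x)) in *.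
  assert (E2 : Cmult (Copp Ci) (Cplus m (Cmult (Copp Ci) u)) = 0%C) by (rewrite E; ring).
  replace (Cmult (Copp Ci) (Cplus m (Cmult (Copp Ci) u)))
    with (Cplus (Cmult (Copp Ci) m) (Cmult (Cmult Ci Ci) u)) in E2 by ring.
  rewrite Ci2, RtoC_m1 in E2.
  replace (Cmult (Copp Ci) m) with (Cplus (Cplus (Cmult (Copp Ci) m) (Cmult (Copp (RtoC 1)) u)) u) by ring.
  rewrite E2. ring.
Qed.

Lemma airy_moment_0_Im (x : R) : Im (airy_moment 0 x) = 0.
Proof.
  apply lineint_odd; [exact (proj2 (airy_kernel_dominated 0 x))|].
  intros s. unfold airy_kernel, Cexp. rewrite !airy_phase_Re, !airy_phase_Im.
  unfold Im; simpl.
  replace (- (- s * (- s * (- s * 1)) / 3 - - s + x * - s))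
    with (- - (s * (s * (s * 1)) / 3 - s + x * s)) by field.
  replace (/ 3 - - s * (- s * 1) - x) with (/ 3 - s * (s * 1) - x) by ring.
  rewrite (sin_neg (- _)). ring.
Qed.

(** Up to sign this real part is the derivative of the identically zero [Im (airy_moment 0 x)]. *)
Lemma airy_moment_1_Re (x : R) : Re (airy_moment 1 x) = 0.
Proof.
  assert (H := airy_moment_derive 0 x). destruct H as [_ H].
  assert (H' : is_derive (fun u => Im (airy_moment 0 u)) x 0).
  { apply (is_derive_ext (fun _ => 0)); [intros; symmetry; apply airy_moment_0_Im|].
    apply @is_derive_const. }
  apply is_derive_unique in H. apply is_derive_unique in H'. rewrite H in H'.
  destruct (airy_moment 1 x) as [m1 m2]. unfold Re, Im in *. simpl in *. lra.
Qed.

Lemma cont_of_derive (f : R -> R) (x l : R) : is_derive f x l -> continuous f x.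
Proof. intros H. apply continuity_pt_filterlim, (is_derive_continuity_pt f x l H). Qed.

(** * Passage from the line of imaginary part -1 to the real axis *)

Definition airy_strip_exp (x th s : R) : R := - s ^ 2 * th + th ^ 3 / 3 - x * th.
Definition airy_strip_arg (x th s : R) : R := s ^ 3 / 3 - s * th ^ 2 + x * s.

Definition airy_strip_U (x th s : R) : R :=
  exp (airy_strip_exp x th s) * cos (airy_strip_arg x th s).
Definition airy_strip_V (x th s : R) : R :=
  - exp (airy_strip_exp x th s) * sin (airy_strip_arg x th s).
Definition airy_strip_W (x th s : R) : R :=
  exp (airy_strip_exp x th s) *
   ((- s ^ 2 + th ^ 2 - x) * cos (airy_strip_arg x th s) + 2 * s * th * sin (airy_strip_arg x th s)).

Ltac c2d := repeat first
  [ apply continuity_2d_pt_plus | apply continuity_2d_pt_minus | apply continuity_2d_pt_mult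
  | apply continuity_2d_pt_opp | apply continuity_2d_pt_id1 | apply continuity_2d_pt_id2
  | apply continuity_2d_pt_const
  | apply (continuity_1d_2d_pt_comp exp); [apply derivable_continuous_pt, derivable_pt_exp|]
  | apply (continuity_1d_2d_pt_comp cos); [apply continuity_cos|]
  | apply (continuity_1d_2d_pt_comp sin); [apply continuity_sin|] ].

(** The real Airy integral converges only conditionally, so [lineint_shift] cannot reach th = 0 and
    the shift is made on [0, b]. The side at s = 0 contributes nothing because the argument vanishes
    there; on the side at s = b the factor exp(-b^2 th) integrates to at most 1 / b^2. *)
Lemma airy_strip_contour (x b : R) : 0 < b ->
  Rabs (RInt (airy_strip_U x 1) 0 b - RInt (airy_strip_U x 0) 0 b)
   <= exp (1 + Rabs x) / b ^ 2.
Proof.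
  intros Hb. remember (exp (1 + Rabs x)) as K eqn:HKe.
  assert (HK : 0 < K) by (rewrite HKe; apply exp_pos).
  assert (Hb2 : 0 < b ^ 2) by nra.
  apply Rle_trans with (- K / b ^ 2 * exp (- b ^ 2 * 1) - - K / b ^ 2 * exp (- b ^ 2 * 0)).
  - apply (derive_abs_le_increment (fun th => RInt (airy_strip_U x th) 0 b)
      (fun th => airy_strip_V x th b - airy_strip_V x th 0)
      (fun th => - K / b ^ 2 * exp (- b ^ 2 * th)) (fun th => K * exp (- b ^ 2 * th))); [lra| | |].
    + intros th _. apply (rect_derive (airy_strip_U x) (airy_strip_V x) (airy_strip_W x)).
      * intros. unfold airy_strip_U, airy_strip_W, airy_strip_exp, airy_strip_arg, Rdiv.
        auto_derive; trivial. unfold Rminus; simpl; field.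
      * intros. unfold airy_strip_V, airy_strip_W, airy_strip_exp, airy_strip_arg, Rdiv.
        auto_derive; trivial. unfold Rminus; simpl; field.
      * intros. unfold airy_strip_W, airy_strip_exp, airy_strip_arg, Rdiv, pow. c2d.
      * intros. unfold airy_strip_U, airy_strip_exp, airy_strip_arg.
        eapply cont_of_derive. auto_derive; trivial.
    + intros th _. auto_derive; trivial. simpl. field. lra.
    + intros th Hth. unfold airy_strip_V. unfold airy_strip_arg at 2.
      replace (0 ^ 3 / 3 - 0 * th ^ 2 + x * 0) with 0 by field. rewrite sin_0, Rmult_0_r, Rminus_0_r.
      rewrite Rabs_mult, Rabs_Ropp, (Rabs_pos_eq (exp _)) by apply Rlt_le, exp_pos.
      rewrite <- (Rmult_1_r (K * exp (- b ^ 2 * th))).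
      apply Rmult_le_compat; [apply Rlt_le, exp_pos | apply Rabs_pos | |].
      * rewrite HKe, <- exp_plus. apply exp_le. unfold airy_strip_exp.
        assert (th ^ 3 <= 1) by (replace 1 with (1 ^ 3) by ring; apply pow_incr; lra).
        assert (- x * th <= Rabs x).
        { apply Rle_trans with (Rabs (- x * th)); [apply Rle_abs|].
          rewrite Rabs_mult, Rabs_Ropp, (Rabs_pos_eq th) by lra.
          generalize (Rabs_pos x). nra. }
        lra.
      * apply Rabs_le. generalize (SIN_bound (airy_strip_arg x th b)). lra.
  - rewrite Rmult_0_r, exp_0. generalize (exp_pos (- b ^ 2 * 1)). intros He.
    assert (0 < K / b ^ 2) by (apply Rdiv_lt_0_compat; auto).
    unfold Rdiv in *. nra.
Qed.

Lemma airy_kernel_0_Re (x s : R) : Re (airy_kernel 0 x s) = airy_strip_U x 1 s.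
Proof.
  unfold airy_kernel, Cexp. rewrite airy_phase_Re, airy_phase_Im. unfold Re; simpl.
  unfold airy_strip_U, airy_strip_exp, airy_strip_arg.
  rewrite cos_neg.
  replace (- s ^ 2 * 1 + 1 ^ 3 / 3 - x * 1) with (/ 3 - s * (s * 1) - x) by field.
  replace (s ^ 3 / 3 - s * 1 ^ 2 + x * s) with (s * (s * (s * 1)) / 3 - s + x * s) by field.
  ring.
Qed.

Lemma Ai_eq (x : R) : Ai x = Re (airy_moment 0 x) / (2 * PI).
Proof.
  unfold Ai. set (f := fun s => cos (s ^ 3 / 3 + x * s)).
  assert (Hfc : forall s, continuous f s).
  { intros s. eapply cont_of_derive. unfold f. auto_derive; trivial. }
  assert (E0 : forall s, f s = airy_strip_U x 0 s).
  { intros s. unfold f, airy_strip_U, airy_strip_exp, airy_strip_arg.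
    replace (- s ^ 2 * 0 + 0 ^ 3 / 3 - x * 0) with 0 by field. rewrite exp_0, Rmult_1_l.
    f_equal. ring. }
  assert (Hd : dominated (airy_strip_U x 1)).
  { apply (dominated_ext (fun s => Re (airy_kernel 0 x s))); [apply airy_kernel_0_Re|].
    exact (proj1 (airy_kernel_dominated 0 x)). }
  assert (EM : Re (airy_moment 0 x) = lineint (airy_strip_U x 1)).
  { apply lineint_ext, airy_kernel_0_Re. }
  assert (Hhalf : forall N, RInt (airy_strip_U x 1) (- N) N = 2 * RInt (airy_strip_U x 1) 0 N).
  { intros N. rewrite <- (RInt_Chasles (V := R_CompleteNormedModule) _ (- N) 0 N)
      by (apply ex_RInt_cont, Hd).
    rewrite (RInt_reflect _ (- N) 0) by apply Hd. rewrite Ropp_0, Ropp_involutive.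
    rewrite (RInt_ext (fun s => airy_strip_U x 1 (- s)) (airy_strip_U x 1)).
    - unfold plus; simpl; ring.
    - intros s _. unfold airy_strip_U, airy_strip_exp, airy_strip_arg.
      replace ((- s) ^ 3 / 3 - - s * 1 ^ 2 + x * - s) with (- (s ^ 3 / 3 - s * 1 ^ 2 + x * s)) by field.
      rewrite cos_neg. f_equal. f_equal. ring. }
  enough (E : RInt_gen (V := R_CompleteNormedModule) f (at_point 0) (Rbar_locally p_infty)
            = lineint (airy_strip_U x 1) / 2).
  { rewrite E, EM. field. apply PI_neq0. }
  refine (is_RInt_gen_unique (V := R_CompleteNormedModule) f _ _).
  intros P [eps HP].
  assert (He : 0 < eps) by apply cond_pos.
  destruct (lineint_approx _ (eps / 2) Hd ltac:(lra)) as [N1 HN1].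
  set (K := exp (1 + Rabs x)).
  assert (HK : 0 < K) by apply exp_pos.
  (* For b above this bound and above 1 the shift error K / b^2 is at most eps / 4, and halving the
     truncation error eps / 2 of the full line gives another eps / 4. *)
  set (N2 := 4 * K / eps).
  assert (HN2 : 0 < N2) by (apply Rdiv_lt_0_compat; lra).
  exists (fun a => a = 0) (fun b => Rmax (Rmax N1 N2) 1 < b).
  - reflexivity.
  - exists (Rmax (Rmax N1 N2) 1). auto.
  - intros a b -> Hb. exists (RInt f 0 b). split.
    { apply (RInt_correct (V := R_CompleteNormedModule)), ex_RInt_cont; auto. }
    apply HP. unfold ball; simpl; unfold AbsRing_ball, abs, minus, plus, opp; simpl.
    assert (B1 : N1 <= b).
    { apply Rlt_le. eapply Rle_lt_trans; [|apply Hb].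
      eapply Rle_trans; [apply Rmax_l | apply Rmax_l]. }
    assert (B2 : N2 <= b).
    { apply Rlt_le. eapply Rle_lt_trans; [|apply Hb].
      eapply Rle_trans; [apply Rmax_r | apply Rmax_l]. }
    assert (B3 : 1 < b).
    { eapply Rle_lt_trans; [|apply Hb]. apply Rmax_r. }
    specialize (HN1 b B1). rewrite Hhalf in HN1.
    assert (HC := airy_strip_contour x b ltac:(lra)). fold K in HC.
    rewrite (RInt_ext f (airy_strip_U x 0)) by (intros; apply E0).
    assert (K / b ^ 2 <= eps / 4).
    { apply Rmult_le_reg_r with (b ^ 2); [nra|].
      unfold Rdiv at 1. rewrite Rmult_assoc, Rinv_l by nra.
      assert (eps * N2 = 4 * K) by (unfold N2; field; lra).
      assert (eps * N2 <= eps * b) by (apply Rmult_le_compat_l; lra).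
      assert (b <= b ^ 2) by nra. nra. }
    revert HC HN1. unfold Rabs; repeat destruct Rcase_abs; lra.
Qed.

Lemma airy_moment_0 (x : R) : airy_moment 0 x = RtoC (2 * PI * Ai x).
Proof.
  apply Ceq; [|rewrite airy_moment_0_Im; reflexivity].
  rewrite Ai_eq. unfold Re; simpl. field. apply PI_neq0.
Qed.

Lemma Ai_derive (x : R) : is_derive Ai x (Im (airy_moment 1 x) / (2 * PI)).
Proof.
  apply (is_derive_ext (fun u => / (2 * PI) * Re (airy_moment 0 u))).
  { intros t. rewrite Ai_eq. apply Rmult_comm. }
  destruct (airy_moment_derive 0 x) as [H _].
  replace (Im (airy_moment 1 x) / (2 * PI)) with
    (/ (2 * PI) * Re (- (Ci * airy_moment 1 x))%C).
  - apply (is_derive_scal (fun u => Re (airy_moment 0 u))). exact H.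
  - unfold Re, Im; simpl. field. apply PI_neq0.
Qed.

Lemma Ai'_eq (x : R) : Ai' x = Im (airy_moment 1 x) / (2 * PI).
Proof. apply is_derive_unique, Ai_derive. Qed.

Lemma airy_moment_1 (x : R) : airy_moment 1 x = Cmult Ci (RtoC (2 * PI * Ai' x)).
Proof.
  apply Ceq.
  - rewrite airy_moment_1_Re. simpl. ring.
  - rewrite Ai'_eq. unfold Im; simpl. field. apply PI_neq0.
Qed.

Lemma is_derive_Ai (x : R) : is_derive Ai x (Ai' x).
Proof. rewrite Ai'_eq. apply Ai_derive. Qed.

(** Airy's equation is the moment recurrence at k = 0. *)
Lemma is_derive_Ai' (x : R) : is_derive Ai' x (x * Ai x).
Proof.
  apply (is_derive_ext (fun u => / (2 * PI) * Im (airy_moment 1 u))).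
  { intros t. rewrite Ai'_eq. apply Rmult_comm. }
  destruct (airy_moment_derive 1 x) as [_ H].
  replace (x * Ai x) with (/ (2 * PI) * Im (- (Ci * airy_moment 2 x))%C).
  - apply (is_derive_scal (fun u => Im (airy_moment 1 u))). exact H.
  - assert (E := airy_moment_rec 0 x). apply (f_equal Re) in E.
    rewrite Ai_eq. change (0 + 2)%nat with 2%nat in E.
    destruct (airy_moment 2 x) as [m1 m2], (airy_moment 0 x) as [n1 n2].
    unfold Re, Im in *; simpl in *.
    assert (E' : m1 = - (x * n1)) by lra.
    rewrite E'. field. apply PI_neq0.
Qed.

(** * Complex functions on a strip *)

Definition C2cont (f : R -> R -> C) : Prop :=
  forall x y, continuity_2d_pt (fun u v => Re (f u v)) x y /\
              continuity_2d_pt (fun u v => Im (f u v)) x y.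

Lemma C2cont_const (c : C) : C2cont (fun _ _ => c).
Proof. intros x y; split; apply continuity_2d_pt_const. Qed.

Lemma C2cont_plus (f g : R -> R -> C) :
  C2cont f -> C2cont g -> C2cont (fun u v => Cplus (f u v) (g u v)).
Proof.
  intros Hf Hg x y. destruct (Hf x y), (Hg x y). split; simpl.
  - apply (continuity_2d_pt_plus (fun u v => Re (f u v)) (fun u v => Re (g u v))); auto.
  - apply (continuity_2d_pt_plus (fun u v => Im (f u v)) (fun u v => Im (g u v))); auto.
Qed.

Lemma C2cont_mult (f g : R -> R -> C) :
  C2cont f -> C2cont g -> C2cont (fun u v => Cmult (f u v) (g u v)).
Proof.
  intros Hf Hg x y. destruct (Hf x y), (Hg x y). split; simpl.
  - apply (continuity_2d_pt_minus (fun u v => Re (f u v) * Re (g u v))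
      (fun u v => Im (f u v) * Im (g u v))); apply continuity_2d_pt_mult; auto.
  - apply (continuity_2d_pt_plus (fun u v => Re (f u v) * Im (g u v))
      (fun u v => Im (f u v) * Re (g u v))); apply continuity_2d_pt_mult; auto.
Qed.

Lemma C2cont_pow (f : R -> R -> C) (n : nat) :
  C2cont f -> C2cont (fun u v => Cpow (f u v) n).
Proof.
  intros Hf. induction n; [exact (C2cont_const 1%C)|].
  exact (C2cont_mult f (fun u v => Cpow (f u v) n) Hf IHn).
Qed.

Lemma C2cont_Cexp (f : R -> R -> C) : C2cont f -> C2cont (fun u v => Cexp (f u v)).
Proof.
  intros Hf x y. destruct (Hf x y) as [H1 H2].
  assert (He : continuity_2d_pt (fun u v => exp (Re (f u v))) x y).
  { apply (continuity_1d_2d_pt_comp exp); auto.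
    apply derivable_continuous_pt, derivable_pt_exp. }
  assert (Hc : continuity_2d_pt (fun u v => cos (Im (f u v))) x y).
  { apply (continuity_1d_2d_pt_comp cos); auto. apply continuity_cos. }
  assert (Hs : continuity_2d_pt (fun u v => sin (Im (f u v))) x y).
  { apply (continuity_1d_2d_pt_comp sin); auto. apply continuity_sin. }
  split.
  - apply (continuity_2d_pt_ext (fun u v => exp (Re (f u v)) * cos (Im (f u v)))).
    { intros; unfold Cexp, Re; simpl; ring. }
    apply continuity_2d_pt_mult; auto.
  - apply (continuity_2d_pt_ext (fun u v => exp (Re (f u v)) * sin (Im (f u v)))).
    { intros; unfold Cexp, Im; simpl; ring. }
    apply continuity_2d_pt_mult; auto.
Qed.

(** The first two hypotheses are the Cauchy-Riemann equations: the th-derivative is i times the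
    s-derivative. Real and imaginary part are shifted separately, with -Im F and Re F in the role of
    V. *)
Lemma cint_shift (F F' : R -> R -> C) (t1 t2 K : R) :
  (forall th s, dC (F th) s (F' th s)) ->
  (forall th s, dC (fun u => F u s) th (Cmult Ci (F' th s))) ->
  C2cont F' -> t1 <= t2 ->
  (forall th s, t1 <= th <= t2 -> Cmod (F th s) <= K * exp (- Rabs s)) ->
  cint (F t1) = cint (F t2).
Proof.
  intros Hs Hth Hc Ht HK.
  assert (Hcont : forall th, Ccont (F th)).
  { intros th. apply (Ccont_dC _ (F' th)). auto. }
  assert (Hdom : forall th, t1 <= th <= t2 -> Cdominated (F th)).
  { intros th H. apply (Cdominated_intro _ K); auto. }
  unfold cint. f_equal.
  - apply (lineint_shift (fun th s => Re (F th s)) (fun th s => - Im (F th s))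
             (fun th s => - Im (F' th s)) t1 t2 K); auto.
    + intros th s. destruct (Hth th s) as [H _].
      replace (- Im (F' th s)) with (Re (Ci * F' th s)%C); [exact H|].
      unfold Re, Im; simpl; ring.
    + intros th s. exact (is_derive_opp _ _ _ (proj2 (Hs th s))).
    + intros th s. apply continuity_2d_pt_opp, Hc.
    + intros th s. exact (proj1 (Hcont th) s).
    + apply (Hdom t1). lra.
    + apply (Hdom t2). lra.
    + intros th s H. rewrite Rabs_Ropp. eapply Rle_trans; [apply Im_le | auto].
  - apply (lineint_shift (fun th s => Im (F th s)) (fun th s => Re (F th s))
             (fun th s => Re (F' th s)) t1 t2 K); auto.
    + intros th s. destruct (Hth th s) as [_ H].
      replace (Re (F' th s)) with (Im (Ci * F' th s)%C); [exact H|].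
      unfold Re, Im; simpl; ring.
    + intros th s. exact (proj1 (Hs th s)).
    + intros th s. apply Hc.
    + intros th s. exact (proj2 (Hcont th) s).
    + apply (Hdom t1). lra.
    + apply (Hdom t2). lra.
    + intros th s H. eapply Rle_trans; [apply Re_le | auto].
Qed.

(** [Ccosh th x] and [Csinh th x] are cosh and sinh at x + i th. *)
Definition Ccosh (th x : R) : C := (cosh x * cos th, sinh x * sin th).
Definition Csinh (th x : R) : C := (sinh x * cos th, cosh x * sin th).

Lemma dC_Ccosh_x (th x : R) : dC (Ccosh th) x (Csinh th x).
Proof. split; simpl; auto_derive; trivial; ring. Qed.

Lemma dC_Ccosh_th (th x : R) : dC (fun u => Ccosh u x) th (Cmult Ci (Csinh th x)).
Proof. split; simpl; auto_derive; trivial; ring. Qed.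

Lemma cont2_cosh (x y : R) : continuity_2d_pt (fun _ v => cosh v) x y.
Proof.
  apply (continuity_1d_2d_pt_comp cosh); [|apply continuity_2d_pt_id2].
  apply derivable_continuous_pt, derivable_pt_cosh.
Qed.

Lemma cont2_sinh (x y : R) : continuity_2d_pt (fun _ v => sinh v) x y.
Proof.
  apply (continuity_1d_2d_pt_comp sinh); [|apply continuity_2d_pt_id2].
  apply derivable_continuous_pt, derivable_pt_sinh.
Qed.

Lemma C2cont_Ccosh : C2cont Ccosh.
Proof.
  intros x y; split; unfold Ccosh, Re, Im; simpl; apply continuity_2d_pt_mult;
    try apply cont2_cosh; try apply cont2_sinh; c2d.
Qed.

Lemma C2cont_Csinh : C2cont Csinh.
Proof.
  intros x y; split; unfold Csinh, Re, Im; simpl; apply continuity_2d_pt_mult;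
    try apply cont2_cosh; try apply cont2_sinh; c2d.
Qed.

(** * The integrals [int cosh^j z exp (- y cosh z + nu z) dz] along [Im z = th] *)

Definition bessel_phase (nu : C) (y th x : R) : C :=
  Cplus (Cmult (RtoC (- y)) (Ccosh th x)) (Cmult nu (x, th)).

Definition bessel_kernel (j : nat) (nu : C) (y th x : R) : C :=
  Cmult (Cpow (Ccosh th x) j) (Cexp (bessel_phase nu y th x)).

Definition bessel_kernel' (j : nat) (nu : C) (y th x : R) : C :=
  Cplus (Cmult (Cmult (RtoC (INR j)) (Cmult (Csinh th x) (Cpow (Ccosh th x) (pred j))))
          (Cexp (bessel_phase nu y th x)))
    (Cmult (Cpow (Ccosh th x) j)
       (Cmult (Cplus (Cmult (RtoC (- y)) (Csinh th x)) nu) (Cexp (bessel_phase nu y th x)))).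

Lemma dC_pow' (f : R -> C) (x : R) (a : C) (n : nat) :
  dC f x a -> dC (fun u => Cpow (f u) n) x (Cmult (RtoC (INR n)) (Cmult a (Cpow (f x) (pred n)))).
Proof.
  intros H. destruct n.
  - eapply dC_eq; [apply (dC_const 1%C)|]. simpl. ring.
  - apply (dC_pow f x a n H).
Qed.

Lemma dC_bessel_kernel_x (j : nat) (nu : C) (y th x : R) :
  dC (bessel_kernel j nu y th) x (bessel_kernel' j nu y th x).
Proof.
  unfold bessel_kernel, bessel_kernel'.
  apply dC_mult; [apply (dC_pow' (Ccosh th)), dC_Ccosh_x|].
  apply dC_Cexp. unfold bessel_phase. apply dC_plus; [apply dC_scal, dC_Ccosh_x|].
  eapply dC_eq; [apply dC_scal|].
  - instantiate (1 := 1%C). split; simpl; [apply @is_derive_id | apply @is_derive_const].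
  - ring.
Qed.

Lemma dC_bessel_kernel_th (j : nat) (nu : C) (y th x : R) :
  dC (fun u => bessel_kernel j nu y u x) th (Cmult Ci (bessel_kernel' j nu y th x)).
Proof.
  unfold bessel_kernel.
  eapply dC_eq.
  - apply dC_mult; [apply (dC_pow' (fun u => Ccosh u x)), dC_Ccosh_th|].
    apply dC_Cexp. unfold bessel_phase. apply dC_plus; [apply dC_scal, dC_Ccosh_th|].
    apply dC_scal. instantiate (1 := Ci).
    split; simpl; [apply @is_derive_const | apply @is_derive_id].
  - unfold bessel_kernel'. fold (bessel_phase nu y th x). ring.
Qed.

Lemma C2cont_bessel_phase (nu : C) (y : R) : C2cont (bessel_phase nu y).
Proof.
  apply C2cont_plus; (apply C2cont_mult; [apply C2cont_const|]).
  - apply C2cont_Ccosh.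
  - intros u v; split; unfold Re, Im; simpl; c2d.
Qed.

Lemma C2cont_bessel_kernel' (j : nat) (nu : C) (y : R) : C2cont (bessel_kernel' j nu y).
Proof.
  assert (He : C2cont (fun th x => Cexp (bessel_phase nu y th x))).
  { apply C2cont_Cexp, C2cont_bessel_phase. }
  assert (Hp : forall k, C2cont (fun th x => Cpow (Ccosh th x) k)).
  { intros; apply C2cont_pow, C2cont_Ccosh. }
  unfold bessel_kernel'.
  apply C2cont_plus.
  - apply C2cont_mult; auto. apply C2cont_mult; [apply C2cont_const|].
    apply C2cont_mult; [apply C2cont_Csinh | auto].
  - apply C2cont_mult; auto. apply C2cont_mult; auto.
    apply C2cont_plus; [|apply C2cont_const].
    apply C2cont_mult; [apply C2cont_const | apply C2cont_Csinh].
Qed.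

Lemma sinh_lower (v : R) : 0 <= v -> v <= sinh v.
Proof.
  intros Hv.
  assert (D := derive_le_increment (fun x => x) (fun _ => 1) sinh cosh 0 v Hv).
  rewrite sinh_0 in D.
  enough (v - 0 <= sinh v - 0) by lra. apply D.
  - intros. auto_derive; trivial.
  - intros. auto_derive; trivial. ring.
  - intros w _. unfold cosh.
    assert (exp w * exp (- w) = 1) by (rewrite <- exp_plus, Rplus_opp_r; apply exp_0).
    generalize (exp_pos w) (exp_pos (- w)). intros.
    assert (0 <= (exp w - exp (- w)) ^ 2) by apply pow2_ge_0. nra.
Qed.

Lemma cosh_bounds (x : R) : 1 + x ^ 2 / 2 <= cosh x <= exp (Rabs x).
Proof.
  split.
  - assert (Hpos : forall u, 0 <= u -> 1 + u ^ 2 / 2 <= cosh u).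
    { intros u Hu.
      assert (D := derive_le_increment (fun x => x ^ 2 / 2) (fun x => x) cosh sinh 0 u Hu).
      rewrite cosh_0 in D.
      enough (u ^ 2 / 2 - 0 ^ 2 / 2 <= cosh u - 1) by lra. apply D.
      - intros. auto_derive; trivial. field.
      - intros. auto_derive; trivial. ring.
      - intros w Hw. apply sinh_lower; lra. }
    destruct (Rle_dec 0 x); [auto|].
    replace (cosh x) with (cosh (- x)).
    + replace (x ^ 2) with ((- x) ^ 2) by ring. apply Hpos; lra.
    + unfold cosh. rewrite Ropp_involutive. field.
  - unfold cosh. assert (exp x <= exp (Rabs x)) by apply exp_le, Rle_abs.
    assert (exp (- x) <= exp (Rabs x)) by (apply exp_le; rewrite <- Rabs_Ropp; apply Rle_abs).
    lra.
Qed.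

Lemma cosh2_sinh2 (x : R) : cosh x ^ 2 - sinh x ^ 2 = 1.
Proof.
  unfold cosh, sinh.
  assert (exp x * exp (- x) = 1) by (rewrite <- exp_plus, Rplus_opp_r; apply exp_0).
  nra.
Qed.

Lemma Cmod_sqr_le (z : C) (B : R) : 0 <= B -> Re z ^ 2 + Im z ^ 2 <= B ^ 2 -> Cmod z <= B.
Proof.
  intros HB H. rewrite <- (sqrt_pow2 B) by auto. unfold Cmod. apply sqrt_le_1_alt. exact H.
Qed.

Lemma Cmod_Ccosh (th x : R) : Cmod (Ccosh th x) <= cosh x.
Proof.
  apply Cmod_sqr_le; [generalize (cosh_bounds x) (pow2_ge_0 x); lra|].
  unfold Re, Im; simpl.
  assert (H1 := cosh2_sinh2 x). assert (H2 := sin2_cos2 th). unfold Rsqr in H2.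
  assert (E : sinh x ^ 2 = cosh x ^ 2 - 1) by lra.
  replace (cosh x * cos th * (cosh x * cos th * 1) + sinh x * sin th * (sinh x * sin th * 1))
    with (cosh x ^ 2 * (cos th * cos th) + sinh x ^ 2 * (sin th * sin th)) by ring.
  rewrite E. nra.
Qed.

Lemma Cmod_Csinh (th x : R) : Cmod (Csinh th x) <= cosh x.
Proof.
  apply Cmod_sqr_le; [generalize (cosh_bounds x) (pow2_ge_0 x); lra|].
  unfold Re, Im; simpl.
  assert (H1 := cosh2_sinh2 x). assert (H2 := sin2_cos2 th). unfold Rsqr in H2.
  assert (E : sinh x ^ 2 = cosh x ^ 2 - 1) by lra.
  replace (sinh x * cos th * (sinh x * cos th * 1) + cosh x * sin th * (cosh x * sin th * 1))
    with (sinh x ^ 2 * (cos th * cos th) + cosh x ^ 2 * (sin th * sin th)) by ring.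
  rewrite E. nra.
Qed.

Lemma bessel_phase_Re (nu : C) (y th x : R) :
  Re (bessel_phase nu y th x) = - y * cosh x * cos th + Re nu * x - Im nu * th.
Proof. unfold bessel_phase, Re, Im; simpl. ring. Qed.

Lemma exp_INR_mult (k : nat) (u : R) : exp u ^ k = exp (INR k * u).
Proof.
  induction k; [simpl; rewrite Rmult_0_l, exp_0; auto|].
  rewrite S_INR, Rmult_plus_distr_r, Rmult_1_l, exp_plus. simpl. rewrite IHk. ring.
Qed.

(** Of the double exponential decay only cosh x >= 1 + x^2 / 2 is kept: a Gaussian of rate d / 2,
    uniform over all lines with y cos th >= d. *)
Lemma bessel_kernel_bound (j : nat) (nu : C) (y d th x : R) :
  0 < d -> d <= y * cos th ->
  Cmod (bessel_kernel j nu y th x)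
    <= exp (Rabs (Im nu) * Rabs th) * exp ((INR j + Rabs (Re nu)) * Rabs x - d / 2 * x ^ 2).
Proof.
  intros Hd Hy. unfold bessel_kernel. rewrite Cmod_mult, Cmod_pow, Cmod_Cexp, bessel_phase_Re.
  assert (Hc := cosh_bounds x).
  apply Rle_trans with (exp (INR j * Rabs x) *
    exp (Rabs (Im nu) * Rabs th + Rabs (Re nu) * Rabs x - d / 2 * x ^ 2)).
  - apply Rmult_le_compat.
    + apply pow_le, Cmod_ge_0.
    + apply Rlt_le, exp_pos.
    + rewrite <- exp_INR_mult. apply pow_incr. split; [apply Cmod_ge_0|].
      eapply Rle_trans; [apply Cmod_Ccosh | apply Hc].
    + apply exp_le.
      assert (Re nu * x <= Rabs (Re nu) * Rabs x) by (rewrite <- Rabs_mult; apply Rle_abs).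
      assert (- Im nu * th <= Rabs (Im nu) * Rabs th)
        by (rewrite <- (Rabs_Ropp (Im nu)), <- Rabs_mult; apply Rle_abs).
      assert (d * (1 + x ^ 2 / 2) <= y * cos th * cosh x).
      { apply Rmult_le_compat; try lra. generalize (pow2_ge_0 x); lra. }
      nra.
  - right. rewrite <- !exp_plus. f_equal. ring.
Qed.

Lemma bessel_kernel_bound' (j : nat) (nu : C) (y d th x : R) :
  0 < d -> d <= y * cos th ->
  Cmod (bessel_kernel j nu y th x)
    <= exp (Rabs (Im nu) * Rabs th) * exp ((INR j + Rabs (Re nu) + 1) ^ 2 / (4 * (d / 2)))
       * exp (- Rabs x).
Proof.
  intros Hd Hy. eapply Rle_trans; [apply (bessel_kernel_bound j nu y d th x Hd Hy)|].
  rewrite Rmult_assoc. apply Rmult_le_compat_l; [apply Rlt_le, exp_pos|].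
  apply gauss_dominated. lra.
Qed.

Lemma bessel_kernel_dominated (j : nat) (nu : C) (y th : R) :
  0 < y * cos th -> Cdominated (bessel_kernel j nu y th).
Proof.
  intros H. eapply Cdominated_intro.
  - eapply Ccont_dC. intros x. apply dC_bessel_kernel_x.
  - intros x. apply (bessel_kernel_bound' j nu y (y * cos th) th x); auto. lra.
Qed.

(** The cosine decreases on [0, pi / 2), so the rate y cos th of the final line serves every line in
    between. *)
Lemma bessel_shift (j : nat) (nu : C) (y th : R) :
  0 < y -> 0 <= th < PI / 2 ->
  cint (bessel_kernel j nu y 0) = cint (bessel_kernel j nu y th).
Proof.
  intros Hy Hth.
  assert (Hd : 0 < y * cos th).
  { apply Rmult_lt_0_compat; auto. apply cos_gt_0; lra. }
  eapply (cint_shift (bessel_kernel j nu y) (bessel_kernel' j nu y) 0 th).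
  - intros; apply dC_bessel_kernel_x.
  - intros; apply dC_bessel_kernel_th.
  - apply C2cont_bessel_kernel'.
  - lra.
  - intros u s Hu.
    eapply Rle_trans; [apply (bessel_kernel_bound' j nu y (y * cos th) u s Hd)|].
    + apply Rmult_le_compat_l; [lra|]. apply cos_decr_1; lra.
    + apply Rmult_le_compat_r; [apply Rlt_le, exp_pos|].
      apply Rmult_le_compat_r; [apply Rlt_le, exp_pos|].
      apply exp_le, Rmult_le_compat_l; [apply Rabs_pos|].
      rewrite !Rabs_pos_eq by lra. apply Hu.
Qed.

(** * The differential equation of the K-Bessel function *)

Definition bessel_moment (j : nat) (nu : C) (y : R) : C := cint (bessel_kernel j nu y 0).

Lemma BesselK_eq (nu : C) (y : R) : 0 < y ->
  BesselK nu y = Cmult (RtoC (/ 2)) (bessel_moment 0 nu y).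
Proof.
  intros Hy. unfold BesselK, bessel_moment.
  replace (1 / 2) with (/ 2) by field. f_equal.
  rewrite <- cint_RInt_gen.
  - f_equal. apply FunctionalExtensionality.functional_extensionality. intros u.
    unfold bessel_kernel, bessel_phase. simpl. rewrite Cmult_1_l. f_equal. f_equal.
    unfold Ccosh. rewrite sin_0, cos_0. apply Ceq; unfold Re, Im; simpl; ring.
  - apply bessel_kernel_dominated. rewrite cos_0. lra.
Qed.

Lemma Ccosh_0 (x : R) : Ccosh 0 x = RtoC (cosh x).
Proof. unfold Ccosh. rewrite sin_0, cos_0. apply Ceq; unfold Re, Im; simpl; ring. Qed.

Lemma Csinh_0 (x : R) : Csinh 0 x = RtoC (sinh x).
Proof. unfold Csinh. rewrite sin_0, cos_0. apply Ceq; unfold Re, Im; simpl; ring. Qed.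

Lemma bessel_moment_derive (j : nat) (nu : C) (y : R) : 0 < y ->
  dC (bessel_moment j nu) y (Copp (bessel_moment (S j) nu y)).
Proof.
  intros Hy.
  assert (Hdom : forall k z, 0 < z -> Cdominated (bessel_kernel k nu z 0)).
  { intros. apply bessel_kernel_dominated. rewrite cos_0. lra. }
  replace (Copp (bessel_moment (S j) nu y))
    with (cint (fun s => Cmult (RtoC (-1)) (bessel_kernel (S j) nu y 0 s))).
  2:{ rewrite cint_scal by auto. unfold bessel_moment. rewrite RtoC_m1. ring. }
  (* For |h| < y / 2 the quadratic remainder is at most 4 h^2 times the kernel at y / 2 with two
     more factors cosh, a majorant independent of h. *)
  destruct (Cdominated_bound _ (Hdom (j + 2)%nat (y / 2) ltac:(lra))) as [K HK].
  unfold bessel_moment.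
  apply (cint_param_derive (fun y => bessel_kernel j nu y 0) _ y (y / 2) (4 * K)).
  - lra.
  - intros h Hh. apply Hdom. apply Rabs_def2 in Hh. lra.
  - apply Cdominated_scal, Hdom; auto.
  - intros h s Hh.
    set (w := RtoC (- h * cosh s)).
    assert (E : Cminus (Cminus (bessel_kernel j nu (y + h) 0 s) (bessel_kernel j nu y 0 s))
        (Cmult (RtoC h) (Cmult (RtoC (-1)) (bessel_kernel (S j) nu y 0 s)))
      = Cmult (bessel_kernel j nu y 0 s) (Cminus (Cexp w) (Cexp_poly 2 w))).
    { rewrite Cexp_poly_2. unfold bessel_kernel.
      replace (bessel_phase nu (y + h) 0 s) with (Cplus (bessel_phase nu y 0 s) w).
      - rewrite Cexp_plus, Cpow_S, RtoC_m1, Ccosh_0. unfold w. rewrite RtoC_mult, RtoC_opp'. ring.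
      - unfold w, bessel_phase. rewrite Ccosh_0. apply Ceq; unfold Re, Im; simpl; ring. }
    rewrite E, Cmod_mult.
    assert (Hc : 1 <= cosh s) by (generalize (cosh_bounds s) (pow2_ge_0 s); lra).
    assert (Ht := Cexp_taylor 2 w).
    assert (Ew : Cmod w = Rabs h * cosh s).
    { unfold w. rewrite Cmod_R, Rabs_mult, Rabs_Ropp, (Rabs_pos_eq (cosh s)); lra. }
    rewrite Ew in Ht.
    assert (Hm : Rmax 1 (exp (Re w)) <= exp (y / 2 * cosh s)).
    { unfold w; simpl. apply Rmax_case.
      - rewrite <- exp_0. apply exp_le. nra.
      - apply exp_le. apply Rmult_le_compat_r; [lra|].
        generalize (Rle_abs (- h)). rewrite Rabs_Ropp. lra. }
    assert (Hk : Cmod (bessel_kernel j nu y 0 s) * (cosh s ^ 2 * exp (y / 2 * cosh s))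
        = Cmod (bessel_kernel (j + 2) nu (y / 2) 0 s)).
    { unfold bessel_kernel. rewrite !Cmod_mult, !Cmod_pow, pow_add, !Cmod_Cexp, !bessel_phase_Re.
      rewrite Ccosh_0, Cmod_R, Rabs_pos_eq, cos_0 by lra.
      replace (- y * cosh s * 1 + Re nu * s - Im nu * 0)
        with ((- (y / 2) * cosh s * 1 + Re nu * s - Im nu * 0) + - (y / 2 * cosh s)) by field.
      rewrite exp_plus, exp_Ropp. field. apply Rgt_not_eq, exp_pos. }
    apply Rle_trans with (4 * h ^ 2 * Cmod (bessel_kernel (j + 2) nu (y / 2) 0 s)).
    + rewrite <- Hk.
      replace (4 * h ^ 2 * (Cmod (bessel_kernel j nu y 0 s) * (cosh s ^ 2 * exp (y / 2 * cosh s))))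
        with (Cmod (bessel_kernel j nu y 0 s) *
              (2 ^ 2 * (Rabs h * cosh s) ^ 2 * exp (y / 2 * cosh s))).
      * apply Rmult_le_compat_l; [apply Cmod_ge_0|].
        eapply Rle_trans; [apply Ht|].
        apply Rmult_le_compat_l; [|auto].
        apply Rmult_le_pos; [lra | apply pow2_ge_0].
      * rewrite Rpow_mult_distr, <- (pow2_abs h). ring.
    + replace (4 * K * h ^ 2 * exp (- Rabs s)) with (4 * h ^ 2 * (K * exp (- Rabs s))) by ring.
      apply Rmult_le_compat_l; [generalize (pow2_ge_0 h); lra | apply HK].
Qed.

(** The derivative of (y sinh x + nu) exp(-y cosh x + nu x) integrates to zero, and sinh^2 = cosh^2
    - 1. Together with [bessel_moment_derive] this is the modified Bessel equation. *)
Lemma bessel_moment_rec (nu : C) (y : R) : 0 < y ->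
  Cmult (RtoC (y ^ 2)) (bessel_moment 2 nu y) =
  Cplus (Cmult (RtoC y) (bessel_moment 1 nu y))
    (Cmult (Cplus (RtoC (y ^ 2)) (Cmult nu nu)) (bessel_moment 0 nu y)).
Proof.
  intros Hy.
  assert (Hdom : forall k, Cdominated (bessel_kernel k nu y 0)).
  { intros. apply bessel_kernel_dominated. rewrite cos_0. lra. }
  assert (E : cint (fun x => Cplus (Cplus (Cmult (RtoC y) (bessel_kernel 1 nu y 0 x))
       (Cmult (Cplus (RtoC (y ^ 2)) (Cmult nu nu)) (bessel_kernel 0 nu y 0 x)))
       (Cmult (RtoC (- y ^ 2)) (bessel_kernel 2 nu y 0 x))) = 0%C).
  { apply (cint_derive (fun x => Cmult (Cplus (Cmult (RtoC y) (Csinh 0 x)) nu) (bessel_kernel 0 nu y 0 x))).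
    - intros x.
      assert (Hs : dC (Csinh 0) x (Ccosh 0 x)).
      { split; simpl; auto_derive; trivial; rewrite ?sin_0, ?cos_0; ring. }
      eapply dC_eq.
      { apply dC_mult; [|apply dC_bessel_kernel_x].
        apply dC_plus; [apply dC_scal, Hs | apply dC_const]. }
      unfold bessel_kernel', bessel_kernel. simpl. rewrite Ccosh_0, Csinh_0.
      assert (Ey : RtoC (y * (y * 1)) = Cmult (RtoC y) (RtoC y))
        by (rewrite <- RtoC_mult; f_equal; ring).
      assert (Es : Cmult (RtoC (sinh x)) (RtoC (sinh x))
                   = Cminus (Cmult (RtoC (cosh x)) (RtoC (cosh x))) (RtoC 1)).
      { rewrite <- !RtoC_mult, <- RtoC_minus. f_equal. generalize (cosh2_sinh2 x). nra. }
      rewrite ?RtoC_opp', ?Ey.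
      generalize dependent (RtoC (sinh x)). intros s Es.
      generalize dependent (RtoC (cosh x)). intros c Es.
      generalize (Cexp (bessel_phase nu y 0 x)) (RtoC y). intros E Y.
      transitivity (Cplus (Cmult (Cmult Y c) E) (Cmult (Cminus (Cmult nu nu) (Cmult (Cmult Y Y) (Cmult s s))) E)).
      + ring.
      + rewrite Es. ring.
    - auto using Cdominated_plus, Cdominated_scal.
    - destruct (Cdominated_bound _ (Hdom 0%nat)) as [K0 HK0].
      destruct (Cdominated_bound _ (Hdom 1%nat)) as [K1 HK1].
      exists (y * K1 + Cmod nu * K0). intros x.
      rewrite Cmod_mult.
      apply Rle_trans with (y * Cmod (bessel_kernel 1 nu y 0 x) + Cmod nu * Cmod (bessel_kernel 0 nu y 0 x)).
      + replace (Cmod (bessel_kernel 1 nu y 0 x)) with (cosh x * Cmod (bessel_kernel 0 nu y 0 x)).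
        * assert (Cmod (Cplus (Cmult (RtoC y) (Csinh 0 x)) nu) <= y * cosh x + Cmod nu).
          { eapply Rle_trans; [apply Cmod_triangle|]. apply Rplus_le_compat_r.
            rewrite Cmod_mult, Cmod_R, Rabs_pos_eq by lra.
            apply Rmult_le_compat_l; [lra | apply Cmod_Csinh]. }
          generalize (Cmod_ge_0 (bessel_kernel 0 nu y 0 x)). intros.
          rewrite <- Rmult_assoc, <- Rmult_plus_distr_r.
          apply Rmult_le_compat_r; auto.
        * unfold bessel_kernel. simpl. rewrite !Cmod_mult, Ccosh_0, !Cmod_R.
          rewrite (Rabs_pos_eq (cosh x)), Rabs_R1; [ring|].
          generalize (cosh_bounds x) (pow2_ge_0 x); lra.
      + specialize (HK0 x). specialize (HK1 x).
        rewrite Rmult_plus_distr_r, !Rmult_assoc.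
        apply Rplus_le_compat; apply Rmult_le_compat_l; auto; [lra | apply Cmod_ge_0]. }
  rewrite !cint_plus, !cint_scal in E; auto using Cdominated_plus, Cdominated_scal.
  fold (bessel_moment 0 nu y) (bessel_moment 1 nu y) (bessel_moment 2 nu y) in E.
  rewrite RtoC_opp' in E.
  set (a := Cmult (RtoC (y ^ 2)) (bessel_moment 2 nu y)).
  match type of E with Cplus ?b (Cmult (Copp ?c) ?d) = _ =>
    replace (Cplus b (Cmult (Copp c) d)) with (Cminus b a) in E by (unfold a; ring);
    replace a with (Cminus b (Cminus b a)) by ring end.
  rewrite E. ring.
Qed.

(** * Expansion of the Bessel integrals at y = t *)

(** Order e^n uniformly in r, with exponential growth in s allowed. That growth absorbs polynomial
    factors in s and is later beaten by the Airy weight, so orders multiply like formal powers of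
    e. *)
Definition ord (M : R) (n : nat) (f : R -> R -> R -> C) : Prop :=
  exists K c, 0 <= K /\ 0 <= c /\ forall r e s, Rabs r <= M -> 0 < e <= 1 ->
    Cmod (f r e s) <= K * e ^ n * exp (c * Rabs s).

Lemma ord_ext (M : R) (n : nat) (f g : R -> R -> R -> C) :
  (forall r e s, Rabs r <= M -> 0 < e <= 1 -> f r e s = g r e s) -> ord M n f -> ord M n g.
Proof.
  intros E [K [c [H1 [H2 H]]]]. exists K, c. repeat split; auto.
  intros. rewrite <- E; auto.
Qed.

Lemma ord_plus (M : R) (n : nat) (f g : R -> R -> R -> C) :
  ord M n f -> ord M n g -> ord M n (fun r e s => Cplus (f r e s) (g r e s)).
Proof.
  intros [K [c [H1 [H2 H]]]] [K' [c' [H1' [H2' H']]]].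
  exists (K + K'), (c + c'). repeat split; try lra. intros r e s Hr He.
  eapply Rle_trans; [apply Cmod_triangle|].
  specialize (H r e s Hr He). specialize (H' r e s Hr He).
  assert (0 <= Rabs s) by apply Rabs_pos.
  assert (0 < e ^ n) by (apply pow_lt; lra).
  assert (exp (c * Rabs s) <= exp ((c + c') * Rabs s)) by (apply exp_le; nra).
  assert (exp (c' * Rabs s) <= exp ((c + c') * Rabs s)) by (apply exp_le; nra).
  rewrite !Rmult_plus_distr_r. apply Rplus_le_compat.
  - eapply Rle_trans; [apply H|]. rewrite <- Rmult_plus_distr_r. apply Rmult_le_compat_l; auto.
    apply Rmult_le_pos; lra.
  - eapply Rle_trans; [apply H'|]. rewrite <- Rmult_plus_distr_r. apply Rmult_le_compat_l; auto.
    apply Rmult_le_pos; lra.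
Qed.

Lemma ord_mult (M : R) (n m : nat) (f g : R -> R -> R -> C) :
  ord M n f -> ord M m g -> ord M (n + m) (fun r e s => Cmult (f r e s) (g r e s)).
Proof.
  intros [K [c [H1 [H2 H]]]] [K' [c' [H1' [H2' H']]]].
  exists (K * K'), (c + c'). split; [apply Rmult_le_pos; auto|]. split; [lra|].
  intros r e s Hr He. rewrite Cmod_mult.
  replace (K * K' * e ^ (n + m) * exp ((c + c') * Rabs s))
    with ((K * e ^ n * exp (c * Rabs s)) * (K' * e ^ m * exp (c' * Rabs s))).
  - apply Rmult_le_compat; auto; apply Cmod_ge_0.
  - rewrite pow_add, Rmult_plus_distr_r, exp_plus. ring.
Qed.

Lemma ord_weaken (M : R) (n m : nat) (f : R -> R -> R -> C) :
  (m <= n)%nat -> ord M n f -> ord M m f.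
Proof.
  intros Hnm [K [c [H1 [H2 H]]]]. exists K, c. repeat split; auto. intros r e s Hr He.
  eapply Rle_trans; [apply H; auto|].
  apply Rmult_le_compat_r; [apply Rlt_le, exp_pos|].
  apply Rmult_le_compat_l; auto.
  replace n with (m + (n - m))%nat by lia. rewrite pow_add.
  assert (0 < e ^ m) by (apply pow_lt; lra).
  assert (e ^ (n - m) <= 1) by (rewrite <- (pow1 (n - m)); apply pow_incr; lra). nra.
Qed.

Lemma ord_const (M : R) (z : C) : ord M 0 (fun _ _ _ => z).
Proof.
  exists (Cmod z), 0. split; [apply Cmod_ge_0|]. split; [lra|].
  intros. simpl. rewrite Rmult_0_l, exp_0. lra.
Qed.

Lemma ord_r (M : R) : ord M 0 (fun r _ _ => RtoC r).
Proof.
  exists (Rabs M), 0. split; [apply Rabs_pos|]. split; [lra|].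
  intros r e s Hr He. simpl. rewrite Rmult_0_l, exp_0, Cmod_R. generalize (Rle_abs M). lra.
Qed.

Lemma ord_e (M : R) : ord M 1 (fun _ e _ => RtoC e).
Proof.
  exists 1, 0. split; [lra|]. split; [lra|].
  intros r e s Hr He. rewrite Rmult_0_l, exp_0, Cmod_R, Rabs_pos_eq; simpl; lra.
Qed.

Lemma ord_v (M : R) : ord M 0 (fun _ _ s => low_line s).
Proof.
  exists (exp 1), 1. split; [apply Rlt_le, exp_pos|]. split; [lra|].
  intros r e s Hr He. generalize (Cmod_low_line_pow s 1).
  rewrite Cpow_1_r. simpl. rewrite Rplus_comm, exp_plus. lra.
Qed.

Lemma ord_pow (M : R) (n k : nat) (f : R -> R -> R -> C) :
  ord M n f -> ord M (k * n) (fun r e s => Cpow (f r e s) k).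
Proof.
  intros H. induction k; [exact (ord_const M 1%C)|].
  exact (ord_mult M n (k * n) _ _ H IHk).
Qed.

Lemma ord_div (M : R) (n k : nat) (f : R -> R -> R -> C) :
  ord M (k + n) f -> ord M n (fun r e s => Cmult (RtoC (/ e ^ k)) (f r e s)).
Proof.
  intros [K [c [H1 [H2 H]]]]. exists K, c. repeat split; auto. intros r e s Hr He.
  assert (0 < e ^ k) by (apply pow_lt; lra).
  assert (0 < / e ^ k) by (apply Rinv_0_lt_compat; auto).
  rewrite Cmod_mult, Cmod_R, Rabs_pos_eq by lra.
  apply Rle_trans with (/ e ^ k * (K * e ^ (k + n) * exp (c * Rabs s))).
  - apply Rmult_le_compat_l; [lra | auto].
  - right. rewrite pow_add. field. lra.
Qed.

(** * Expansion of the phase in powers of e *)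

Definition Csh (z : C) : C := Cmult (RtoC (/ 2)) (Cminus (Cexp z) (Cexp (Copp z))).

Definition scaled (e s : R) : C := Cmult (RtoC e) (low_line s).

Lemma ord_scaled (M : R) : ord M 1 (fun _ e s => scaled e s).
Proof. exact (ord_mult M 1 0 _ _ (ord_e M) (ord_v M)). Qed.

Definition sh_rem (z : C) : C :=
  Cminus (Csh z) (Cplus z (Cplus (Cmult (RtoC (/ 6)) (Cpow z 3)) (Cmult (RtoC (/ 120)) (Cpow z 5)))).

Lemma Cexp_poly_7_odd (z : C) :
  Cmult (RtoC (/ 2)) (Cminus (Cexp_poly 7 z) (Cexp_poly 7 (Copp z)))
  = Cplus z (Cplus (Cmult (RtoC (/ 6)) (Cpow z 3)) (Cmult (RtoC (/ 120)) (Cpow z 5))).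
Proof.
  unfold Cexp_poly.
  replace (/ INR (Factorial.fact 0)) with 1 by (simpl; field).
  replace (/ INR (Factorial.fact 1)) with 1 by (simpl; field).
  replace (/ INR (Factorial.fact 2)) with (/ 2) by (simpl; field).
  replace (/ INR (Factorial.fact 3)) with (/ 6) by (simpl; field).
  replace (/ INR (Factorial.fact 4)) with (/ 24) by (simpl; field).
  replace (/ INR (Factorial.fact 5)) with (/ 120) by (simpl; field).
  replace (/ INR (Factorial.fact 6)) with (/ 720) by (simpl; field).
  assert (E2 : Cmult (RtoC (/ 2)) (RtoC 2) = 1%C) by (rewrite <- RtoC_mult; f_equal; field).
  transitivity (Cmult (Cmult (RtoC (/ 2)) (RtoC 2)) (Cplus z
     (Cplus (Cmult (RtoC (/ 6)) (Cpow z 3)) (Cmult (RtoC (/ 120)) (Cpow z 5))))).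
  - generalize (RtoC (/ 2)) (RtoC (/ 6)) (RtoC (/ 24)) (RtoC (/ 120)) (RtoC (/ 720)).
    intros. ring.
  - rewrite E2. ring.
Qed.

(** The odd part of the seven-term Taylor polynomial of exp ends at degree 5, so sinh is left with a
    remainder of order 7; division by e^3 leaves order 4 in the phase, the accuracy aimed at. *)
Lemma ord_sh_rem (M : R) : ord M 7 (fun _ e s => sh_rem (scaled e s)).
Proof.
  destruct (ord_pow M 1 7 _ (ord_scaled M)) as [K [c [H1 [H2 H]]]].
  exists (2 ^ 7 * K), (c + 1). split; [|split; [lra|]].
  { apply Rmult_le_pos; [apply pow_le; lra | auto]. }
  intros r e s Hr He. specialize (H r e s Hr He).
  rewrite Cmod_pow in H. change (7 * 1)%nat with 7%nat in H.
  set (z := scaled e s) in *.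
  unfold sh_rem. rewrite <- Cexp_poly_7_odd. unfold Csh.
  replace (Cminus (Cmult (RtoC (/ 2)) (Cminus (Cexp z) (Cexp (Copp z))))
     (Cmult (RtoC (/ 2)) (Cminus (Cexp_poly 7 z) (Cexp_poly 7 (Copp z)))))
    with (Cmult (RtoC (/ 2)) (Cplus (Cminus (Cexp z) (Cexp_poly 7 z))
        (Copp (Cminus (Cexp (Copp z)) (Cexp_poly 7 (Copp z)))))) by ring.
  rewrite Cmod_mult, Cmod_R, Rabs_pos_eq by lra.
  assert (T1 := Cexp_taylor 7 z). assert (T2 := Cexp_taylor 7 (Copp z)).
  rewrite Cmod_opp in T2.
  assert (Hz : forall w, Re w = e * s \/ Re w = - (e * s) -> Rmax 1 (exp (Re w)) <= exp (Rabs s)).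
  { intros w Hw. apply Rmax_case.
    - rewrite <- exp_0. apply exp_le, Rabs_pos.
    - apply exp_le. apply Rle_trans with (Rabs (Re w)); [apply Rle_abs|].
      replace (Rabs (Re w)) with (Rabs (e * s)) by (destruct Hw as [-> | ->]; rewrite ?Rabs_Ropp; auto).
      rewrite Rabs_mult, Rabs_pos_eq by lra.
      generalize (Rabs_pos s). nra. }
  assert (M1 := Hz z ltac:(left; unfold z, scaled, Re; simpl; ring)).
  assert (M2 := Hz (Copp z) ltac:(right; unfold z, scaled, Re; simpl; ring)).
  set (B := 2 ^ 7 * (K * e ^ 7 * exp (c * Rabs s)) * exp (Rabs s)).
  assert (HB : forall m, m <= exp (Rabs s) -> 0 <= m -> 2 ^ 7 * Cmod z ^ 7 * m <= B).
  { intros m Hm Hm0. unfold B. apply Rmult_le_compat; auto.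
    - apply Rmult_le_pos; apply pow_le; [lra | apply Cmod_ge_0].
    - apply Rmult_le_compat_l; [apply pow_le; lra | auto]. }
  assert (C1 := Rle_trans _ _ _ T1 (HB _ M1 (Rle_trans _ _ _ Rle_0_1 (Rmax_l _ _)))).
  assert (C2 := Rle_trans _ _ _ T2 (HB _ M2 (Rle_trans _ _ _ Rle_0_1 (Rmax_l _ _)))).
  replace (2 ^ 7 * K * e ^ 7 * exp ((c + 1) * Rabs s)) with B.
  - assert (C3 := Cmod_triangle (Cminus (Cexp z) (Cexp_poly 7 z))
        (Copp (Cminus (Cexp (Copp z)) (Cexp_poly 7 (Copp z))))).
    rewrite Cmod_opp in C3. lra.
  - unfold B. rewrite Rmult_plus_distr_r, Rmult_1_l, exp_plus. ring.
Qed.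

Lemma ord0_mult (M : R) (f g : R -> R -> R -> C) :
  ord M 0 f -> ord M 0 g -> ord M 0 (fun r e s => Cmult (f r e s) (g r e s)).
Proof. exact (ord_mult M 0 0 f g). Qed.

Lemma ord0_pow (M : R) (k : nat) (f : R -> R -> R -> C) :
  ord M 0 f -> ord M 0 (fun r e s => Cpow (f r e s) k).
Proof. intros H. generalize (ord_pow M 0 k f H). rewrite Nat.mul_0_r. auto. Qed.

Lemma ord_opp (M : R) (n : nat) (f : R -> R -> R -> C) :
  ord M n f -> ord M n (fun r e s => Copp (f r e s)).
Proof.
  intros [K [c [H1 [H2 H]]]]. exists K, c. repeat split; auto. intros. rewrite Cmod_opp; auto.
Qed.

Lemma ord_minus (M : R) (n : nat) (f g : R -> R -> R -> C) :
  ord M n f -> ord M n g -> ord M n (fun r e s => Cminus (f r e s) (g r e s)).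
Proof. intros Hf Hg. exact (ord_plus M n f _ Hf (ord_opp M n g Hg)). Qed.

Lemma ord_divc (M : R) (n : nat) (c : C) (f : R -> R -> R -> C) :
  ord M n f -> ord M n (fun r e s => Cdiv (f r e s) c).
Proof.
  intros Hf. generalize (ord_mult M n 0 _ _ Hf (ord_const M (Cinv c))).
  rewrite Nat.add_0_r. auto.
Qed.

Lemma ord0_e (M : R) : ord M 0 (fun _ e _ => RtoC e).
Proof. apply (ord_weaken M 1 0); [lia | apply ord_e]. Qed.

Ltac ord0 := repeat first
  [ assumption | apply ord_const | apply ord_r | apply ord_v | apply ord0_e
  | apply ord_plus | apply ord_minus | apply ord_opp | apply ord_divc | apply ord0_mult
  | apply ord0_pow ].

(** What remains of the exponent besides Airy's phase, before [phase_rem]: r e v comes from exp(nu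
    z), and -i e^2 v^5 / 60 from the fifth-order term of sinh. *)
Definition phase_lead (r e s : R) : C :=
  (RtoC r * RtoC e * low_line s - Ci * RtoC e ^ 2 * low_line s ^ 5 / 60)%C.

Definition phase_rem (r e s : R) : C :=
  Cmult (Cmult (RtoC (-2)) Ci) (Cmult (RtoC (/ e ^ 3)) (sh_rem (scaled e s))).

(* [phase_poly] keeps the terms of order below e^4 of the exponential of the phase,
   [phase_poly_rem] the remaining ones of its cubic Taylor polynomial. *)
Definition phase_poly (r e s : R) : C :=
  (1 + RtoC r * RtoC e * low_line s
   + RtoC e ^ 2 * (RtoC r ^ 2 * low_line s ^ 2 / 2 - Ci * low_line s ^ 5 / 60)
   + RtoC e ^ 3 * (RtoC r ^ 3 * low_line s ^ 3 / 6 - Ci * RtoC r * low_line s ^ 6 / 60))%C.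

Definition phase_poly_rem (r e s : R) : C :=
  (RtoC e ^ 4 * (Ci ^ 2 * low_line s ^ 10 / 7200 - Ci * RtoC r ^ 2 * low_line s ^ 7 / 120
     + RtoC e * RtoC r * Ci ^ 2 * low_line s ^ 11 / 7200
     - RtoC e ^ 2 * Ci ^ 3 * low_line s ^ 15 / 1296000)
   + phase_rem r e s * (1 + (2 * phase_lead r e s + phase_rem r e s) / 2
        + (3 * phase_lead r e s ^ 2 + 3 * phase_lead r e s * phase_rem r e s + phase_rem r e s ^ 2) / 6))%C.

Definition phase_exp_tail (r e s : R) : C :=
  Cminus (Cexp (phase_lead r e s + phase_rem r e s)%C) (Cexp_poly 4 (phase_lead r e s + phase_rem r e s)%C).

Lemma Cexp_poly_4 (z : C) : Cexp_poly 4 z = (1 + z + z ^ 2 / 2 + z ^ 3 / 6)%C.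
Proof.
  unfold Cexp_poly.
  replace (/ INR (Factorial.fact 0)) with 1 by (simpl; field).
  replace (/ INR (Factorial.fact 1)) with 1 by (simpl; field).
  replace (/ INR (Factorial.fact 2)) with (/ 2) by (simpl; field).
  replace (/ INR (Factorial.fact 3)) with (/ 6) by (simpl; field).
  rewrite !RtoC_inv by lra. field.
Qed.

Lemma exp_phase_split (r e s : R) :
  Cexp (phase_lead r e s + phase_rem r e s)%C = (phase_poly r e s + phase_poly_rem r e s + phase_exp_tail r e s)%C.
Proof.
  unfold phase_exp_tail. rewrite Cexp_poly_4.
  assert (H : (1 + (phase_lead r e s + phase_rem r e s) + (phase_lead r e s + phase_rem r e s) ^ 2 / 2
     + (phase_lead r e s + phase_rem r e s) ^ 3 / 6 = phase_poly r e s + phase_poly_rem r e s)%C).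
  { unfold phase_poly_rem, phase_poly. generalize (phase_rem r e s). intros w. unfold phase_lead.
    generalize (low_line s) (RtoC r) (RtoC e). intros. field. }
  rewrite H. ring.
Qed.

Lemma ord_phase_lead (M : R) : ord M 1 phase_lead.
Proof.
  apply (ord_ext M 1 (fun r e s => Cmult (RtoC e)
    (RtoC r * low_line s - Ci * RtoC e * low_line s ^ 5 / 60)%C)).
  { intros. unfold phase_lead. field. }
  apply (ord_mult M 1 0); [apply ord_e | ord0].
Qed.

Lemma ord_phase_rem (M : R) : ord M 4 phase_rem.
Proof.
  apply (ord_mult M 0 4); [apply ord_const|].
  apply (ord_div M 4 3 (fun _ e s => sh_rem (scaled e s))). apply ord_sh_rem.
Qed.

Lemma ord_phase_poly_rem (M : R) : ord M 4 phase_poly_rem.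
Proof.
  assert (H1 : ord M 0 phase_lead) by (apply (ord_weaken M 1); [lia | apply ord_phase_lead]).
  assert (H2 : ord M 0 phase_rem) by (apply (ord_weaken M 4); [lia | apply ord_phase_rem]).
  apply ord_plus.
  - apply (ord_mult M 4 0); [exact (ord_pow M 1 4 _ (ord_e M)) | ord0].
  - apply (ord_mult M 4 0); [apply ord_phase_rem|].
    revert H1 H2. generalize phase_lead phase_rem. intros f g H1 H2. ord0.
Qed.

Lemma Csh_parts (a b : R) : Csh (a, b) = (sinh a * cos b, cosh a * sin b).
Proof.
  unfold Csh, Cexp, sinh, cosh. apply Ceq; unfold Re, Im; simpl;
  rewrite cos_neg, sin_neg; field.
Qed.

(** With t = 2 / e^3 the cubic term of t (sinh(e v) - e v) is exactly v^3 / 3. The right side is the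
    Bessel exponent on the shifted line, without the constant i nu pi / 2. *)
Lemma phase_total (r e s : R) : 0 < e ->
  Cplus (airy_phase 0 s) (phase_lead r e s + phase_rem r e s)%C =
  (RtoC r * scaled e s - Ci * RtoC (2 / e ^ 3) * (Csh (scaled e s) - scaled e s))%C.
Proof.
  intros He. unfold airy_phase, phase_lead, phase_rem, sh_rem, scaled.
  generalize (Csh (RtoC e * low_line s)%C) (low_line s). intros S v.
  assert (He' : RtoC e <> RtoC 0) by (intro H; apply (f_equal fst) in H; simpl in H; lra).
  unfold Rdiv. rewrite RtoC_mult, !RtoC_inv by (try lra; apply pow_nonzero; lra).
  replace (RtoC (-2)) with (Copp (RtoC 2)) by (apply Ceq; simpl; ring).
  rewrite RtoC_pow. field; auto.
Qed.

Lemma cos_lower (x : R) : 0 <= x -> 1 - x ^ 2 / 2 <= cos x.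
Proof.
  intros Hx.
  assert (H1 : forall x, 0 <= x -> sin x <= x).
  { clear x Hx. intros x Hx. enough (sin x - sin 0 <= x - 0) by (rewrite sin_0 in H; lra).
    apply (derive_le_increment sin cos (fun x => x) (fun _ => 1)); auto.
    - intros; auto_derive; trivial; ring.
    - intros; auto_derive; trivial; ring.
    - intros; apply COS_bound. }
  enough (- cos x - - cos 0 <= x ^ 2 / 2 - 0 ^ 2 / 2) by (rewrite cos_0 in H; lra).
  apply (derive_le_increment (fun x => - cos x) sin (fun x => x ^ 2 / 2) (fun x => x)); auto.
  - intros; auto_derive; trivial; ring.
  - intros; auto_derive; trivial; field.
  - intros y Hy; apply H1; lra.
Qed.

Lemma sin_lower (e : R) : 0 <= e -> e - e ^ 3 / 6 <= sin e.
Proof.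
  intros He.
  enough ((e - e ^ 3 / 6) - (0 - 0 ^ 3 / 6) <= sin e - sin 0) by (rewrite sin_0 in H; lra).
  apply (derive_le_increment (fun x => x - x ^ 3 / 6) (fun x => 1 - x ^ 2 / 2) sin cos); auto.
  - intros; auto_derive; trivial; field.
  - intros; auto_derive; trivial; ring.
  - intros y Hy; apply cos_lower; lra.
Qed.

(** [ord] bounds the phase corrections only by exp(c |s|), which is too weak once they are
    exponentiated, so the exact phase is estimated: (2 / e^3) sin e (cosh(e s) - 1) >= (1 - e^2 / 6)
    s^2, and e <= 1 gives the rate 5/6. *)
Lemma phase_total_Re_le (M r e s : R) : Rabs r <= M -> 0 < e <= 1 ->
  Re (Cplus (airy_phase 0 s) (phase_lead r e s + phase_rem r e s)%C) <= / 3 + M * Rabs s - 5 / 6 * s ^ 2.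
Proof.
  intros Hr He. rewrite phase_total by lra.
  replace (scaled e s) with (e * s, - e) by (unfold scaled; apply Ceq; unfold Re, Im; simpl; ring).
  rewrite Csh_parts, sin_neg, cos_neg.
  replace (Re _) with (r * (e * s) - 2 / e ^ 3 * sin e * (cosh (e * s) - 1) + 2 / e ^ 3 * (e - sin e))
    by (unfold Re; simpl; field; lra).
  assert (H1 := sin_lower e ltac:(lra)).
  assert (H2 := proj1 (cosh_bounds (e * s))).
  assert (He3 : 0 < e ^ 3) by (apply pow_lt; lra).
  assert (Ht : 0 < 2 / e ^ 3) by (apply Rdiv_lt_0_compat; lra).
  assert (A1 : r * (e * s) <= M * Rabs s).
  { apply Rle_trans with (Rabs (r * (e * s))); [apply Rle_abs|].
    rewrite !Rabs_mult, (Rabs_pos_eq e) by lra.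
    apply Rmult_le_compat; auto; [apply Rabs_pos | | ].
    - apply Rmult_le_pos; [lra | apply Rabs_pos].
    - generalize (Rabs_pos s); nra. }
  assert (A2 : 2 / e ^ 3 * (e - sin e) <= / 3).
  { replace (/ 3) with (2 / e ^ 3 * (e ^ 3 / 6)) by (field; lra).
    apply Rmult_le_compat_l; lra. }
  assert (A3 : 5 / 6 * s ^ 2 <= 2 / e ^ 3 * sin e * (cosh (e * s) - 1)).
  { apply Rle_trans with (2 / e ^ 3 * (e - e ^ 3 / 6) * ((e * s) ^ 2 / 2)).
    - replace (2 / e ^ 3 * (e - e ^ 3 / 6) * ((e * s) ^ 2 / 2)) with ((1 - e ^ 2 / 6) * s ^ 2)
        by (field; lra).
      apply Rmult_le_compat_r; [apply pow2_ge_0 | nra].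
    - assert (0 <= e - e ^ 3 / 6).
      { replace (e - e ^ 3 / 6) with (e * (1 - e ^ 2 / 6)) by field. apply Rmult_le_pos; nra. }
      apply Rmult_le_compat.
      + apply Rmult_le_pos; lra.
      + apply Rmult_le_pos; [apply pow2_ge_0 | lra].
      + apply Rmult_le_compat_l; lra.
      + lra. }
  lra.
Qed.

(** * Integration against the Airy weight *)

Definition airy_weight (s : R) : C := Cexp (airy_phase 0 s).

(** The analogue of [ord] with the Gaussian rate of [phase_total_Re_le]; such functions can be
    integrated without losing their power of e. *)
Definition ordA (M : R) (n : nat) (f : R -> R -> R -> C) : Prop :=
  exists K c, 0 <= K /\ 0 <= c /\ forall r e s, Rabs r <= M -> 0 < e <= 1 ->
    Cmod (f r e s) <= K * e ^ n * exp (c * Rabs s - 5 / 6 * s ^ 2).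

Lemma ordA_intro (M : R) (n : nat) (f : R -> R -> R -> C) :
  ord M n f -> ordA M n (fun r e s => Cmult (f r e s) (airy_weight s)).
Proof.
  intros [K [c [H1 [H2 H]]]]. exists (K * exp (/ 3)), c.
  split; [apply Rmult_le_pos; [auto | apply Rlt_le, exp_pos]|]. split; auto.
  intros r e s Hr He. rewrite Cmod_mult. unfold airy_weight. rewrite Cmod_Cexp, airy_phase_Re.
  apply Rle_trans with (K * e ^ n * exp (c * Rabs s) * exp (/ 3 - 5 / 6 * s ^ 2)).
  - apply Rmult_le_compat; [apply Cmod_ge_0 | apply Rlt_le, exp_pos | auto |].
    apply exp_le. generalize (pow2_ge_0 s). lra.
  - right. unfold Rminus. rewrite !exp_plus. ring.
Qed.

Lemma ordA_plus (M : R) (n : nat) (f g : R -> R -> R -> C) :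
  ordA M n f -> ordA M n g -> ordA M n (fun r e s => Cplus (f r e s) (g r e s)).
Proof.
  intros [K [c [H1 [H2 H]]]] [K' [c' [H1' [H2' H']]]].
  exists (K + K'), (c + c'). repeat split; try lra. intros r e s Hr He.
  eapply Rle_trans; [apply Cmod_triangle|].
  specialize (H r e s Hr He). specialize (H' r e s Hr He).
  assert (0 <= Rabs s) by apply Rabs_pos.
  assert (0 < e ^ n) by (apply pow_lt; lra).
  assert (exp (c * Rabs s - 5 / 6 * s ^ 2) <= exp ((c + c') * Rabs s - 5 / 6 * s ^ 2))
    by (apply exp_le; nra).
  assert (exp (c' * Rabs s - 5 / 6 * s ^ 2) <= exp ((c + c') * Rabs s - 5 / 6 * s ^ 2))
    by (apply exp_le; nra).
  rewrite (Rmult_plus_distr_r K), (Rmult_plus_distr_r (K * _)). apply Rplus_le_compat.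
  - eapply Rle_trans; [apply H|]. apply Rmult_le_compat_l; auto.
    apply Rmult_le_pos; lra.
  - eapply Rle_trans; [apply H'|]. apply Rmult_le_compat_l; auto.
    apply Rmult_le_pos; lra.
Qed.

Lemma ordA_mult (M : R) (n m : nat) (f g : R -> R -> R -> C) :
  ord M n f -> ordA M m g -> ordA M (n + m) (fun r e s => Cmult (f r e s) (g r e s)).
Proof.
  intros [K [c [H1 [H2 H]]]] [K' [c' [H1' [H2' H']]]].
  exists (K * K'), (c + c'). split; [apply Rmult_le_pos; auto|]. split; [lra|].
  intros r e s Hr He. rewrite Cmod_mult.
  replace (K * K' * e ^ (n + m) * exp ((c + c') * Rabs s - 5 / 6 * s ^ 2))
    with ((K * e ^ n * exp (c * Rabs s)) * (K' * e ^ m * exp (c' * Rabs s - 5 / 6 * s ^ 2))).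
  - apply Rmult_le_compat; auto; apply Cmod_ge_0.
  - replace ((c + c') * Rabs s - 5 / 6 * s ^ 2) with (c * Rabs s + (c' * Rabs s - 5 / 6 * s ^ 2)) by ring.
    rewrite pow_add, exp_plus. ring.
Qed.

(** The Airy weight tames the maximum in [Cexp_taylor]: the alternative 1 leaves Airy's exponent,
    the alternative exp(Re w) the full phase, and both lie below the bound of
    [phase_total_Re_le]. *)
Lemma ordA_phase_exp_tail (M : R) : 0 <= M -> ordA M 4 (fun r e s => Cmult (phase_exp_tail r e s) (airy_weight s)).
Proof.
  intros HM.
  assert (HE : ord M 1 (fun r e s => Cplus (phase_lead r e s) (phase_rem r e s))).
  { apply ord_plus; [apply ord_phase_lead | apply (ord_weaken M 4); [lia | apply ord_phase_rem]]. }
  destruct (ord_pow M 1 4 _ HE) as [K [c [H1 [H2 H]]]].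
  exists (16 * K * exp (/ 3)), (c + M).
  split; [apply Rmult_le_pos; [lra | apply Rlt_le, exp_pos]|]. split; [lra|].
  intros r e s Hr He. specialize (H r e s Hr He). change (4 * 1)%nat with 4%nat in H.
  rewrite Cmod_pow in H. rewrite Cmod_mult. unfold phase_exp_tail, airy_weight. rewrite Cmod_Cexp.
  assert (HR := phase_total_Re_le M r e s Hr He).
  assert (Ht := Cexp_taylor 4 (phase_lead r e s + phase_rem r e s)%C).
  set (w := (phase_lead r e s + phase_rem r e s)%C) in *.
  assert (HR' : Re (airy_phase 0 s) + Re w <= / 3 + M * Rabs s - 5 / 6 * s ^ 2) by exact HR.
  assert (Hm : Rmax 1 (exp (Re w)) * exp (Re (airy_phase 0 s))
             <= exp (/ 3 + M * Rabs s - 5 / 6 * s ^ 2)).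
  { apply Rmax_case.
    - rewrite Rmult_1_l. apply exp_le. rewrite airy_phase_Re.
      generalize (pow2_ge_0 s) (Rabs_pos s). nra.
    - rewrite <- exp_plus. apply exp_le. lra. }
  apply Rle_trans with (2 ^ 4 * Cmod w ^ 4 * (Rmax 1 (exp (Re w)) * exp (Re (airy_phase 0 s)))).
  { rewrite <- Rmult_assoc. apply Rmult_le_compat_r; [apply Rlt_le, exp_pos | auto]. }
  apply Rle_trans with (2 ^ 4 * (K * e ^ 4 * exp (c * Rabs s)) * exp (/ 3 + M * Rabs s - 5 / 6 * s ^ 2)).
  - apply Rmult_le_compat; auto.
    + apply Rmult_le_pos; apply pow_le; [lra | apply Cmod_ge_0].
    + apply Rmult_le_pos; [|apply Rlt_le, exp_pos].
      apply Rle_trans with 1; [lra | apply Rmax_l].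
    + apply Rmult_le_compat_l; [apply pow_le; lra | auto].
  - right. unfold Rminus. rewrite Rmult_plus_distr_r, !exp_plus. ring.
Qed.

Lemma ordA_cint (M : R) (n : nat) (f : R -> R -> R -> C) :
  ordA M n f -> (forall r e, Rabs r <= M -> 0 < e <= 1 -> Ccont (f r e)) ->
  (forall r e, Rabs r <= M -> 0 < e <= 1 -> Cdominated (f r e)) /\
  exists K, 0 <= K /\ forall r e, Rabs r <= M -> 0 < e <= 1 -> Cmod (cint (f r e)) <= K * e ^ n.
Proof.
  intros [K [c [H1 [H2 H]]]] Hc.
  assert (HB : forall r e s, Rabs r <= M -> 0 < e <= 1 ->
    Cmod (f r e s) <= (K * e ^ n * exp ((c + 1) ^ 2 / (4 * (5 / 6)))) * exp (- Rabs s)).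
  { intros r e s Hr He. eapply Rle_trans; [apply H; auto|]. rewrite (Rmult_assoc (K * e ^ n)).
    apply Rmult_le_compat_l.
    - apply Rmult_le_pos; [auto | apply pow_le; lra].
    - apply gauss_dominated. lra. }
  split.
  - intros r e Hr He. eapply Cdominated_intro; [apply Hc; auto | intros; apply HB; auto].
  - exists (8 * K * exp ((c + 1) ^ 2 / (4 * (5 / 6)))).
    split; [apply Rmult_le_pos; [lra | apply Rlt_le, exp_pos]|].
    intros r e Hr He. eapply Rle_trans; [apply cint_bound|].
    + apply Hc; auto.
    + intros; apply HB; auto.
    + right; ring.
Qed.

Lemma Ccont_Cexp (f : R -> C) : Ccont f -> Ccont (fun x => Cexp (f x)).
Proof.
  intros [H1 H2]. unfold Cexp. apply Ccont_mult.
  - split; intros x; simpl.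
    + apply (continuous_comp (fun x => Re (f x)) exp); [apply H1|].
      apply (cont_of_derive _ _ _ (is_derive_exp _)).
    + apply continuous_const.
  - split; intros x; simpl.
    + apply (continuous_comp (fun x => Im (f x)) cos); [apply H2|].
      apply (cont_of_derive _ _ _ (is_derive_cos _)).
    + apply (continuous_comp (fun x => Im (f x)) sin); [apply H2|].
      apply (cont_of_derive _ _ _ (is_derive_sin _)).
Qed.

Lemma Ccont_opp (f : R -> C) : Ccont f -> Ccont (fun x => Copp (f x)).
Proof.
  intros [H1 H2]. split; intros x; simpl.
  - apply (continuous_opp (V := R_NormedModule) (fun x => Re (f x))), H1.
  - apply (continuous_opp (V := R_NormedModule) (fun x => Im (f x))), H2.
Qed.

Lemma Ccont_minus (f g : R -> C) : Ccont f -> Ccont g -> Ccont (fun x => Cminus (f x) (g x)).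
Proof. intros Hf Hg. exact (Ccont_plus _ _ Hf (Ccont_opp _ Hg)). Qed.

Lemma Ccont_divc (f : R -> C) (c : C) : Ccont f -> Ccont (fun x => Cdiv (f x) c).
Proof. intros Hf. exact (Ccont_mult _ _ Hf (Ccont_const _)). Qed.

Lemma Ccont_low_line : Ccont low_line.
Proof. eapply Ccont_dC. apply dC_low_line. Qed.

Lemma Ccont_pow (f : R -> C) (k : nat) : Ccont f -> Ccont (fun s => Cpow (f s) k).
Proof.
  intros H. induction k; [exact (Ccont_const 1%C) | exact (Ccont_mult _ _ H IHk)].
Qed.

Ltac ccont := lazymatch goal with
  | |- Ccont (fun _ => ?c) => exact (Ccont_const c)
  | |- Ccont (fun s => Cplus _ _) => apply Ccont_plus; ccont
  | |- Ccont (fun s => Cminus _ _) => apply Ccont_minus; ccont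
  | |- Ccont (fun s => Copp _) => apply Ccont_opp; ccont
  | |- Ccont (fun s => Cmult _ _) => apply Ccont_mult; ccont
  | |- Ccont (fun s => Cdiv _ _) => apply Ccont_divc; ccont
  | |- Ccont (fun s => Cexp _) => apply Ccont_Cexp; ccont
  | |- Ccont (fun s => Cpow _ _) => apply Ccont_pow; ccont
  | |- Ccont low_line => exact Ccont_low_line
  | |- Ccont (fun s => low_line s) => exact Ccont_low_line
  | |- _ => try assumption
  end.

Lemma Ccont_Csh (e : R) : Ccont (fun s => Csh (scaled e s)).
Proof. unfold Csh, scaled. ccont. Qed.

Lemma Ccont_phase_lead (r e : R) : Ccont (phase_lead r e).
Proof. unfold phase_lead. ccont. Qed.

Lemma Ccont_phase_rem (r e : R) : Ccont (phase_rem r e).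
Proof.
  unfold phase_rem, sh_rem. assert (H := Ccont_Csh e).
  assert (Hs : forall k, Ccont (fun s => Cpow (scaled e s) k)).
  { intros k. apply Ccont_pow. unfold scaled. ccont. }
  apply Ccont_mult; [apply Ccont_const|]. apply Ccont_mult; [apply Ccont_const|].
  apply Ccont_minus; [exact H|]. apply Ccont_plus; [unfold scaled; ccont|].
  apply Ccont_plus; (apply Ccont_mult; [apply Ccont_const | apply Hs]).
Qed.

Lemma Ccont_phase_poly (r e : R) : Ccont (phase_poly r e).
Proof. unfold phase_poly. ccont. Qed.

Lemma Ccont_airy_weight : Ccont airy_weight.
Proof. exact (Ccont_airy_exp 0). Qed.

Definition bessel_integrand (r e s : R) : C :=
  Cmult (Cexp (phase_lead r e s + phase_rem r e s)%C) (airy_weight s).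

Lemma Ccont_exp_phase (r e : R) : Ccont (fun s => Cexp (phase_lead r e s + phase_rem r e s)%C).
Proof. apply Ccont_Cexp, Ccont_plus; [apply Ccont_phase_lead | apply Ccont_phase_rem]. Qed.

(** At x = 0 the recurrence reduces all moments to those of index 0 and 1. Those of index 2 and 5
    vanish, which removes the whole e^2 correction from [main0]. *)
Lemma airy_moment_values :
  airy_moment 2 0 = 0%C /\ airy_moment 3 0 = Cmult (Copp Ci) (airy_moment 0 0) /\
  airy_moment 4 0 = Cmult (Cmult (RtoC (-2)) Ci) (airy_moment 1 0) /\
  airy_moment 5 0 = 0%C /\ airy_moment 6 0 = Cmult (RtoC (-4)) (airy_moment 0 0) /\
  airy_moment 7 0 = Cmult (RtoC (-10)) (airy_moment 1 0).
Proof.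
  assert (H : forall k, airy_moment (k + 2) 0 =
    Cmult (Copp Ci) (Cmult (RtoC (INR k)) (airy_moment (pred k) 0))).
  { intros k. rewrite <- airy_moment_rec. ring. }
  assert (H2 := H 0%nat). assert (H3 := H 1%nat). assert (H4 := H 2%nat).
  assert (H5 := H 3%nat). assert (H6 := H 4%nat). assert (H7 := H 5%nat).
  simpl Nat.add in *. simpl Nat.pred in *. rewrite !INR_IZR_INZ in *. simpl Z.of_nat in *.
  assert (V2 : airy_moment 2 0 = 0%C) by (rewrite H2; ring).
  assert (C2 : forall z, Cmult (Copp Ci) (Cmult (Copp Ci) z) = Copp z).
  { intros z. transitivity (Cmult (Cmult Ci Ci) z); [ring|]. rewrite Ci2, RtoC_m1. ring. }
  repeat split.
  - exact V2.
  - rewrite H3. ring.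
  - rewrite H4. replace (RtoC (-2)) with (Copp (RtoC 2)) by (apply Ceq; simpl; ring). ring.
  - rewrite H5, V2. ring.
  - rewrite H6, H3. replace (RtoC (-4)) with (Copp (RtoC 4)) by (apply Ceq; simpl; ring).
    transitivity (Cmult (RtoC 4) (Cmult (Copp Ci) (Cmult (Copp Ci) (airy_moment 0 0)))); [ring|].
    rewrite C2. ring.
  - rewrite H7, H4. replace (RtoC (-10)) with (Copp (RtoC 10)) by (apply Ceq; simpl; ring).
    transitivity (Cmult (RtoC 10) (Cmult (Copp Ci) (Cmult (Copp Ci) (airy_moment 1 0)))); [ring|].
    rewrite C2. ring.
Qed.

Definition main0 (r e : R) : C :=
  ((1 + Ci * RtoC (e ^ 3 * (r / 15 - r ^ 3 / 6))) * airy_moment 0 0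
    + RtoC (r * e) * airy_moment 1 0)%C.

(** The expansion of the integral with the additional factor sinh(e v) / e, from which the
    derivative of K_nu in y is obtained. *)
Definition main1 (r e : R) : C :=
  ((1 - 2 * Ci * RtoC (e ^ 3 * (r ^ 3 / 6 + r / 12))) * airy_moment 1 0
    - Ci * RtoC (e ^ 2 * (r ^ 2 / 2 + / 10)) * airy_moment 0 0)%C.

(** A formal combination of moments can be evaluated on kernels as well as on their integrals, so
    term-by-term integration becomes one induction on the list. *)
Fixpoint lin_moments (l : list (C * nat)) (F : nat -> C) : C :=
  match l with
  | nil => 0%C
  | cons (c, k) l => Cplus (Cmult c (F k)) (lin_moments l F)
  end.

Lemma cint_lin_moments (l : list (C * nat)) :
  Cdominated (fun s => lin_moments l (fun k => airy_kernel k 0 s)) /\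
  cint (fun s => lin_moments l (fun k => airy_kernel k 0 s))
    = lin_moments l (fun k => airy_moment k 0).
Proof.
  induction l as [|[c k] l [IH1 IH2]]; simpl.
  - assert (E : forall s : R, Cmult 0 (airy_kernel 0 0 s) = 0%C) by (intros; ring).
    split.
    + apply (Cdominated_ext (fun s => Cmult 0 (airy_kernel 0 0 s))); auto.
      apply Cdominated_scal, airy_kernel_dominated.
    + rewrite (cint_ext _ (fun s => Cmult 0 (airy_kernel 0 0 s))) by auto.
      rewrite cint_scal by apply airy_kernel_dominated. ring.
  - assert (Hk : Cdominated (fun s => Cmult c (airy_kernel k 0 s)))
      by apply Cdominated_scal, airy_kernel_dominated.
    split.
    + apply Cdominated_plus; auto.
    + rewrite cint_plus, IH2 by auto. f_equal.
      rewrite cint_scal by apply airy_kernel_dominated. reflexivity.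
Qed.

Definition phase_poly_list (r e : R) : list (C * nat) :=
  ((RtoC 1, 0%nat) :: ((RtoC r * RtoC e)%C, 1%nat) :: ((RtoC e ^ 2 * RtoC r ^ 2 / 2)%C, 2%nat)
   :: ((- RtoC e ^ 2 * Ci / 60)%C, 5%nat) :: ((RtoC e ^ 3 * RtoC r ^ 3 / 6)%C, 3%nat)
   :: ((- RtoC e ^ 3 * Ci * RtoC r / 60)%C, 6%nat) :: nil)%list.

Definition phase_poly_sh_list (r e : R) : list (C * nat) :=
  ((RtoC 1, 1%nat) :: ((RtoC r * RtoC e)%C, 2%nat)
   :: ((RtoC e ^ 2 * (RtoC r ^ 2 / 2 + 1 / 6))%C, 3%nat)
   :: ((- RtoC e ^ 2 * Ci / 60)%C, 6%nat)
   :: ((RtoC e ^ 3 * (RtoC r ^ 3 / 6 + RtoC r / 6))%C, 4%nat)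
   :: ((- RtoC e ^ 3 * Ci * RtoC r / 60)%C, 7%nat) :: nil)%list.

Definition phase_poly_sh (r e s : R) : C :=
  (low_line s * phase_poly r e s + RtoC e ^ 2 * low_line s ^ 3 / 6 * (1 + RtoC r * RtoC e * low_line s))%C.

Lemma phase_poly_list_eq (r e s : R) :
  Cmult (phase_poly r e s) (airy_weight s) = lin_moments (phase_poly_list r e) (fun k => airy_kernel k 0 s).
Proof.
  unfold phase_poly_list, lin_moments, airy_kernel, phase_poly, airy_weight.
  generalize (Cexp (airy_phase 0 s)) (low_line s) (RtoC r) (RtoC e). intros. field.
Qed.

Lemma phase_poly_sh_list_eq (r e s : R) :
  Cmult (phase_poly_sh r e s) (airy_weight s) = lin_moments (phase_poly_sh_list r e) (fun k => airy_kernel k 0 s).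
Proof.
  unfold phase_poly_sh_list, lin_moments, airy_kernel, phase_poly_sh, phase_poly, airy_weight.
  generalize (Cexp (airy_phase 0 s)) (low_line s) (RtoC r) (RtoC e). intros. field.
Qed.

Lemma lin_moments_phase_poly (r e : R) :
  lin_moments (phase_poly_list r e) (fun k => airy_moment k 0) = main0 r e.
Proof.
  destruct airy_moment_values as [V2 [V3 [V4 [V5 [V6 V7]]]]].
  unfold phase_poly_list, lin_moments, main0. rewrite V2, V3, V5, V6.
  generalize (airy_moment 0 0) (airy_moment 1 0). intros [a1 a2] [b1 b2].
  apply Ceq; unfold Re, Im; simpl; field.
Qed.

Lemma lin_moments_phase_poly_sh (r e : R) :
  lin_moments (phase_poly_sh_list r e) (fun k => airy_moment k 0) = main1 r e.
Proof.
  destruct airy_moment_values as [V2 [V3 [V4 [V5 [V6 V7]]]]].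
  unfold phase_poly_sh_list, lin_moments, main1. rewrite V2, V3, V4, V6, V7.
  generalize (airy_moment 0 0) (airy_moment 1 0). intros [a1 a2] [b1 b2].
  apply Ceq; unfold Re, Im; simpl; field.
Qed.

Lemma ordA_ext (M : R) (n : nat) (f g : R -> R -> R -> C) :
  (forall r e s, Rabs r <= M -> 0 < e <= 1 -> f r e s = g r e s) -> ordA M n f -> ordA M n g.
Proof.
  intros E [K [c [H1 [H2 H]]]]. exists K, c. repeat split; auto.
  intros. rewrite <- E; auto.
Qed.

Lemma integral_expansion_0 (M : R) : 0 <= M -> exists K, 0 <= K /\
  forall r e, Rabs r <= M -> 0 < e <= 1 ->
    Cmod (Cminus (cint (bessel_integrand r e)) (main0 r e)) <= K * e ^ 4.
Proof.
  intros HM.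
  assert (HA : ordA M 4 (fun r e s => Cmult (Cminus (Cexp (phase_lead r e s + phase_rem r e s)%C) (phase_poly r e s)) (airy_weight s))).
  { apply (ordA_ext M 4 (fun r e s => Cplus (Cmult (phase_poly_rem r e s) (airy_weight s)) (Cmult (phase_exp_tail r e s) (airy_weight s)))).
    - intros. rewrite exp_phase_split. ring.
    - apply ordA_plus; [apply ordA_intro, ord_phase_poly_rem | apply ordA_phase_exp_tail; auto]. }
  destruct (ordA_cint M 4 _ HA) as [Hd [K [HK H]]].
  { intros r e _ _. apply Ccont_mult; [|apply Ccont_airy_weight].
    apply Ccont_minus; [apply Ccont_exp_phase | apply Ccont_phase_poly]. }
  exists K. split; auto. intros r e Hr He.
  specialize (H r e Hr He). specialize (Hd r e Hr He).
  destruct (cint_lin_moments (phase_poly_list r e)) as [L1 L2].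
  rewrite <- lin_moments_phase_poly, <- L2.
  rewrite (cint_ext (bessel_integrand r e) (fun s => Cplus
     (Cmult (Cminus (Cexp (phase_lead r e s + phase_rem r e s)%C) (phase_poly r e s)) (airy_weight s))
     (lin_moments (phase_poly_list r e) (fun k => airy_kernel k 0 s)))).
  - rewrite cint_plus by auto. unfold Cminus at 1. rewrite <- Cplus_assoc, Cplus_opp_r, Cplus_0_r. auto.
  - intros s. rewrite <- phase_poly_list_eq. unfold bessel_integrand. ring.
Qed.

Lemma Csh_over_e (e s : R) : 0 < e ->
  Cmult (RtoC (/ e)) (Csh (scaled e s)) =
  (low_line s + RtoC e ^ 2 * low_line s ^ 3 / 6 +
    (RtoC e ^ 4 * low_line s ^ 5 / 120 + RtoC (/ e ^ 1) * sh_rem (scaled e s)))%C.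
Proof.
  intros He. unfold sh_rem, scaled. rewrite pow_1. rewrite !RtoC_inv by lra.
  assert (He' : RtoC e <> RtoC 0) by (intro H; apply (f_equal fst) in H; simpl in H; lra).
  field. auto.
Qed.

Lemma integral_expansion_1 (M : R) : 0 <= M -> exists K, 0 <= K /\
  forall r e, Rabs r <= M -> 0 < e <= 1 ->
    Cdominated (fun s => Cmult (Cmult (RtoC (/ e)) (Csh (scaled e s))) (bessel_integrand r e s)) /\
    Cmod (Cminus (cint (fun s => Cmult (Cmult (RtoC (/ e)) (Csh (scaled e s))) (bessel_integrand r e s)))
       (main1 r e)) <= K * e ^ 4.
Proof.
  intros HM.
  set (rem := fun (r e s : R) => (RtoC e ^ 4 * low_line s ^ 5 / 120
               + RtoC (/ e ^ 1) * sh_rem (scaled e s))%C).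
  set (rho := fun (r e s : R) => (low_line s + RtoC e ^ 2 * low_line s ^ 3 / 6)%C).
  assert (Hrem : ord M 4 rem).
  { apply ord_plus.
    - apply (ord_ext M 4 (fun r e s => Cmult (RtoC e ^ 4)%C (low_line s ^ 5 / 120)%C)).
      { intros. field. }
      apply (ord_mult M 4 0); [exact (ord_pow M 1 4 _ (ord_e M)) | ord0].
    - apply (ord_weaken M 6); [lia|].
      apply (ord_div M 6 1 (fun _ e s => sh_rem (scaled e s))). apply ord_sh_rem. }
  assert (Hrho : ord M 0 rho) by (unfold rho; ord0).
  (* The product of sinh(e v) / e with [phase_poly] + [phase_poly_rem] exceeds [phase_poly_sh] by
     exactly this sum. *)
  assert (HS : ord M 4 (fun r e s => Cplus (RtoC e ^ 4 *
      (low_line s ^ 3 / 6 * ((RtoC r ^ 2 * low_line s ^ 2 / 2 - Ci * low_line s ^ 5 / 60)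
        + RtoC e * (RtoC r ^ 3 * low_line s ^ 3 / 6 - Ci * RtoC r * low_line s ^ 6 / 60))))%C
      (Cplus (Cmult (rem r e s) (phase_poly r e s)) (Cmult (Cplus (rho r e s) (rem r e s)) (phase_poly_rem r e s))))).
  { apply ord_plus.
    - apply (ord_mult M 4 0); [exact (ord_pow M 1 4 _ (ord_e M)) | ord0].
    - apply ord_plus.
      + apply (ord_mult M 4 0); auto. unfold phase_poly. ord0.
      + apply (ord_mult M 0 4); [|apply ord_phase_poly_rem].
        apply ord_plus; auto. apply (ord_weaken M 4); auto with arith. }
  assert (HA : ordA M 4 (fun r e s => Cmult (Cminus (Cmult (Cmult (RtoC (/ e)) (Csh (scaled e s)))
       (Cexp (phase_lead r e s + phase_rem r e s)%C)) (phase_poly_sh r e s)) (airy_weight s))).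
  { eapply ordA_ext; [|apply ordA_plus; [apply ordA_intro, HS|]].
    2:{ apply (ordA_mult M 0 4 (fun r e s => Cplus (rho r e s) (rem r e s))).
        - apply ord_plus; auto. apply (ord_weaken M 4); auto with arith.
        - apply ordA_phase_exp_tail; auto. }
    intros r e s Hr He. cbv beta. rewrite exp_phase_split, Csh_over_e by lra.
    fold (rem r e s). fold (rho r e s). unfold phase_poly_sh.
    generalize (rem r e s) (phase_poly_rem r e s) (phase_exp_tail r e s) (airy_weight s). intros a b c d.
    unfold rho, phase_poly. field. }
  destruct (ordA_cint M 4 _ HA) as [Hd [K [HK H]]].
  { intros r e _ _. apply Ccont_mult; [|apply Ccont_airy_weight].
    apply Ccont_minus.
    - apply Ccont_mult; [|apply Ccont_exp_phase].
      apply Ccont_mult; [apply Ccont_const | apply Ccont_Csh].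
    - assert (Hp := Ccont_phase_poly r e). unfold phase_poly_sh. ccont. }
  exists K. split; auto. intros r e Hr He.
  specialize (H r e Hr He). specialize (Hd r e Hr He).
  destruct (cint_lin_moments (phase_poly_sh_list r e)) as [L1 L2].
  rewrite <- lin_moments_phase_poly_sh, <- L2.
  assert (E : forall s, Cplus (Cmult (Cminus (Cmult (Cmult (RtoC (/ e)) (Csh (scaled e s)))
       (Cexp (phase_lead r e s + phase_rem r e s)%C)) (phase_poly_sh r e s)) (airy_weight s))
     (lin_moments (phase_poly_sh_list r e) (fun k => airy_kernel k 0 s))
     = Cmult (Cmult (RtoC (/ e)) (Csh (scaled e s))) (bessel_integrand r e s)).
  { intros s. rewrite <- phase_poly_sh_list_eq. unfold bessel_integrand. ring. }
  split.
  - apply (Cdominated_ext _ _ E). apply Cdominated_plus; auto.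
  - rewrite <- (cint_ext _ _ E), cint_plus by auto.
    unfold Cminus at 1. rewrite <- Cplus_assoc, Cplus_opp_r, Cplus_0_r. auto.
Qed.

(** The contour moves to imaginary part pi / 2 - e and is dilated by e, so that z = i pi / 2 + e v
    with v on the Airy line; there cosh z = i sinh(e v). As e <= 1 < pi / 2, this line stays in the
    strip of [bessel_shift]. *)
Lemma bessel_moment_scaled (j : nat) (r e : R) : 0 < e <= 1 ->
  bessel_moment j (r, 2 / e ^ 3) (2 / e ^ 3) =
  Cmult (Cmult (RtoC e) (Cexp (Cmult (Cmult Ci (r, 2 / e ^ 3)) (RtoC (PI / 2)))))
    (cint (fun s => Cmult (Cpow (Cmult Ci (Csh (scaled e s))) j) (bessel_integrand r e s))).
Proof.
  intros He. set (t := 2 / e ^ 3). set (nu := (r, t)).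
  assert (Ht : 0 < t) by (apply Rdiv_lt_0_compat; [lra | apply pow_lt; lra]).
  assert (Hpi : 1 < PI / 2) by (generalize PI2_3_2; lra).
  assert (Hth : 0 <= PI / 2 - e < PI / 2) by lra.
  unfold bessel_moment. rewrite (bessel_shift j nu t (PI / 2 - e) Ht Hth).
  assert (Hcos : cos (PI / 2 - e) = sin e) by apply cos_shift.
  assert (Hsin : sin (PI / 2 - e) = cos e) by apply sin_shift.
  assert (Hsp : 0 < sin e) by (apply sin_gt_0; lra).
  assert (Hd : 0 < t * cos (PI / 2 - e)) by (rewrite Hcos; apply Rmult_lt_0_compat; auto).
  assert (Hdil : Cdominated (fun s => bessel_kernel j nu t (PI / 2 - e) (e * s))).
  { eapply Cdominated_intro.
    - assert (Ccont (bessel_kernel j nu t (PI / 2 - e))) as [C1 C2].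
      { eapply Ccont_dC. intros x. apply dC_bessel_kernel_x. }
      assert (Hl : forall x, continuous (fun s => e * s) x).
      { intros x. eapply cont_of_derive. auto_derive; trivial. }
      split; intros x.
      + apply (continuous_comp (fun s => e * s) (fun y => Re (bessel_kernel j nu t (PI / 2 - e) y)));
          [apply Hl | apply C1].
      + apply (continuous_comp (fun s => e * s) (fun y => Im (bessel_kernel j nu t (PI / 2 - e) y)));
          [apply Hl | apply C2].
    - intros s. eapply Rle_trans.
      { apply (bessel_kernel_bound j nu t _ (PI / 2 - e) (e * s) Hd (Rle_refl _)). }
      set (d := t * cos (PI / 2 - e)) in *.
      replace ((INR j + Rabs (Re nu)) * Rabs (e * s) - d / 2 * (e * s) ^ 2)
        with ((INR j + Rabs (Re nu)) * e * Rabs s - d / 2 * e ^ 2 * s ^ 2).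
      + eapply Rle_trans.
        { apply Rmult_le_compat_l; [apply Rlt_le, exp_pos|].
          apply gauss_dominated. apply Rmult_lt_0_compat; [lra | apply pow_lt; lra]. }
        rewrite <- Rmult_assoc. apply Rle_refl.
      + rewrite Rabs_mult, (Rabs_pos_eq e) by lra. ring. }
  rewrite (cint_dilate _ e); [| lra | apply bessel_kernel_dominated; exact Hd | exact Hdil].
  rewrite <- Cmult_assoc. f_equal.
  assert (Hbi : Cdominated (fun s => Cmult (Cexp (Cmult (Cmult Ci nu) (RtoC (PI / 2))))
     (Cmult (Cpow (Cmult Ci (Csh (scaled e s))) j) (bessel_integrand r e s)))
     /\ forall s, bessel_kernel j nu t (PI / 2 - e) (e * s) =
    Cmult (Cexp (Cmult (Cmult Ci nu) (RtoC (PI / 2))))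
     (Cmult (Cpow (Cmult Ci (Csh (scaled e s))) j) (bessel_integrand r e s))).
  { assert (Heq : forall s, bessel_kernel j nu t (PI / 2 - e) (e * s) =
    Cmult (Cexp (Cmult (Cmult Ci nu) (RtoC (PI / 2))))
     (Cmult (Cpow (Cmult Ci (Csh (scaled e s))) j) (bessel_integrand r e s))).
    { intros s. unfold bessel_kernel, bessel_integrand.
      assert (Esc : scaled e s = (e * s, - e)).
      { unfold scaled; apply Ceq; unfold Re, Im; simpl; ring. }
      assert (Ec : Ccosh (PI / 2 - e) (e * s) = Cmult Ci (Csh (scaled e s))).
      { rewrite Esc, Csh_parts, sin_neg, cos_neg. unfold Ccosh. rewrite Hcos, Hsin.
        apply Ceq; unfold Re, Im; simpl; ring. }
      rewrite <- Ec.
      replace (Cmult (Cexp (phase_lead r e s + phase_rem r e s)%C) (airy_weight s))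
        with (Cexp (Cplus (airy_phase 0 s) (phase_lead r e s + phase_rem r e s)%C))
        by (rewrite Cexp_plus; unfold airy_weight; ring).
      rewrite phase_total by lra.
      replace (bessel_phase nu t (PI / 2 - e) (e * s)) with
        (Cplus (Cmult (Cmult Ci nu) (RtoC (PI / 2)))
          (RtoC r * scaled e s - Ci * RtoC (2 / e ^ 3) * (Csh (scaled e s) - scaled e s))%C).
      - rewrite Cexp_plus. ring.
      - unfold bessel_phase. rewrite Ec. fold t.
        replace ((e * s, PI / 2 - e) : C) with (Cplus (scaled e s) (Cmult Ci (RtoC (PI / 2))))
          by (rewrite Esc; apply Ceq; unfold Re, Im; simpl; ring).
        replace nu with (Cplus (RtoC r) (Cmult Ci (RtoC t)))
          by (unfold nu; apply Ceq; unfold Re, Im; simpl; ring).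
        rewrite RtoC_opp'. ring. }
    split; auto. apply (Cdominated_ext _ _ Heq Hdil). }
  destruct Hbi as [Hb1 Hb2].
  rewrite (cint_ext _ _ Hb2). apply cint_scal.
  apply (Cdominated_ext (fun s => Cmult (Cexp (Copp (Cmult (Cmult Ci nu) (RtoC (PI / 2)))))
    (Cmult (Cexp (Cmult (Cmult Ci nu) (RtoC (PI / 2))))
     (Cmult (Cpow (Cmult Ci (Csh (scaled e s))) j) (bessel_integrand r e s))))).
  - intros s. rewrite Cmult_assoc, <- Cexp_plus.
    replace (Cplus (Copp (Cmult (Cmult Ci nu) (RtoC (PI / 2)))) (Cmult (Cmult Ci nu) (RtoC (PI / 2))))
      with (RtoC 0) by ring.
    rewrite Cexp_0. ring.
  - apply Cdominated_scal. exact Hb1.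
Qed.

(** * The envelope of the Airy function on the negative axis *)

Lemma RInt_even (f : R -> R) (N : R) :
  (forall x, continuous f x) -> (forall s, f (- s) = f s) ->
  RInt f (- N) N = 2 * RInt f 0 N.
Proof.
  intros Hc He.
  rewrite <- (RInt_Chasles (V := R_CompleteNormedModule) f (- N) 0 N)
    by (apply ex_RInt_cont, Hc).
  rewrite (RInt_reflect _ (- N) 0) by apply Hc. rewrite Ropp_0, Ropp_involutive.
  rewrite (RInt_ext (fun s => f (- s)) f) by (intros; apply He).
  unfold plus; simpl; ring.
Qed.

Lemma exp_m1_half : exp (- 1) <= / 2.
Proof.
  replace (- 1) with (- (1)) by lra. rewrite exp_Ropp.
  apply Rinv_le_contravar; [lra|]. generalize (exp_ineq1_le 1). lra.
Qed.

(** At x = 1 the linear terms of the phase cancel, and the integrand is a multiple of exp(-s^2)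
    cos(s^3 / 3). Its integral over [0, 1] is at least 17/27; the part beyond 1 is at least minus
    the integral of s exp(-s^2), hence at least -1/4. *)
Lemma Ai_1_neq_0 : Ai 1 <> 0.
Proof.
  set (f := fun s => exp (- s ^ 2) * cos (s ^ 3 / 3)).
  assert (Ef : forall s, exp (- 2 / 3) * f s = Re (airy_kernel 0 1 s)).
  { intros s. unfold f, airy_kernel, Cexp. rewrite airy_phase_Re, airy_phase_Im.
    unfold Re, RtoC, Cmult, Cpow; cbn [fst snd].
    replace (- (s ^ 3 / 3 - s + 1 * s)) with (- (s ^ 3 / 3)) by (simpl; field).
    rewrite cos_neg. rewrite <- Rmult_assoc, <- exp_plus.
    replace (/ 3 - s ^ 2 - 1) with (- 2 / 3 + - s ^ 2) by (simpl; field).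
    generalize (exp (- 2 / 3 + - s ^ 2)) (cos (s ^ 3 / 3)) (sin (- (s ^ 3 / 3))). intros. simpl. ring. }
  assert (Hd : dominated f).
  { apply (dominated_ext (fun s => exp (2 / 3) * Re (airy_kernel 0 1 s))).
    - intros s. rewrite <- Ef, <- Rmult_assoc, <- exp_plus.
      replace (2 / 3 + - 2 / 3) with 0 by field. rewrite exp_0. ring.
    - apply dominated_scal. exact (proj1 (airy_kernel_dominated 0 1)). }
  assert (Hc : forall x, continuous f x) by apply Hd.
  assert (Hprim : forall b, is_derive (fun b => RInt f 0 b) b (f b)).
  { intros b. apply (is_derive_RInt f (fun b => RInt f 0 b) 0 b).
    - apply filter_forall. intros x. apply (RInt_correct (V := R_CompleteNormedModule)), ex_RInt_cont; auto.
    - apply Hc. }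
  (* On [0, 1], exp(-s^2) >= 1 - s^2 and cos(s^3 / 3) >= 1 - 1/18. *)
  assert (H01 : 17 / 27 <= RInt f 0 1).
  { enough (17 / 18 * (1 - 1 ^ 3 / 3) - 17 / 18 * (0 - 0 ^ 3 / 3) <= RInt f 0 1 - RInt f 0 0).
    { rewrite (RInt_point (V := R_CompleteNormedModule) 0 f) in H. unfold zero in H; simpl in H. lra. }
    apply (derive_le_increment (fun x => 17 / 18 * (x - x ^ 3 / 3)) (fun x => 17 / 18 * (1 - x ^ 2))
       (fun b => RInt f 0 b) f); [lra | | auto |].
    - intros; auto_derive; trivial; field.
    - intros x Hx. unfold f. rewrite Rmult_comm.
      assert (0 <= x ^ 3 / 3 <= / 3).
      { assert (0 <= x ^ 3) by (apply pow_le; lra).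
        assert (x ^ 3 <= 1 ^ 3) by (apply pow_incr; lra). lra. }
      assert (C := cos_lower (x ^ 3 / 3) ltac:(lra)).
      assert (X := exp_ineq1_le (- x ^ 2)).
      apply Rmult_le_compat; nra. }
  assert (HN : forall N, 1 <= N -> 3 / 8 <= RInt f 0 N).
  { intros N HN.
    enough (exp (- N ^ 2) / 2 - exp (- 1 ^ 2) / 2 <= RInt f 0 N - RInt f 0 1).
    { generalize (exp_pos (- N ^ 2)). replace (- 1 ^ 2) with (- 1) in H by ring.
      generalize exp_m1_half. lra. }
    apply (derive_le_increment (fun x => exp (- x ^ 2) / 2) (fun x => - x * exp (- x ^ 2))
       (fun b => RInt f 0 b) f); [lra | | auto |].
    - intros; auto_derive; trivial; simpl; field.
    - intros x Hx. unfold f.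
      generalize (exp_pos (- x ^ 2)) (COS_bound (x ^ 3 / 3)). nra. }
  intros H0.
  assert (E0 : lineint f = 0).
  { assert (E := airy_moment_0 1). rewrite H0, Rmult_0_r in E. apply (f_equal Re) in E.
    unfold airy_moment, cint in E. simpl in E.
    rewrite (lineint_ext _ (fun s => exp (- 2 / 3) * f s)) in E by (intros; rewrite Ef; auto).
    rewrite lineint_scal in E by auto. generalize (exp_pos (- 2 / 3)). nra. }
  destruct (lineint_approx f (/ 8) Hd ltac:(lra)) as [N0 HN0].
  specialize (HN0 (Rmax N0 1) (Rmax_l _ _)). specialize (HN (Rmax N0 1) (Rmax_r _ _)).
  rewrite E0, RInt_even in HN0; auto.
  - revert HN0. unfold Rabs; destruct Rcase_abs; lra.
  - intros s. unfold f. replace ((- s) ^ 3 / 3) with (- (s ^ 3 / 3)) by field.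
    rewrite cos_neg. f_equal. f_equal. ring.
Qed.

(** If both values vanished, Gronwall's inequality on [0, 1] would force Ai(1) = 0, against
    [Ai_1_neq_0]. *)
Lemma Ai_0_pos : 0 < Ai 0 ^ 2 + Ai' 0 ^ 2.
Proof.
  destruct (Req_dec (Ai 0 ^ 2 + Ai' 0 ^ 2) 0) as [E|E].
  2:{ generalize (pow2_ge_0 (Ai 0)) (pow2_ge_0 (Ai' 0)); lra. }
  exfalso.
  set (N := fun x => (Ai x ^ 2 + Ai' x ^ 2) * exp (- 2 * x)).
  assert (H : N 1 - N 0 <= 0 - 0).
  { apply (derive_le_increment N
      (fun x => (2 * Ai x * Ai' x + 2 * Ai' x * (x * Ai x) - 2 * (Ai x ^ 2 + Ai' x ^ 2)) * exp (- 2 * x))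
      (fun _ => 0) (fun _ => 0)); [lra | | |].
    - intros x _. unfold N.
      assert (D1 := is_derive_Ai x). assert (D2 := is_derive_Ai' x).
      auto_derive.
      + repeat split; eexists; eauto.
      + replace (Derive (fun x => Ai x) x) with (Ai' x) by (symmetry; apply is_derive_unique; auto).
        replace (Derive (fun x => Ai' x) x) with (x * Ai x) by (symmetry; apply is_derive_unique; auto).
        ring.
    - intros; apply @is_derive_const.
    - intros x Hx. generalize (exp_pos (- 2 * x)). intros.
      assert (2 * Ai x * Ai' x * (1 + x) <= 2 * (Ai x ^ 2 + Ai' x ^ 2)); [|nra].
      assert (0 <= (Ai x - Ai' x) ^ 2) by apply pow2_ge_0.
      assert (0 <= (Ai x + Ai' x) ^ 2) by apply pow2_ge_0. nra. }
  unfold N in H. rewrite E, Rmult_0_l, Rminus_0_r, Rminus_0_r in H.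
  generalize (exp_pos (- 2 * 1)) (pow2_ge_0 (Ai' 1)). intros.
  apply Ai_1_neq_0. assert (Ai 1 ^ 2 <= 0) by nra. generalize (pow2_ge_0 (Ai 1)). nra.
Qed.

Definition AiN (X : R) : R := Ai (- X).
(** This is Ai' taken at -X, hence minus the derivative of [AiN]. *)
Definition AiN' (X : R) : R := Ai' (- X).

Lemma is_derive_AiN (X : R) : is_derive AiN X (- AiN' X).
Proof.
  unfold AiN, AiN'. assert (D1 := is_derive_Ai (- X)).
  auto_derive; [eexists; eauto|].
  replace (Derive (fun x => Ai x) (- X)) with (Ai' (- X)) by (symmetry; apply is_derive_unique; auto).
  ring.
Qed.

Lemma is_derive_AiN' (X : R) : is_derive AiN' X (X * AiN X).
Proof.
  unfold AiN, AiN'. assert (D1 := is_derive_Ai' (- X)).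
  auto_derive; [eexists; eauto|].
  replace (Derive (fun x => Ai' x) (- X)) with (- X * Ai (- X)) by (symmetry; apply is_derive_unique; auto).
  ring.
Qed.

Ltac AiN_derive X :=
  assert (D1 := is_derive_AiN X); assert (D2 := is_derive_AiN' X);
  auto_derive;
  [ repeat split; try (eexists; eauto); try lra
  | replace (Derive (fun x => AiN x) X) with (- AiN' X)
      by (symmetry; apply is_derive_unique; auto);
    replace (Derive (fun x => AiN' x) X) with (X * AiN X)
      by (symmetry; apply is_derive_unique; auto) ].

(** The logarithmic derivative of AiN^2 + AiN'^2 is at most 1 - X in absolute value, so over [0, 1]
    the sum changes by a factor of at most exp 1 <= 3. *)
Lemma AiN_unit (X : R) : 0 <= X <= 1 ->
  (Ai 0 ^ 2 + Ai' 0 ^ 2) * / 3 <= AiN X ^ 2 + AiN' X ^ 2 <= (Ai 0 ^ 2 + Ai' 0 ^ 2) * 3.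
Proof.
  intros HX. set (N := fun x => AiN x ^ 2 + AiN' x ^ 2).
  assert (DN : forall x, is_derive N x (- 2 * (1 - x) * AiN x * AiN' x)).
  { intros x. unfold N. AiN_derive x. ring. }
  assert (HN : forall x, 0 <= x <= 1 -> Rabs (- 2 * (1 - x) * AiN x * AiN' x) <= N x).
  { intros x Hx. apply Rabs_le. unfold N.
    assert (0 <= (AiN x - AiN' x) ^ 2) by apply pow2_ge_0.
    assert (0 <= (AiN x + AiN' x) ^ 2) by apply pow2_ge_0. nra. }
  assert (E0 : N 0 = Ai 0 ^ 2 + Ai' 0 ^ 2) by (unfold N, AiN, AiN'; rewrite Ropp_0; auto).
  assert (Hp := Ai_0_pos). rewrite <- E0 in *. fold (N X).
  assert (He : exp X <= 3).
  { eapply Rle_trans; [|apply exp_le_3]. apply exp_le; lra. }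
  assert (He1 : 1 <= exp X) by (generalize (exp_ineq1_le X); lra).
  split.
  - assert (H : 0 - 0 <= N X * exp X - N 0 * exp 0).
    { apply (derive_le_increment (fun _ => 0) (fun _ => 0) (fun x => N x * exp x)
        (fun x => (- 2 * (1 - x) * AiN x * AiN' x) * exp x + N x * exp x)); [lra | | |].
      - intros; apply @is_derive_const.
      - intros x _. apply is_derive_multR; [apply DN | apply is_derive_exp].
      - intros x Hx. specialize (HN x ltac:(lra)). apply Rabs_le_between in HN.
        generalize (exp_pos x). nra. }
    rewrite exp_0 in H. assert (0 <= N X) by (unfold N; generalize (pow2_ge_0 (AiN X)) (pow2_ge_0 (AiN' X)); lra).
    nra.
  - assert (H : N X * exp (- X) - N 0 * exp (- 0) <= 0 - 0).
    { apply (derive_le_increment (fun x => N x * exp (- x))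
        (fun x => (- 2 * (1 - x) * AiN x * AiN' x) * exp (- x) + N x * (- exp (- x))) (fun _ => 0) (fun _ => 0)); [lra | | |].
      - intros x _. apply (is_derive_multR N (fun x => exp (- x))); [apply DN |].
        auto_derive; trivial; ring.
      - intros; apply @is_derive_const.
      - intros x Hx. specialize (HN x ltac:(lra)). apply Rabs_le_between in HN.
        generalize (exp_pos (- x)). nra. }
    rewrite Ropp_0, exp_0, exp_Ropp in H.
    assert (N X * / exp X * exp X = N X) by (field; lra). nra.
Qed.

(** The derivative of [AiE] is (X AiN^2 - AiN'^2) / (2 X^(3/2)), of relative size 1 / X, which is
    not integrable. Since X AiN^2 - AiN'^2 is the derivative of AiN AiN', the last term cancels it
    and leaves the integrable rate X^(-5/2). *)
Definition AiF (X : R) : R :=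
  sqrt X * AiN X ^ 2 + AiN' X ^ 2 / sqrt X - / 2 * (AiN X * AiN' X) / (X * sqrt X).
Definition AiE (X : R) : R := sqrt X * AiN X ^ 2 + AiN' X ^ 2 / sqrt X.

Lemma AiF_derive (X : R) : 0 < X ->
  is_derive AiF X (3 / 4 * (AiN X * AiN' X) / (X ^ 2 * sqrt X)).
Proof.
  intros HX. assert (Hs : 0 < sqrt X) by (apply sqrt_lt_R0; auto).
  assert (Hss : sqrt X * sqrt X = X) by (apply sqrt_sqrt; lra).
  assert (0 < X * sqrt X) by (apply Rmult_lt_0_compat; auto).
  unfold AiF. AiN_derive X.
  generalize dependent (sqrt X). intros s Hs Hss _.
  rewrite <- Hss. simpl. field. lra.
Qed.

Lemma AiE_cross (X : R) : 0 < X -> 2 * Rabs (AiN X * AiN' X) <= AiE X.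
Proof.
  intros HX. assert (Hs : 0 < sqrt X) by (apply sqrt_lt_R0; auto).
  unfold AiE. generalize dependent (sqrt X). intros s Hs.
  generalize (AiN X) (AiN' X). intros p q.
  assert (A : 0 <= (s * p - q) ^ 2 / s) by (apply Rmult_le_pos; [apply pow2_ge_0 | apply Rlt_le, Rinv_0_lt_compat; auto]).
  assert (B : 0 <= (s * p + q) ^ 2 / s) by (apply Rmult_le_pos; [apply pow2_ge_0 | apply Rlt_le, Rinv_0_lt_compat; auto]).
  replace ((s * p - q) ^ 2 / s) with (s * p ^ 2 + q ^ 2 / s - 2 * (p * q)) in A by (field; lra).
  replace ((s * p + q) ^ 2 / s) with (s * p ^ 2 + q ^ 2 / s + 2 * (p * q)) in B by (field; lra).
  unfold Rabs; destruct Rcase_abs; lra.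
Qed.

Lemma sqrt_ge_1 (X : R) : 1 <= X -> 1 <= sqrt X.
Proof. intros. rewrite <- sqrt_1. apply sqrt_le_1_alt; auto. Qed.

Lemma AiF_AiE (X : R) : 1 <= X -> 3 / 4 * AiE X <= AiF X <= 5 / 4 * AiE X.
Proof.
  intros HX. assert (Hs := sqrt_ge_1 X HX).
  assert (HE := AiE_cross X ltac:(lra)).
  unfold AiF. fold (AiE X).
  assert (Hx : 0 < / (X * sqrt X) <= 1).
  { split; [apply Rinv_0_lt_compat; nra|]. rewrite <- Rinv_1. apply Rinv_le_contravar; nra. }
  unfold Rdiv. generalize dependent (/ (X * sqrt X)). intros i Hi.
  assert (Rabs (/ 2 * (AiN X * AiN' X) * i) <= / 4 * AiE X).
  { rewrite !Rabs_mult, (Rabs_pos_eq i), (Rabs_pos_eq (/ 2)) by lra.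
    rewrite <- Rabs_mult. generalize (Rabs_pos (AiN X * AiN' X)). nra. }
  apply Rabs_le_between in H. lra.
Qed.

Lemma AiF_bounds (X : R) : 1 <= X -> AiF 1 / 3 <= AiF X <= AiF 1 * 3.
Proof.
  intros HX.
  (* An antiderivative of X^(-5/2) / 2. It varies by 1/3 on [1, oo), so the envelope changes by a
     factor of at most exp(1/3). *)
  set (G := fun X => - / 3 * / (X * sqrt X)).
  assert (HG : forall x, 0 < x -> is_derive G x (/ 2 * / (x ^ 2 * sqrt x))).
  { intros x Hx. assert (Hs : 0 < sqrt x) by (apply sqrt_lt_R0; auto).
    assert (Hss : sqrt x * sqrt x = x) by (apply sqrt_sqrt; lra).
    assert (0 < x * sqrt x) by (apply Rmult_lt_0_compat; auto).
    unfold G. auto_derive; [repeat split; try lra|].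
    generalize dependent (sqrt x). intros s Hs Hss _. rewrite <- Hss. field. lra. }
  assert (HFp : forall x, 1 <= x -> Rabs (3 / 4 * (AiN x * AiN' x) / (x ^ 2 * sqrt x))
      <= / 2 * / (x ^ 2 * sqrt x) * AiF x).
  { intros x Hx. assert (Hs := sqrt_ge_1 x Hx).
    assert (A := AiF_AiE x Hx). assert (B := AiE_cross x ltac:(lra)).
    assert (0 < / (x ^ 2 * sqrt x)) by (apply Rinv_0_lt_compat; nra).
    unfold Rdiv. rewrite Rabs_mult, (Rabs_pos_eq (/ (x ^ 2 * sqrt x))) by lra.
    rewrite Rabs_mult, (Rabs_pos_eq (3 * / 4)) by lra. nra. }
  assert (HGb : forall x, 1 <= x -> - / 3 <= G x <= 0).
  { intros x Hx. assert (Hs := sqrt_ge_1 x Hx). unfold G.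
    assert (Hi : 0 < / (x * sqrt x) <= 1).
    { split; [apply Rinv_0_lt_compat; nra|]. rewrite <- Rinv_1. apply Rinv_le_contravar; nra. }
    lra. }
  assert (Hex : exp (/ 3) <= 3).
  { eapply Rle_trans; [|apply exp_le_3]. apply exp_le; lra. }
  assert (G1 := HGb 1 ltac:(lra)). assert (G2 := HGb X HX).
  assert (F1 : 0 <= AiF 1).
  { generalize (AiF_AiE 1 ltac:(lra)) (AiE_cross 1 ltac:(lra)) (Rabs_pos (AiN 1 * AiN' 1)). lra. }
  assert (FX : 0 <= AiF X).
  { generalize (AiF_AiE X ltac:(lra)) (AiE_cross X ltac:(lra)) (Rabs_pos (AiN X * AiN' X)). lra. }
  assert (Hd : 1 <= exp (G X - G 1) <= 3 \/ exp (G X - G 1) <= 3).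
  { right. eapply Rle_trans; [|apply Hex]. apply exp_le; lra. }
  assert (Hd3 : exp (G X - G 1) <= 3) by (destruct Hd; lra). clear Hd.
  split.
  - assert (H : 0 - 0 <= AiF X * exp (G X) - AiF 1 * exp (G 1)).
    { apply (derive_le_increment (fun _ => 0) (fun _ => 0) (fun x => AiF x * exp (G x))
        (fun x => (3 / 4 * (AiN x * AiN' x) / (x ^ 2 * sqrt x)) * exp (G x)
           + AiF x * ((/ 2 * / (x ^ 2 * sqrt x)) * exp (G x)))); [lra | | |].
      - intros; apply @is_derive_const.
      - intros x Hx. apply (is_derive_multR AiF (fun x => exp (G x))); [apply AiF_derive; lra |].
        apply (is_derive_comp exp G); [apply is_derive_exp | apply HG; lra].
      - intros x Hx. specialize (HFp x ltac:(lra)). apply Rabs_le_between in HFp.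
        generalize (exp_pos (G x)). nra. }
    replace (exp (G X)) with (exp (G X - G 1) * exp (G 1)) in H by (rewrite <- exp_plus; f_equal; ring).
    generalize (exp_pos (G 1)) (exp_pos (G X - G 1)). intros.
    assert (AiF 1 <= AiF X * exp (G X - G 1)) by nra. nra.
  - assert (H : AiF X * exp (- G X) - AiF 1 * exp (- G 1) <= 0 - 0).
    { apply (derive_le_increment (fun x => AiF x * exp (- G x))
        (fun x => (3 / 4 * (AiN x * AiN' x) / (x ^ 2 * sqrt x)) * exp (- G x)
           + AiF x * (- (/ 2 * / (x ^ 2 * sqrt x)) * exp (- G x))) (fun _ => 0) (fun _ => 0)); [lra | | |].
      - intros x Hx. apply (is_derive_multR AiF (fun x => exp (- G x))); [apply AiF_derive; lra |].
        apply (is_derive_comp exp (fun x => - G x)); [apply is_derive_exp |].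
        apply (is_derive_opp G). apply HG; lra.
      - intros; apply @is_derive_const.
      - intros x Hx. specialize (HFp x ltac:(lra)). apply Rabs_le_between in HFp.
        generalize (exp_pos (- G x)). nra. }
    replace (exp (- G 1)) with (exp (G X - G 1) * exp (- G X)) in H by (rewrite <- exp_plus; f_equal; ring).
    generalize (exp_pos (- G X)) (exp_pos (G X - G 1)). intros.
    assert (AiF X <= AiF 1 * exp (G X - G 1)) by nra. nra.
Qed.

Lemma sqrt_shift (X : R) : 1 <= X -> sqrt X <= sqrt (1 + X) <= 2 * sqrt X.
Proof.
  intros HX. split; [apply sqrt_le_1_alt; lra|].
  replace 2 with (sqrt (2 ^ 2)) by (apply sqrt_pow2; lra).
  rewrite <- sqrt_mult by lra. apply sqrt_le_1_alt. lra.
Qed.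

(** The upper bounds control the source of the comparison equation; the lower bound converts an
    error bound into Ai and Ai' terms. Writing 1 + X for X merges the estimates on [0, 1] and [1,
    oo). *)
Lemma Airy_envelope : exists c K, 0 < c /\ 0 < K /\ forall X, 0 <= X ->
  AiN X ^ 2 * sqrt (1 + X) <= K /\ AiN' X ^ 2 <= K * sqrt (1 + X) /\
  c * sqrt (1 + X) <= (1 + X) * AiN X ^ 2 + AiN' X ^ 2.
Proof.
  set (n := Ai 0 ^ 2 + Ai' 0 ^ 2).
  assert (Hn : 0 < n) by apply Ai_0_pos.
  assert (E1 : AiE 1 = AiN 1 ^ 2 + AiN' 1 ^ 2) by (unfold AiE; rewrite sqrt_1; field).
  assert (U1 := AiN_unit 1 ltac:(lra)). fold n in U1. rewrite <- E1 in U1.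
  assert (F1 := AiF_AiE 1 ltac:(lra)).
  (* The losses are 3 in [AiN_unit], 3 in [AiF_bounds], 5/3 between [AiE] and [AiF], and 2 in
     [sqrt_shift], together 30. *)
  exists (n / 30), (40 * n). split; [lra|]. split; [lra|]. intros X HX.
  assert (H1X : sqrt (1 + X) * sqrt (1 + X) = 1 + X) by (apply sqrt_sqrt; lra).
  assert (H1 : 1 <= sqrt (1 + X)) by (apply sqrt_ge_1; lra).
  destruct (Rle_dec X 1) as [Hle|Hgt].
  - assert (U := AiN_unit X ltac:(lra)). fold n in U.
    assert (sqrt (1 + X) <= 2) by nra.
    generalize (pow2_ge_0 (AiN X)) (pow2_ge_0 (AiN' X)). intros.
    repeat split; nra.
  - assert (HX1 : 1 <= X) by lra.
    assert (FB := AiF_bounds X HX1). assert (FE := AiF_AiE X HX1).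
    assert (Hs := sqrt_shift X HX1).
    assert (Hss : sqrt X * sqrt X = X) by (apply sqrt_sqrt; lra).
    assert (Hs1 := sqrt_ge_1 X HX1).
    unfold AiE in FE.
    generalize (pow2_ge_0 (AiN X)) (pow2_ge_0 (AiN' X)). intros P Q.
    assert (Q' : 0 <= AiN' X ^ 2 / sqrt X) by (apply Rmult_le_pos; [auto | apply Rlt_le, Rinv_0_lt_compat; lra]).
    assert (EQ : AiN' X ^ 2 = AiN' X ^ 2 / sqrt X * sqrt X) by (field; lra).
    assert (P' : 0 <= sqrt X * AiN X ^ 2) by (apply Rmult_le_pos; lra).
    set (p := AiN X ^ 2) in *. set (q := AiN' X ^ 2 / sqrt X) in *. rewrite EQ.
    assert (S1 : 0 < n / 30) by lra.
    assert (BU : sqrt X * p + q <= 20 * n) by lra.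
    assert (BL : n / 15 <= sqrt X * p + q) by lra.
    repeat split.
    + nra.
    + assert (q * sqrt X <= 20 * n * sqrt X) by (apply Rmult_le_compat_r; lra). nra.
    + assert ((1 + X) * p + q * sqrt X >= sqrt X * (sqrt X * p + q)) by nra.
      assert (sqrt X * (n / 15) <= sqrt X * (sqrt X * p + q)) by (apply Rmult_le_compat_l; lra).
      nra.
Qed.

(** * An energy estimate for the comparison equation *)

Ltac rewrite_Derive H :=
  match type of H with is_derive ?f ?x ?l =>
    replace (Derive (fun u => f u) x) with l by (symmetry; apply is_derive_unique; exact H)
  end.

Lemma cross_le (l a1 a2 b1 b2 : R) : 0 < l ->
  Rabs (2 * (a1 * b1 + a2 * b2)) <= l * (a1 ^ 2 + a2 ^ 2) + (b1 ^ 2 + b2 ^ 2) / l.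
Proof.
  intros Hl.
  assert (H : forall u v, 0 <= l * u ^ 2 + v ^ 2 / l - 2 * (u * v)).
  { intros u v. replace (l * u ^ 2 + v ^ 2 / l - 2 * (u * v)) with ((l * u - v) ^ 2 / l) by (field; lra).
    apply Rmult_le_pos; [apply pow2_ge_0 | apply Rlt_le, Rinv_0_lt_compat; auto]. }
  assert (E : (b1 ^ 2 + b2 ^ 2) / l = b1 ^ 2 / l + b2 ^ 2 / l) by (field; lra).
  rewrite E.
  apply Rabs_le. split.
  - generalize (H (- a1) b1) (H (- a2) b2). nra.
  - generalize (H a1 b1) (H a2 b2). nra.
Qed.

(** This is the zone q <= e^2 around the turning point. The energy |E|^2 / e^4 + |P|^2 grows at a
    rate O(1 / e^2) over an interval of length e^2, so Gronwall's inequality costs a constant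
    factor. Here E = e1 + i e2 is the error and P = p1 + i p2 its derivative in ln cosh mu, while
    [phi] converts to derivatives in q. *)
Lemma energy_start (M B q0 r e : R) (e1 e2 p1 p2 s1 s2 T phi : R -> R) :
  Rabs r <= M -> 0 < e <= 1 -> 0 <= B -> q0 <= e ^ 2 ->
  (forall q, 0 <= q <= q0 ->
     is_derive e1 q (phi q * p1 q) /\ is_derive e2 q (phi q * p2 q) /\
     is_derive p1 q (phi q * ((- 4 * T q / e ^ 6 + r ^ 2) * e1 q - 4 * r / e ^ 3 * e2 q + s1 q)) /\
     is_derive p2 q (phi q * ((- 4 * T q / e ^ 6 + r ^ 2) * e2 q + 4 * r / e ^ 3 * e1 q + s2 q)) /\
     0 < phi q <= 1 /\ 0 <= T q <= 2 * q /\ s1 q ^ 2 + s2 q ^ 2 <= B) ->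
  e1 0 ^ 2 + e2 0 ^ 2 <= B * e ^ 8 -> p1 0 ^ 2 + p2 0 ^ 2 <= B * e ^ 4 ->
  forall q, 0 <= q <= q0 ->
  (e1 q ^ 2 + e2 q ^ 2) / e ^ 4 + (p1 q ^ 2 + p2 q ^ 2) <= 3 * B * exp (10 + M ^ 2 + 4 * M) * e ^ 4.
Proof.
  intros Hr He HB Hq0 H I1 I2 q Hq.
  assert (HM : 0 <= M) by (generalize (Rabs_pos r); lra).
  (* One unit from the term |E|^2 / e^4, 8 + M^2 from the real part of the potential with T <= 2
     e^2, 4 M from its imaginary part, and one unit from the source. *)
  set (K := 10 + M ^ 2 + 4 * M).
  assert (HK : 1 <= K) by (unfold K; nra).
  assert (He2 : 0 < e ^ 2) by (apply pow_lt; lra).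
  assert (He4 : 0 < e ^ 4) by (apply pow_lt; lra).
  set (N := fun q => (e1 q ^ 2 + e2 q ^ 2) / e ^ 4 + (p1 q ^ 2 + p2 q ^ 2)).
  set (N' := fun q => phi q * (2 * (e1 q * p1 q + e2 q * p2 q) / e ^ 4
     + (- 4 * T q / e ^ 6 + r ^ 2) * (2 * (e1 q * p1 q + e2 q * p2 q))
     + 4 * r / e ^ 3 * (2 * (- e2 q * p1 q + e1 q * p2 q))
     + 2 * (s1 q * p1 q + s2 q * p2 q))).
  assert (DN : forall x, 0 <= x <= q0 -> is_derive N x (N' x)).
  { intros x Hx. destruct (H x Hx) as [D1 [D2 [D3 [D4 _]]]]. unfold N, N'.
    auto_derive; [repeat split; eexists; eauto|].
    rewrite_Derive D1; rewrite_Derive D2; rewrite_Derive D3; rewrite_Derive D4.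
    field. lra. }
  assert (BN : forall x, 0 <= x <= q0 -> N' x <= K / e ^ 2 * N x + e ^ 2 * B).
  { intros x Hx. destruct (H x Hx) as [_ [_ [_ [_ [Hphi [HT Hs]]]]]].
    assert (C1 := cross_le (/ e ^ 2) (e1 x) (e2 x) (p1 x) (p2 x) ltac:(apply Rinv_0_lt_compat; auto)).
    assert (C2 := cross_le (/ e ^ 2) (- e2 x) (e1 x) (p1 x) (p2 x) ltac:(apply Rinv_0_lt_compat; auto)).
    assert (C3 := cross_le (e ^ 2) (s1 x) (s2 x) (p1 x) (p2 x) He2).
    assert (EN : / e ^ 2 * (e1 x ^ 2 + e2 x ^ 2) + (p1 x ^ 2 + p2 x ^ 2) / / e ^ 2 = e ^ 2 * N x)
      by (unfold N; field; lra).
    rewrite EN in C1.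
    replace ((- e2 x) ^ 2 + e1 x ^ 2) with (e1 x ^ 2 + e2 x ^ 2) in C2 by ring.
    rewrite EN in C2. clear EN.
    assert (N0 : 0 <= N x).
    { unfold N. apply Rplus_le_le_0_compat.
      - apply Rmult_le_pos; [generalize (pow2_ge_0 (e1 x)) (pow2_ge_0 (e2 x)); lra|].
        apply Rlt_le, Rinv_0_lt_compat; auto.
      - generalize (pow2_ge_0 (p1 x)) (pow2_ge_0 (p2 x)); lra. }
    assert (HP : (p1 x ^ 2 + p2 x ^ 2) / e ^ 2 <= N x / e ^ 2).
    { apply Rmult_le_compat_r; [apply Rlt_le, Rinv_0_lt_compat; auto|].
      unfold N. enough (0 <= (e1 x ^ 2 + e2 x ^ 2) / e ^ 4) by lra.
      apply Rmult_le_pos; [generalize (pow2_ge_0 (e1 x)) (pow2_ge_0 (e2 x)); lra|].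
      apply Rlt_le, Rinv_0_lt_compat; auto. }
    assert (A1 : 2 * (e1 x * p1 x + e2 x * p2 x) / e ^ 4 <= N x / e ^ 2).
    { replace (N x / e ^ 2) with ((e ^ 2 * N x) / e ^ 4) by (field; lra).
      apply Rmult_le_compat_r; [apply Rlt_le, Rinv_0_lt_compat; auto|].
      eapply Rle_trans; [apply Rle_abs | apply C1]. }
    assert (A2 : (- 4 * T x / e ^ 6 + r ^ 2) * (2 * (e1 x * p1 x + e2 x * p2 x))
        <= (8 + M ^ 2) * (N x / e ^ 2)).
    { eapply Rle_trans; [apply Rle_abs|]. rewrite Rabs_mult.
      replace ((8 + M ^ 2) * (N x / e ^ 2)) with ((8 + M ^ 2) / e ^ 4 * (e ^ 2 * N x)) by (field; lra).
      apply Rmult_le_compat; [apply Rabs_pos | apply Rabs_pos | | apply C1].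
      assert (T1 : 0 <= 4 * T x / e ^ 6 <= 8 / e ^ 4).
      { assert (0 < e ^ 6) by (apply pow_lt; lra). split.
        - apply Rmult_le_pos; [lra | apply Rlt_le, Rinv_0_lt_compat; auto].
        - replace (8 / e ^ 4) with (8 * e ^ 2 / e ^ 6) by (field; lra).
          apply Rmult_le_compat_r; [apply Rlt_le, Rinv_0_lt_compat; auto | lra]. }
      assert (T2 : 0 <= r ^ 2 <= M ^ 2).
      { split; [apply pow2_ge_0|]. rewrite <- (pow2_abs r). apply pow_incr. split; [apply Rabs_pos | auto]. }
      assert (T3 : M ^ 2 <= M ^ 2 / e ^ 4).
      { rewrite <- (Rmult_1_r (M ^ 2)) at 1. apply Rmult_le_compat_l; [apply pow2_ge_0|].
        rewrite <- Rinv_1. apply Rinv_le_contravar; auto.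
        rewrite <- (pow1 4). apply pow_incr; lra. }
      replace (- 4 * T x / e ^ 6) with (- (4 * T x / e ^ 6)) by (unfold Rdiv; ring).
      unfold Rdiv in *. apply Rabs_le. lra. }
    assert (A3 : 4 * r / e ^ 3 * (2 * (- e2 x * p1 x + e1 x * p2 x)) <= 4 * M * (N x / e ^ 2)).
    { eapply Rle_trans; [apply Rle_abs|]. rewrite Rabs_mult.
      replace (4 * M * (N x / e ^ 2)) with (4 * M / e ^ 4 * (e ^ 2 * N x)) by (field; lra).
      apply Rmult_le_compat; [apply Rabs_pos | apply Rabs_pos | | apply C2].
      unfold Rdiv. rewrite !Rabs_mult, (Rabs_pos_eq 4), (Rabs_pos_eq (/ e ^ 3)); try lra.
      2:{ apply Rlt_le, Rinv_0_lt_compat, pow_lt; lra. }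
      apply Rmult_le_compat.
      - generalize (Rabs_pos r); lra.
      - apply Rlt_le, Rinv_0_lt_compat, pow_lt; lra.
      - lra.
      - apply Rinv_le_contravar; auto. replace (e ^ 4) with (e * e ^ 3) by ring.
        assert (0 < e ^ 3) by (apply pow_lt; lra). nra. }
    assert (A4 : 2 * (s1 x * p1 x + s2 x * p2 x) <= N x / e ^ 2 + e ^ 2 * B).
    { eapply Rle_trans; [apply Rle_abs|]. eapply Rle_trans; [apply C3|].
      assert (e ^ 2 * (s1 x ^ 2 + s2 x ^ 2) <= e ^ 2 * B) by (apply Rmult_le_compat_l; lra). lra. }
    assert (N2 : 0 <= N x / e ^ 2) by (apply Rmult_le_pos; [auto | apply Rlt_le, Rinv_0_lt_compat; auto]).
    apply Rle_trans with (phi x * (K / e ^ 2 * N x + e ^ 2 * B)).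
    - unfold N'. apply Rmult_le_compat_l; [lra|].
      replace (K / e ^ 2 * N x) with (K * (N x / e ^ 2)) by (unfold Rdiv; ring).
      unfold K. lra.
    - assert (0 <= K / e ^ 2 * N x + e ^ 2 * B).
      { replace (K / e ^ 2 * N x) with (K * (N x / e ^ 2)) by (unfold Rdiv; ring).
        apply Rplus_le_le_0_compat; apply Rmult_le_pos; lra. }
      nra. }
  assert (DI : (N q + e ^ 4 * B) * exp (- (K / e ^ 2) * q) - (N 0 + e ^ 4 * B) * exp (- (K / e ^ 2) * 0)
      <= 0 - 0).
  { apply (derive_le_increment (fun q => (N q + e ^ 4 * B) * exp (- (K / e ^ 2) * q))
      (fun q => N' q * exp (- (K / e ^ 2) * q) + (N q + e ^ 4 * B) * (- (K / e ^ 2) * exp (- (K / e ^ 2) * q)))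
      (fun _ => 0) (fun _ => 0)); [lra | | |].
    - intros x Hx.
      apply (is_derive_multR (fun q => N q + e ^ 4 * B) (fun q => exp (- (K / e ^ 2) * q))).
      + replace (N' x) with (N' x + 0) by ring.
        apply (is_derive_plus N (fun _ => e ^ 4 * B)); [apply DN; lra | apply @is_derive_const].
      + generalize (- (K / e ^ 2)). intros c. auto_derive; trivial. ring.
    - intros; apply @is_derive_const.
    - intros x Hx. specialize (BN x ltac:(lra)).
      generalize (exp_pos (- (K / e ^ 2) * x)). intros Hp.
      assert (e ^ 2 * B <= K / e ^ 2 * (e ^ 4 * B)).
      { replace (K / e ^ 2 * (e ^ 4 * B)) with (K * (e ^ 2 * B)) by (field; lra).
        assert (0 <= e ^ 2 * B) by (apply Rmult_le_pos; lra). nra. }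
      replace (N' x * exp (- (K / e ^ 2) * x) + (N x + e ^ 4 * B) * (- (K / e ^ 2) * exp (- (K / e ^ 2) * x)))
        with ((N' x - K / e ^ 2 * N x - K / e ^ 2 * (e ^ 4 * B)) * exp (- (K / e ^ 2) * x)) by ring.
      nra. }
  fold (N q).
  rewrite Rmult_0_r, exp_0, Rmult_1_r in DI.
  assert (N00 : N 0 <= 2 * B * e ^ 4).
  { unfold N. assert ((e1 0 ^ 2 + e2 0 ^ 2) / e ^ 4 <= B * e ^ 4).
    { apply Rmult_le_reg_r with (e ^ 4); auto. unfold Rdiv. rewrite Rmult_assoc, Rinv_l by lra.
      replace (B * e ^ 4 * e ^ 4) with (B * e ^ 8) by ring. lra. }
    lra. }
  assert (Hex : 1 <= exp (- (K / e ^ 2) * q) * exp K).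
  { rewrite <- exp_plus, <- exp_0. apply exp_le.
    assert (K / e ^ 2 * q <= K).
    { replace K with (K / e ^ 2 * e ^ 2) at 2 by (field; lra).
      apply Rmult_le_compat_l; [|lra]. apply Rmult_le_pos; [lra | apply Rlt_le, Rinv_0_lt_compat; auto]. }
    lra. }
  assert (0 <= N q).
  { unfold N. apply Rplus_le_le_0_compat.
    - apply Rmult_le_pos; [generalize (pow2_ge_0 (e1 q)) (pow2_ge_0 (e2 q)); lra|].
      apply Rlt_le, Rinv_0_lt_compat; auto.
    - generalize (pow2_ge_0 (p1 q)) (pow2_ge_0 (p2 q)); lra. }
  assert (0 <= e ^ 4 * B) by (apply Rmult_le_pos; lra).
  apply Rle_trans with ((N q + e ^ 4 * B) * (exp (- (K / e ^ 2) * q) * exp K)); [nra|].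
  rewrite <- Rmult_assoc.
  replace (3 * B * exp K * e ^ 4) with (3 * B * e ^ 4 * exp K) by ring.
  apply Rmult_le_compat_r; [apply Rlt_le, exp_pos|]. lra.
Qed.

(** For q >= e^2 the energy (4 T / e^6) |E|^2 + |P|^2 is used, in which the large real potential
    cancels. It grows through T, at most like q because q T' <= T, and through the lower terms and
    the source, reaching size e q^(3/2); multiplication by e^6 / q gives the stated bound. *)
Lemma energy_estimate (M B : R) : 0 <= B -> exists K, 0 <= K /\
  forall (q0 r e : R) (e1 e2 p1 p2 s1 s2 T T' phi : R -> R),
  Rabs r <= M -> 0 < e <= 1 -> q0 <= 1 ->
  (forall q, 0 <= q <= q0 ->
     is_derive e1 q (phi q * p1 q) /\ is_derive e2 q (phi q * p2 q) /\
     is_derive p1 q (phi q * ((- 4 * T q / e ^ 6 + r ^ 2) * e1 q - 4 * r / e ^ 3 * e2 q + s1 q)) /\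
     is_derive p2 q (phi q * ((- 4 * T q / e ^ 6 + r ^ 2) * e2 q + 4 * r / e ^ 3 * e1 q + s2 q)) /\
     is_derive T q (T' q) /\ q * T' q <= T q /\
     0 < phi q <= 1 /\ q / 2 <= T q <= 2 * q /\ s1 q ^ 2 + s2 q ^ 2 <= B) ->
  (forall rho, 0 < rho -> e <= rho ^ 2 -> rho ^ 4 <= q0 ->
     (s1 (rho ^ 4) ^ 2 + s2 (rho ^ 4) ^ 2) * rho ^ 2 <= B * e) ->
  e1 0 ^ 2 + e2 0 ^ 2 <= B * e ^ 8 -> p1 0 ^ 2 + p2 0 ^ 2 <= B * e ^ 4 ->
  forall q, 0 <= q <= q0 -> e1 q ^ 2 + e2 q ^ 2 <= K * e ^ 8 * sqrt (1 + q / e ^ 2).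
Proof.
  intros HB.
  set (K1 := 3 * B * exp (10 + M ^ 2 + 4 * M)).
  set (k := M ^ 2 + 4 * M).
  assert (HK1 : 0 <= K1) by (apply Rmult_le_pos; [lra | apply Rlt_le, exp_pos]).
  exists (K1 + exp (2 * k) * (4 * K1 + 8 * B)).
  assert (HK2 : 0 <= exp (2 * k) * (4 * K1 + 8 * B)) by (apply Rmult_le_pos; [apply Rlt_le, exp_pos | lra]).
  split; [lra|].
  intros q0 r e e1 e2 p1 p2 s1 s2 T T' phi Hr He Hq0 H Hs I1 I2 q Hq.
  assert (HM : 0 <= M) by (generalize (Rabs_pos r); lra).
  assert (Hk : 0 <= k) by (unfold k; nra).
  assert (He2 : 0 < e ^ 2) by (apply pow_lt; lra).
  assert (He3 : 0 < e ^ 3) by (apply pow_lt; lra).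
  assert (He4 : 0 < e ^ 4) by (apply pow_lt; lra).
  assert (He6 : 0 < e ^ 6) by (apply pow_lt; lra).
  assert (He8 : 0 < e ^ 8) by (apply pow_lt; lra).
  assert (Hqe : 0 <= q / e ^ 2) by (apply Rmult_le_pos; [lra | apply Rlt_le, Rinv_0_lt_compat; auto]).
  assert (Hsq1 : 1 <= sqrt (1 + q / e ^ 2)).
  { rewrite <- sqrt_1 at 1. apply sqrt_le_1_alt. lra. }
  assert (Hstart : forall x, 0 <= x <= q0 -> x <= e ^ 2 ->
     (e1 x ^ 2 + e2 x ^ 2) / e ^ 4 + (p1 x ^ 2 + p2 x ^ 2) <= K1 * e ^ 4).
  { intros x Hx Hxe. apply (energy_start M B (Rmin q0 (e ^ 2)) r e e1 e2 p1 p2 s1 s2 T phi); auto.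
    - apply Rmin_r.
    - intros y Hy. assert (Hy0 : 0 <= y <= q0) by (split; [lra | eapply Rle_trans; [apply Hy | apply Rmin_l]]).
      destruct (H y Hy0) as [D1 [D2 [D3 [D4 [_ [_ [D5 [D6 D7]]]]]]]].
      do 4 (split; [assumption|]). split; [assumption|]. split; [lra | assumption].
    - split; [lra|]. apply Rmin_glb; lra. }
  destruct (Rle_dec q (e ^ 2)) as [Hle|Hgt].
  { specialize (Hstart q Hq Hle).
    assert (E : (e1 q ^ 2 + e2 q ^ 2) / e ^ 4 <= K1 * e ^ 4)
      by (generalize (pow2_ge_0 (p1 q)) (pow2_ge_0 (p2 q)); lra).
    assert (E' : e1 q ^ 2 + e2 q ^ 2 <= K1 * e ^ 8).
    { replace (e1 q ^ 2 + e2 q ^ 2) with ((e1 q ^ 2 + e2 q ^ 2) / e ^ 4 * e ^ 4) by (field; lra).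
      replace (K1 * e ^ 8) with (K1 * e ^ 4 * e ^ 4) by ring.
      apply Rmult_le_compat_r; lra. }
    eapply Rle_trans; [apply E'|].
    rewrite <- (Rmult_1_r (K1 * e ^ 8)). apply Rmult_le_compat; [apply Rmult_le_pos; lra | lra | | auto].
    apply Rmult_le_compat_r; lra. }
  apply Rnot_le_lt in Hgt.
  (* In the variable rho = q^(1/4) the outer range begins at [rho0], where q = e^2. *)
  set (rho0 := sqrt e). set (rho1 := sqrt (sqrt q)).
  assert (R0 : 0 < rho0) by (apply sqrt_lt_R0; lra).
  assert (R02 : rho0 ^ 2 = e) by (unfold rho0; apply pow2_sqrt; lra).
  assert (R12 : rho1 ^ 2 = sqrt q) by (unfold rho1; apply pow2_sqrt, sqrt_pos).
  assert (R14 : rho1 ^ 4 = q).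
  { replace (rho1 ^ 4) with ((rho1 ^ 2) ^ 2) by ring. rewrite R12. apply pow2_sqrt. lra. }
  assert (R04 : rho0 ^ 4 = e ^ 2) by (rewrite <- R02; ring).
  assert (Re : e <= sqrt q).
  { rewrite <- (sqrt_pow2 e) by lra. apply sqrt_le_1_alt. lra. }
  assert (R01 : rho0 <= rho1) by (apply sqrt_le_1_alt; auto).
  set (N := fun q => 4 * T q / e ^ 6 * (e1 q ^ 2 + e2 q ^ 2) + (p1 q ^ 2 + p2 q ^ 2)).
  set (N' := fun q => 4 * T' q / e ^ 6 * (e1 q ^ 2 + e2 q ^ 2) + phi q *
     (r ^ 2 * (2 * (e1 q * p1 q + e2 q * p2 q))
     + 4 * r / e ^ 3 * (2 * (- e2 q * p1 q + e1 q * p2 q))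
     + 2 * (s1 q * p1 q + s2 q * p2 q))).
  assert (DN : forall x, 0 <= x <= q0 -> is_derive N x (N' x)).
  { intros x Hx. destruct (H x Hx) as [D1 [D2 [D3 [D4 [D5 _]]]]]. unfold N, N'.
    auto_derive; [repeat split; eexists; eauto|].
    rewrite_Derive D1; rewrite_Derive D2; rewrite_Derive D3; rewrite_Derive D4; rewrite_Derive D5.
    field. lra. }
  assert (HN0 : forall x, 0 <= x <= q0 -> 0 <= N x /\ 2 * x / e ^ 6 * (e1 x ^ 2 + e2 x ^ 2) <= N x
       /\ p1 x ^ 2 + p2 x ^ 2 <= N x).
  { intros x Hx. destruct (H x Hx) as [_ [_ [_ [_ [_ [_ [_ [HT _]]]]]]]].
    assert (0 <= e1 x ^ 2 + e2 x ^ 2) by (generalize (pow2_ge_0 (e1 x)) (pow2_ge_0 (e2 x)); lra).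
    assert (0 <= p1 x ^ 2 + p2 x ^ 2) by (generalize (pow2_ge_0 (p1 x)) (pow2_ge_0 (p2 x)); lra).
    assert (0 <= 2 * x / e ^ 6) by (apply Rmult_le_pos; [lra | apply Rlt_le, Rinv_0_lt_compat; auto]).
    assert (2 * x / e ^ 6 <= 4 * T x / e ^ 6).
    { apply Rmult_le_compat_r; [apply Rlt_le, Rinv_0_lt_compat; auto | lra]. }
    assert (2 * x / e ^ 6 * (e1 x ^ 2 + e2 x ^ 2) <= 4 * T x / e ^ 6 * (e1 x ^ 2 + e2 x ^ 2))
      by (apply Rmult_le_compat_r; auto).
    assert (0 <= 2 * x / e ^ 6 * (e1 x ^ 2 + e2 x ^ 2)) by (apply Rmult_le_pos; auto).
    unfold N. lra. }
  (* Of the rate 5 / (4 q), the part 1 / q is due to T' and 1 / (4 q) to the source, paired with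
     weight 4 q. A coefficient below 3/2 keeps the integrated source, of size e q^(3/2), free of a
     logarithm. *)
  assert (BN : forall rho, rho0 <= rho -> rho ^ 4 <= q0 ->
     N' (rho ^ 4) <= (5 / 4 / rho ^ 4 + k / rho ^ 2) * N (rho ^ 4) + 4 * B * e * rho ^ 2).
  { intros rho Hrho Hrq.
    assert (P1 : 0 < rho) by lra.
    assert (P2 : 0 < rho ^ 2) by (apply pow_lt; lra).
    assert (P4 : 0 < rho ^ 4) by (apply pow_lt; lra).
    assert (Pe : e <= rho ^ 2) by (rewrite <- R02; apply pow_incr; lra).
    specialize (Hs rho P1 Pe Hrq).
    set (x := rho ^ 4) in *.
    assert (Hx : 0 <= x <= q0) by lra.
    destruct (HN0 x Hx) as [N1 [N2 N3]].
    destruct (H x Hx) as [_ [_ [_ [_ [_ [HT' [Hphi [HT _]]]]]]]].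
    set (l := rho ^ 2 / e ^ 3).
    assert (Hl : 0 < l) by (apply Rdiv_lt_0_compat; auto).
    assert (C1 := cross_le l (e1 x) (e2 x) (p1 x) (p2 x) Hl).
    assert (C2 := cross_le l (- e2 x) (e1 x) (p1 x) (p2 x) Hl).
    replace ((- e2 x) ^ 2 + e1 x ^ 2) with (e1 x ^ 2 + e2 x ^ 2) in C2 by ring.
    assert (C3 := cross_le (4 * x) (s1 x) (s2 x) (p1 x) (p2 x) ltac:(lra)).
    assert (EN : l * (e1 x ^ 2 + e2 x ^ 2) + (p1 x ^ 2 + p2 x ^ 2) / l <= e ^ 3 / rho ^ 2 * N x).
    { replace (l * (e1 x ^ 2 + e2 x ^ 2) + (p1 x ^ 2 + p2 x ^ 2) / l)
        with (e ^ 3 / rho ^ 2 * (x / e ^ 6 * (e1 x ^ 2 + e2 x ^ 2) + (p1 x ^ 2 + p2 x ^ 2)))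
        by (unfold l, x; field; lra).
      apply Rmult_le_compat_l; [apply Rlt_le, Rdiv_lt_0_compat; auto|].
      unfold N. apply Rplus_le_compat_r, Rmult_le_compat_r.
      - generalize (pow2_ge_0 (e1 x)) (pow2_ge_0 (e2 x)); lra.
      - apply Rmult_le_compat_r; [apply Rlt_le, Rinv_0_lt_compat; auto | lra]. }
    assert (A1 : 4 * T' x / e ^ 6 * (e1 x ^ 2 + e2 x ^ 2) <= N x / x).
    { apply Rmult_le_reg_r with x; auto. unfold Rdiv at 2. rewrite (Rmult_assoc (N x)), Rinv_l, Rmult_1_r by lra.
      replace (4 * T' x / e ^ 6 * (e1 x ^ 2 + e2 x ^ 2) * x)
        with (4 / e ^ 6 * (e1 x ^ 2 + e2 x ^ 2) * (x * T' x)) by (field; lra).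
      apply Rle_trans with (4 / e ^ 6 * (e1 x ^ 2 + e2 x ^ 2) * T x).
      - apply Rmult_le_compat_l; auto. apply Rmult_le_pos.
        + apply Rlt_le, Rdiv_lt_0_compat; lra.
        + generalize (pow2_ge_0 (e1 x)) (pow2_ge_0 (e2 x)); lra.
      - unfold N. replace (4 / e ^ 6 * (e1 x ^ 2 + e2 x ^ 2) * T x)
          with (4 * T x / e ^ 6 * (e1 x ^ 2 + e2 x ^ 2)) by (field; lra).
        generalize (pow2_ge_0 (p1 x)) (pow2_ge_0 (p2 x)); lra. }
    assert (Hnr : 0 <= N x / rho ^ 2) by (apply Rmult_le_pos; [auto | apply Rlt_le, Rinv_0_lt_compat; auto]).
    assert (A2 : r ^ 2 * (2 * (e1 x * p1 x + e2 x * p2 x)) <= M ^ 2 * (N x / rho ^ 2)).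
    { eapply Rle_trans; [apply Rle_abs|]. rewrite Rabs_mult.
      apply Rmult_le_compat; [apply Rabs_pos | apply Rabs_pos | |].
      - rewrite <- RPow_abs. apply pow_incr. split; [apply Rabs_pos | auto].
      - eapply Rle_trans; [apply C1|]. eapply Rle_trans; [apply EN|].
        replace (e ^ 3 / rho ^ 2 * N x) with (e ^ 3 * (N x / rho ^ 2)) by (field; lra).
        rewrite <- (Rmult_1_l (N x / rho ^ 2)) at 2. apply Rmult_le_compat_r; auto.
        rewrite <- (pow1 3). apply pow_incr; lra. }
    assert (A3 : 4 * r / e ^ 3 * (2 * (- e2 x * p1 x + e1 x * p2 x)) <= 4 * M * (N x / rho ^ 2)).
    { eapply Rle_trans; [apply Rle_abs|]. rewrite Rabs_mult.
      replace (4 * M * (N x / rho ^ 2)) with (4 * M / e ^ 3 * (e ^ 3 / rho ^ 2 * N x)) by (field; lra).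
      apply Rmult_le_compat; [apply Rabs_pos | apply Rabs_pos | | lra].
      unfold Rdiv. rewrite !Rabs_mult, (Rabs_pos_eq 4), (Rabs_pos_eq (/ e ^ 3)); try lra.
      - apply Rmult_le_compat_r; [apply Rlt_le, Rinv_0_lt_compat; auto | lra].
      - apply Rlt_le, Rinv_0_lt_compat; auto. }
    assert (A4 : 2 * (s1 x * p1 x + s2 x * p2 x) <= / 4 * (N x / x) + 4 * B * e * rho ^ 2).
    { eapply Rle_trans; [apply Rle_abs|]. eapply Rle_trans; [apply C3|].
      rewrite Rplus_comm. apply Rplus_le_compat.
      - replace (/ 4 * (N x / x)) with (N x / (4 * x)) by (field; lra).
        apply Rmult_le_compat_r; [apply Rlt_le, Rinv_0_lt_compat; lra | auto].
      - replace (4 * x * (s1 x ^ 2 + s2 x ^ 2)) with (4 * rho ^ 2 * ((s1 x ^ 2 + s2 x ^ 2) * rho ^ 2))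
          by (unfold x; ring).
        replace (4 * B * e * rho ^ 2) with (4 * rho ^ 2 * (B * e)) by ring.
        apply Rmult_le_compat_l; lra. }
    assert (Hnx : 0 <= N x / x) by (apply Rmult_le_pos; [auto | apply Rlt_le, Rinv_0_lt_compat; auto]).
    assert (HBe : 0 <= 4 * B * e * rho ^ 2) by (repeat apply Rmult_le_pos; lra).
    replace ((5 / 4 / x + k / rho ^ 2) * N x) with (5 / 4 * (N x / x) + k * (N x / rho ^ 2)) by (field; lra).
    unfold N'. apply Rle_trans with (N x / x + phi x *
      (M ^ 2 * (N x / rho ^ 2) + 4 * M * (N x / rho ^ 2) + (/ 4 * (N x / x) + 4 * B * e * rho ^ 2))).
    - apply Rplus_le_compat; auto. apply Rmult_le_compat_l; lra.
    - assert (0 <= M ^ 2 * (N x / rho ^ 2)) by (apply Rmult_le_pos; [apply pow2_ge_0 | auto]).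
      assert (0 <= 4 * M * (N x / rho ^ 2)) by (apply Rmult_le_pos; lra).
      set (Y := M ^ 2 * (N x / rho ^ 2) + 4 * M * (N x / rho ^ 2) + (/ 4 * (N x / x) + 4 * B * e * rho ^ 2)).
      assert (HY : phi x * Y <= 1 * Y) by (apply Rmult_le_compat_r; unfold Y; lra).
      unfold Y in *. unfold k. lra. }
  (* Integrating factor of [BN]: N' / N is at most 5 / (4 q) + k / sqrt q, and q = rho^4 removes
     the root. *)
  set (W := fun rho => exp (- 2 * k * rho ^ 2) / rho ^ 5).
  assert (DI : N (rho1 ^ 4) * W rho1 - N (rho0 ^ 4) * W rho0 <= 16 * B * e * rho1 - 16 * B * e * rho0).
  { apply (derive_le_increment (fun rho => N (rho ^ 4) * W rho)
      (fun rho => (4 * rho ^ 3 * N' (rho ^ 4)) * W rho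
          + N (rho ^ 4) * (- (4 * k * rho + 5 / rho) * W rho))
      (fun rho => 16 * B * e * rho) (fun _ => 16 * B * e)); auto.
    - intros rho Hrho.
      assert (P4 : rho ^ 4 <= q0).
      { apply Rle_trans with q; [|lra]. rewrite <- R14. apply pow_incr; lra. }
      assert (P40 : 0 <= rho ^ 4) by (apply pow_le; lra).
      apply (is_derive_multR (fun rho => N (rho ^ 4)) W).
      + apply (is_derive_comp N (fun rho => rho ^ 4)); [apply DN; lra|].
        auto_derive; trivial. ring.
      + unfold W. assert (rho ^ 5 <> 0) by (apply pow_nonzero; lra).
        auto_derive; [exact H0|]. simpl. field. lra.
    - intros; auto_derive; trivial; ring.
    - intros rho Hrho.
      assert (P4 : rho ^ 4 <= q0).
      { apply Rle_trans with q; [|lra]. rewrite <- R14. apply pow_incr; lra. }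
      specialize (BN rho (proj1 Hrho) P4).
      assert (HW : 0 < W rho) by (apply Rdiv_lt_0_compat; [apply exp_pos | apply pow_lt; lra]).
      assert (P3 : 0 < rho ^ 3) by (apply pow_lt; lra).
      replace (4 * rho ^ 3 * N' (rho ^ 4) * W rho + N (rho ^ 4) * (- (4 * k * rho + 5 / rho) * W rho))
        with (4 * rho ^ 3 * (N' (rho ^ 4) - (5 / 4 / rho ^ 4 + k / rho ^ 2) * N (rho ^ 4)) * W rho)
        by (field; lra).
      apply Rle_trans with (4 * rho ^ 3 * (4 * B * e * rho ^ 2) * W rho).
      + apply Rmult_le_compat_r; [lra|]. apply Rmult_le_compat_l; lra.
      + unfold W. replace (4 * rho ^ 3 * (4 * B * e * rho ^ 2) * (exp (- 2 * k * rho ^ 2) / rho ^ 5))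
          with (16 * B * e * exp (- 2 * k * rho ^ 2)) by (field; lra).
        rewrite <- (Rmult_1_r (16 * B * e)) at 2. apply Rmult_le_compat_l.
        * repeat apply Rmult_le_pos; lra.
        * rewrite <- exp_0. apply exp_le. generalize (pow2_ge_0 rho). nra. }
  rewrite R14, R04 in DI.
  assert (Q0 : 0 <= e ^ 2 <= q0) by lra.
  assert (Ne : N (e ^ 2) <= 8 * (K1 * e ^ 4)).
  { specialize (Hstart (e ^ 2) Q0 ltac:(lra)).
    destruct (H (e ^ 2) Q0) as [_ [_ [_ [_ [_ [_ [_ [HT _]]]]]]]].
    assert (0 <= e1 (e ^ 2) ^ 2 + e2 (e ^ 2) ^ 2)
      by (generalize (pow2_ge_0 (e1 (e ^ 2))) (pow2_ge_0 (e2 (e ^ 2))); lra).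
    assert (0 <= p1 (e ^ 2) ^ 2 + p2 (e ^ 2) ^ 2)
      by (generalize (pow2_ge_0 (p1 (e ^ 2))) (pow2_ge_0 (p2 (e ^ 2))); lra).
    unfold N. apply Rle_trans with (8 * ((e1 (e ^ 2) ^ 2 + e2 (e ^ 2) ^ 2) / e ^ 4 + (p1 (e ^ 2) ^ 2 + p2 (e ^ 2) ^ 2))); [|lra].
    assert (4 * T (e ^ 2) / e ^ 6 * (e1 (e ^ 2) ^ 2 + e2 (e ^ 2) ^ 2)
       <= 8 * ((e1 (e ^ 2) ^ 2 + e2 (e ^ 2) ^ 2) / e ^ 4)).
    { replace (8 * ((e1 (e ^ 2) ^ 2 + e2 (e ^ 2) ^ 2) / e ^ 4))
        with (8 * e ^ 2 / e ^ 6 * (e1 (e ^ 2) ^ 2 + e2 (e ^ 2) ^ 2)) by (field; lra).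
      apply Rmult_le_compat_r; auto.
      apply Rmult_le_compat_r; [apply Rlt_le, Rinv_0_lt_compat; auto | lra]. }
    lra. }
  assert (W0 : W rho0 * e ^ 4 <= e * rho0).
  { unfold W. rewrite <- R02. replace (exp (- 2 * k * rho0 ^ 2) / rho0 ^ 5 * (rho0 ^ 2) ^ 4)
      with (exp (- 2 * k * rho0 ^ 2) * (rho0 ^ 2 * rho0)) by (field; lra).
    rewrite <- (Rmult_1_l (rho0 ^ 2 * rho0)) at 2.
    apply Rmult_le_compat_r; [rewrite R02; apply Rmult_le_pos; lra|].
    rewrite <- exp_0. apply exp_le. generalize (pow2_ge_0 rho0). nra. }
  assert (W0p : 0 < W rho0) by (apply Rdiv_lt_0_compat; [apply exp_pos | apply pow_lt; lra]).
  assert (Hfin : N q * W rho1 <= (8 * K1 + 16 * B) * (e * rho1)).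
  { assert (N (e ^ 2) * W rho0 <= 8 * K1 * (e * rho0)).
    { apply Rle_trans with (8 * (K1 * e ^ 4) * W rho0); [apply Rmult_le_compat_r; lra|].
      replace (8 * (K1 * e ^ 4) * W rho0) with (8 * K1 * (W rho0 * e ^ 4)) by ring.
      apply Rmult_le_compat_l; lra. }
    assert (8 * K1 * (e * rho0) <= 8 * K1 * (e * rho1)).
    { apply Rmult_le_compat_l; [lra|]. apply Rmult_le_compat_l; lra. }
    assert (0 <= 16 * B * e * rho0) by (repeat apply Rmult_le_pos; lra).
    replace ((8 * K1 + 16 * B) * (e * rho1)) with (8 * K1 * (e * rho1) + 16 * B * e * rho1) by ring.
    lra. }
  assert (R1p : 0 < rho1) by lra.
  assert (R11 : rho1 ^ 2 <= 1).
  { rewrite R12, <- sqrt_1. apply sqrt_le_1_alt. lra. }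
  assert (Nq : N q <= exp (2 * k) * (8 * K1 + 16 * B) * (e * rho1 ^ 6)).
  { replace (N q) with (N q * W rho1 * (exp (2 * k * rho1 ^ 2) * rho1 ^ 5)).
    - apply Rle_trans with ((8 * K1 + 16 * B) * (e * rho1) * (exp (2 * k) * rho1 ^ 5)).
      + apply Rmult_le_compat; auto.
        * apply Rmult_le_pos; [apply HN0; auto|]. apply Rlt_le, Rdiv_lt_0_compat; [apply exp_pos | apply pow_lt; lra].
        * apply Rmult_le_pos; [apply Rlt_le, exp_pos | apply pow_le; lra].
        * apply Rmult_le_compat_r; [apply pow_le; lra|]. apply exp_le. nra.
      + right; ring.
    - unfold W. replace (- 2 * k * rho1 ^ 2) with (- (2 * k * rho1 ^ 2)) by ring. rewrite exp_Ropp.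
      field. repeat split; try lra; apply Rgt_not_eq, exp_pos. }
  destruct (HN0 q Hq) as [_ [N2 _]].
  assert (E1 : e1 q ^ 2 + e2 q ^ 2 <= exp (2 * k) * (4 * K1 + 8 * B) * (e ^ 7 * rho1 ^ 2)).
  { apply Rmult_le_reg_l with (2 * q / e ^ 6).
    - apply Rdiv_lt_0_compat; lra.
    - eapply Rle_trans; [apply N2|]. eapply Rle_trans; [apply Nq|]. right.
      rewrite <- R14. field. lra. }
  eapply Rle_trans; [apply E1|].
  assert (E2 : e ^ 7 * rho1 ^ 2 <= e ^ 8 * sqrt (1 + q / e ^ 2)).
  { replace (e ^ 7 * rho1 ^ 2) with (e ^ 8 * (sqrt q / e)) by (rewrite R12; field; lra).
    apply Rmult_le_compat_l; [lra|].
    replace (sqrt q / e) with (sqrt (q / e ^ 2)).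
    - apply sqrt_le_1_alt. lra.
    - rewrite sqrt_div_alt by auto. rewrite sqrt_pow2 by lra. auto. }
  apply Rle_trans with (exp (2 * k) * (4 * K1 + 8 * B) * (e ^ 8 * sqrt (1 + q / e ^ 2))).
  - apply Rmult_le_compat_l; auto.
  - assert (0 <= K1 * (e ^ 8 * sqrt (1 + q / e ^ 2))).
    { apply Rmult_le_pos; auto. apply Rmult_le_pos; lra. }
    lra.
Qed.

(** * The Langer variable as a smooth function of mu^2 *)

(** Beyond a finite radius the terms a_n y^n could not tend to zero, but they are dominated by those
    of the exponential series. *)
Lemma CV_radius_fact (a : nat -> R) (x : R) :
  (forall n, Rabs (a n) <= / INR (Factorial.fact n)) -> Rbar_lt (Rabs x) (CV_radius a).
Proof.
  intros H. apply Rbar_not_le_lt. intros Hle.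
  set (y := Rabs x + 1).
  assert (Hy : 0 < y) by (unfold y; generalize (Rabs_pos x); lra).
  apply (CV_disk_outside a y).
  - eapply Rbar_le_lt_trans; [apply Hle|]. simpl. rewrite (Rabs_pos_eq y) by lra. unfold y; lra.
  - apply ex_series_lim_0.
    apply (ex_series_le (K := R_AbsRing) (V := R_CompleteNormedModule) _
             (fun n => / INR (Factorial.fact n) * y ^ n)).
    + intros n. unfold norm; simpl; unfold abs; simpl. rewrite Rabs_mult.
      rewrite (Rabs_pos_eq (y ^ n)) by (apply pow_le; lra).
      apply Rmult_le_compat_r; [apply pow_le; lra | apply H].
    + exists (exp y). generalize (is_exp_Reals y). unfold is_pseries.
      apply is_series_ext. intros n. rewrite pow_n_pow. unfold scal; simpl; unfold mult; simpl. ring.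
Qed.

(** In q = m^2 the three series are cosh m, sinh m / m and (m cosh m - sinh m) / m^3. This variable
    removes the apparent singularities at mu = 0. *)
Definition chc (n : nat) : R := / INR (Factorial.fact (2 * n)).
Definition shc (n : nat) : R := / INR (Factorial.fact (2 * n + 1)).
Definition phc (n : nat) : R := chc (S n) - shc (S n).

Definition chq : R -> R := PSeries chc.
Definition shq : R -> R := PSeries shc.
Definition phq : R -> R := PSeries phc.
Definition phq1 : R -> R := PSeries (PS_derive phc).
Definition phq2 : R -> R := PSeries (PS_derive (PS_derive phc)).

Lemma inv_fact_le (n m : nat) : (n <= m)%nat ->
  0 < / INR (Factorial.fact m) <= / INR (Factorial.fact n).
Proof.
  intros H. assert (0 < INR (Factorial.fact n)) by apply INR_fact_lt_0.
  assert (0 < INR (Factorial.fact m)) by apply INR_fact_lt_0.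
  split; [apply Rinv_0_lt_compat; auto|]. apply Rinv_le_contravar; auto.
  apply le_INR, Factorial.fact_le. auto.
Qed.

Lemma chc_radius (x : R) : Rbar_lt (Rabs x) (CV_radius chc).
Proof.
  apply CV_radius_fact. intros n. unfold chc.
  destruct (inv_fact_le n (2 * n) ltac:(lia)). rewrite Rabs_pos_eq; lra.
Qed.

Lemma shc_radius (x : R) : Rbar_lt (Rabs x) (CV_radius shc).
Proof.
  apply CV_radius_fact. intros n. unfold shc.
  destruct (inv_fact_le n (2 * n + 1) ltac:(lia)). rewrite Rabs_pos_eq; lra.
Qed.

Lemma phc_radius (x : R) : Rbar_lt (Rabs x) (CV_radius phc).
Proof.
  apply CV_radius_fact. intros n. unfold phc, chc, shc.
  destruct (inv_fact_le n (2 * S n) ltac:(lia)).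
  destruct (inv_fact_le (2 * S n) (2 * S n + 1) ltac:(lia)).
  rewrite Rabs_pos_eq; lra.
Qed.

Lemma ex_pseries_radius (a : nat -> R) (x : R) : Rbar_lt (Rabs x) (CV_radius a) -> ex_pseries a x.
Proof. intros H. apply CV_radius_inside; auto. Qed.

Lemma INR_fact_S (n : nat) : INR (Factorial.fact (S n)) = INR (S n) * INR (Factorial.fact n).
Proof. rewrite <- mult_INR. reflexivity. Qed.

Lemma chc_S (n : nat) : INR (S n) * chc (S n) = / 2 * shc n.
Proof.
  unfold chc, shc. replace (2 * S n)%nat with (S (2 * n + 1)) by lia.
  assert (H := INR_fact_lt_0 (2 * n + 1)). rewrite INR_fact_S.
  replace (INR (S (2 * n + 1))) with (2 * INR (S n)).
  - assert (0 < INR (S n)) by apply lt_0_INR, Nat.lt_0_succ. field. lra.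
  - replace (S (2 * n + 1)) with (2 * S n)%nat by lia. rewrite mult_INR. reflexivity.
Qed.

Lemma shc_S (n : nat) : INR (S n) * shc (S n) = / 2 * phc n.
Proof.
  unfold phc, chc, shc. replace (2 * S n + 1)%nat with (S (2 * S n)) by lia.
  assert (H := INR_fact_lt_0 (2 * S n)). rewrite INR_fact_S.
  assert (0 < INR (S n)) by apply lt_0_INR, Nat.lt_0_succ.
  rewrite (S_INR (2 * S n)), mult_INR. change (INR 2) with 2. field. lra.
Qed.

Lemma is_derive_chq (q : R) : is_derive chq q (shq q / 2).
Proof.
  replace (shq q / 2) with (PSeries (PS_derive chc) q).
  - apply is_derive_PSeries, chc_radius.
  - unfold shq. rewrite (PSeries_ext (PS_derive chc) (PS_scal (/ 2) shc)).
    + rewrite PSeries_scal. field.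
    + exact chc_S.
Qed.

Lemma is_derive_shq (q : R) : is_derive shq q (phq q / 2).
Proof.
  replace (phq q / 2) with (PSeries (PS_derive shc) q).
  - apply is_derive_PSeries, shc_radius.
  - unfold phq. rewrite (PSeries_ext (PS_derive shc) (PS_scal (/ 2) phc)).
    + rewrite PSeries_scal. field.
    + exact shc_S.
Qed.

Lemma is_derive_phq (q : R) : is_derive phq q (phq1 q).
Proof. apply is_derive_PSeries, phc_radius. Qed.

Lemma is_derive_phq1 (q : R) : is_derive phq1 q (phq2 q).
Proof. apply is_derive_PSeries. rewrite CV_radius_derive. apply phc_radius. Qed.

Lemma chq_shq_phq (q : R) : chq q = shq q + q * phq q.
Proof.
  unfold chq, shq, phq. rewrite <- PSeries_incr_1, <- PSeries_plus.
  - apply PSeries_ext. intros [|n].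
    + unfold PS_plus, PS_incr_1, plus, zero; simpl. unfold chc, shc; simpl. field.
    + unfold PS_plus, PS_incr_1, plus; simpl. unfold phc. ring.
  - apply ex_pseries_radius, shc_radius.
  - apply ex_pseries_incr_1, ex_pseries_radius, phc_radius.
Qed.

(** Differentiating [chq_shq_phq] and comparing with chq' = shq / 2 and shq' = phq / 2 gives the
    relation. *)
Lemma phq1_eq (q : R) : q * phq1 q = (shq q - 3 * phq q) / 2.
Proof.
  assert (D : is_derive chq q (phq q / 2 + (phq q + q * phq1 q))).
  { apply (is_derive_ext (fun u => shq u + u * phq u)); [intros; symmetry; apply chq_shq_phq|].
    apply (is_derive_plus shq (fun u => u * phq u)); [apply is_derive_shq|].
    replace (phq q + q * phq1 q) with (1 * phq q + q * phq1 q) by ring.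
    apply (is_derive_multR (fun u => u) phq); [apply @is_derive_id | apply is_derive_phq]. }
  apply is_derive_unique in D. rewrite (is_derive_unique _ _ _ (is_derive_chq q)) in D. lra.
Qed.

Lemma exp_chq_shq (m : R) : exp m = chq (m ^ 2) + m * shq (m ^ 2).
Proof.
  rewrite exp_Reals, PSeries_odd_even.
  - reflexivity.
  - apply (ex_pseries_radius chc), chc_radius.
  - apply (ex_pseries_radius shc), shc_radius.
Qed.

Lemma cosh_chq (m : R) : cosh m = chq (m ^ 2).
Proof.
  unfold cosh. rewrite (exp_chq_shq m), (exp_chq_shq (- m)).
  replace ((- m) ^ 2) with (m ^ 2) by ring. field.
Qed.

Lemma sinh_shq (m : R) : sinh m = m * shq (m ^ 2).
Proof.
  unfold sinh. rewrite (exp_chq_shq m), (exp_chq_shq (- m)).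
  replace ((- m) ^ 2) with (m ^ 2) by ring. field.
Qed.

Lemma chq_0 : chq 0 = 1.
Proof. unfold chq. rewrite PSeries_0. unfold chc; simpl. field. Qed.
Lemma shq_0 : shq 0 = 1.
Proof. unfold shq. rewrite PSeries_0. unfold shc; simpl. field. Qed.
Lemma phq_0 : phq 0 = / 3.
Proof. unfold phq. rewrite PSeries_0. unfold phc, chc, shc; simpl. field. Qed.
Lemma phq1_0 : phq1 0 = / 30.
Proof. unfold phq1. rewrite PSeries_0. unfold PS_derive, phc, chc, shc; simpl. field. Qed.

Lemma chq2_shq2 (q : R) : 0 <= q -> chq q ^ 2 - q * shq q ^ 2 = 1.
Proof.
  intros Hq. generalize (cosh2_sinh2 (sqrt q)).
  rewrite cosh_chq, sinh_shq. rewrite pow2_sqrt by auto.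
  rewrite Rpow_mult_distr, pow2_sqrt by auto. auto.
Qed.

Lemma chq_ge_1 (q : R) : 0 <= q -> 1 <= chq q.
Proof.
  intros Hq. rewrite <- (pow2_sqrt q), <- cosh_chq by auto.
  generalize (cosh_bounds (sqrt q)) (pow2_ge_0 (sqrt q)); lra.
Qed.

Lemma shq_ge_1 (q : R) : 0 <= q -> 1 <= shq q.
Proof.
  intros [Hq|<-]; [|rewrite shq_0; lra].
  assert (Hs : 0 < sqrt q) by (apply sqrt_lt_R0; auto).
  assert (H := sinh_lower (sqrt q) ltac:(lra)).
  rewrite sinh_shq, pow2_sqrt in H by lra. nra.
Qed.

(* [langer_H = (3 P / C)^(1/6)] and [langer_R = (C / S)^(1/2)], with C, S, P = chq, shq, phq,
   so that the Langer variable is [langer_z = (3 (mu - tanh mu))^(2/3)]. *)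
Definition langer_H (q : R) : R := exp (/ 6 * ln (3 * phq q / chq q)).
Definition langer_R (q : R) : R := sqrt (chq q / shq q).
Definition langer_z (q : R) : R := q * langer_H q ^ 4.
Definition langer_d (q : R) : R := 2 / (langer_R q * langer_H q) ^ 2.

(** Logarithmic derivatives in q of [langer_H] and [langer_R]; [langer_lH1] and [langer_lR1] are
    their own q-derivatives. *)
Definition langer_lH (q : R) : R := / 6 * (phq1 q / phq q - shq q / (2 * chq q)).
Definition langer_lR (q : R) : R := / 2 * (shq q / (2 * chq q) - phq q / (2 * shq q)).
Definition langer_lH1 (q : R) : R :=
  / 6 * (phq2 q / phq q - (phq1 q / phq q) ^ 2 - phq q / (4 * chq q) + (shq q / (2 * chq q)) ^ 2).
Definition langer_lR1 (q : R) : R :=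
  / 2 * (phq q / (4 * chq q) - (shq q / (2 * chq q)) ^ 2 - phq1 q / (2 * shq q) + (phq q / (2 * shq q)) ^ 2).

Definition series_pos (q : R) : Prop := 0 < chq q /\ 0 < shq q /\ 0 < phq q.

Lemma langer_H_pos (q : R) : 0 < langer_H q.
Proof. apply exp_pos. Qed.

Lemma langer_R_pos (q : R) : series_pos q -> 0 < langer_R q.
Proof. intros [H1 [H2 _]]. apply sqrt_lt_R0, Rdiv_lt_0_compat; auto. Qed.

Lemma langer_R2 (q : R) : series_pos q -> langer_R q ^ 2 = chq q / shq q.
Proof. intros [H1 [H2 _]]. apply pow2_sqrt, Rlt_le, Rdiv_lt_0_compat; auto. Qed.

Lemma langer_H6 (q : R) : series_pos q -> langer_H q ^ 6 = 3 * phq q / chq q.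
Proof.
  intros [H1 [H2 H3]]. unfold langer_H. rewrite exp_INR_mult.
  replace (INR 6 * (/ 6 * ln (3 * phq q / chq q))) with (ln (3 * phq q / chq q)) by (simpl; field).
  apply exp_ln, Rdiv_lt_0_compat; lra.
Qed.

Lemma is_derive_langer_H (q : R) : series_pos q ->
  is_derive langer_H q (langer_H q * langer_lH q).
Proof.
  intros [H1 [H2 H3]].
  assert (D1 := is_derive_chq q). assert (D2 := is_derive_phq q).
  unfold langer_H at 1. auto_derive.
  - repeat split; try (eexists; eauto); try lra.
    apply Rmult_lt_0_compat; [lra | apply Rinv_0_lt_compat; auto].
  - rewrite_Derive D1; rewrite_Derive D2. unfold langer_H, langer_lH, Rdiv. field. lra.
Qed.

Lemma is_derive_langer_R (q : R) : series_pos q ->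
  is_derive langer_R q (langer_R q * langer_lR q).
Proof.
  intros Hp. assert (Hr := langer_R_pos q Hp). assert (Hr2 := langer_R2 q Hp).
  destruct Hp as [H1 [H2 H3]].
  assert (D1 := is_derive_chq q). assert (D2 := is_derive_shq q).
  unfold langer_R in *. auto_derive.
  - repeat split; try (eexists; eauto); try lra.
    apply Rmult_lt_0_compat; [lra | apply Rinv_0_lt_compat; auto].
  - rewrite_Derive D1; rewrite_Derive D2. unfold langer_lR.
    change (chq q * / shq q) with (chq q / shq q).
    apply Rmult_eq_reg_r with (2 * sqrt (chq q / shq q)); [|lra].
    replace (/ 2 * (shq q / (2 * chq q) - phq q / (2 * shq q))) with
      (/ 2 * (shq q / (2 * chq q) - phq q / (2 * shq q))) by reflexivity.
    transitivity (2 * (sqrt (chq q / shq q)) ^ 2 * (/ 2 * (shq q / (2 * chq q) - phq q / (2 * shq q)))).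
    + rewrite Hr2. field. repeat split; lra.
    + ring.
Qed.

Lemma is_derive_langer_lH (q : R) : series_pos q -> is_derive langer_lH q (langer_lH1 q).
Proof.
  intros [H1 [H2 H3]].
  assert (D1 := is_derive_chq q). assert (D2 := is_derive_phq q). assert (D3 := is_derive_phq1 q).
  assert (D4 := is_derive_shq q).
  unfold langer_lH. auto_derive.
  - repeat split; try (eexists; eauto); try lra.
  - rewrite_Derive D1; rewrite_Derive D2; rewrite_Derive D3; rewrite_Derive D4.
    unfold langer_lH1. field. lra.
Qed.

Lemma is_derive_langer_lR (q : R) : series_pos q -> is_derive langer_lR q (langer_lR1 q).
Proof.
  intros [H1 [H2 H3]].
  assert (D1 := is_derive_chq q). assert (D2 := is_derive_phq q). assert (D4 := is_derive_shq q).
  unfold langer_lR. auto_derive.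
  - repeat split; try (eexists; eauto); try lra.
  - rewrite_Derive D1; rewrite_Derive D2; rewrite_Derive D4.
    unfold langer_lR1. field. lra.
Qed.

(** The left side is q times the logarithmic derivative of [langer_z]; eliminating phq1 by [phq1_eq]
    gives that derivative a closed form. *)
Lemma langer_lH_eq (q : R) : series_pos q ->
  1 + 4 * q * langer_lH q = shq q ^ 2 / (3 * phq q * chq q).
Proof.
  intros [H1 [H2 H3]]. unfold langer_lH.
  replace (4 * q * (/ 6 * (phq1 q / phq q - shq q / (2 * chq q))))
    with (4 / 6 * (q * phq1 q) / phq q - q * shq q / (3 * chq q)) by (field; lra).
  rewrite phq1_eq. replace (q * shq q / (3 * chq q)) with (q * phq q * shq q / (3 * chq q * phq q)) by (field; lra).
  replace (q * phq q) with (chq q - shq q) by (rewrite chq_shq_phq; ring).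
  field. lra.
Qed.

Lemma is_derive_langer_z (q : R) : series_pos q ->
  is_derive langer_z q (langer_d q / (2 * langer_R q ^ 2)).
Proof.
  intros Hp. assert (Hr := langer_R_pos q Hp). assert (Hr2 := langer_R2 q Hp).
  assert (Hh := langer_H_pos q). assert (Hh6 := langer_H6 q Hp).
  assert (D := is_derive_langer_H q Hp). assert (El := langer_lH_eq q Hp).
  replace (langer_d q / (2 * langer_R q ^ 2)) with (langer_H q ^ 4 * (1 + 4 * q * langer_lH q)).
  - unfold langer_z. auto_derive; [eexists; eauto|]. rewrite_Derive D. ring.
  - rewrite El. unfold langer_d. destruct Hp as [H1 [H2 H3]].
    replace (langer_H q ^ 4) with (langer_H q ^ 6 / langer_H q ^ 2) by (field; lra).
    replace (2 / (langer_R q * langer_H q) ^ 2 / (2 * langer_R q ^ 2))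
      with (/ (langer_R q ^ 2 * langer_R q ^ 2 * langer_H q ^ 2)) by (field; lra).
    rewrite Hh6, Hr2. field. repeat split; lra.
Qed.

(** Langer's condition: [langer_d] is dz / d ln cosh mu and the right side is 4 tanh(mu)^2, so that
    Ai(-z / e^2) reproduces the term -4 tanh(mu)^2 / e^6 of the potential. *)
Lemma langer_zd2 (q : R) : series_pos q ->
  langer_z q * langer_d q ^ 2 = 4 * q * (shq q / chq q) ^ 2.
Proof.
  intros Hp. assert (Hr := langer_R_pos q Hp). assert (Hr2 := langer_R2 q Hp).
  assert (Hh := langer_H_pos q). unfold langer_z, langer_d.
  replace (q * langer_H q ^ 4 * (2 / (langer_R q * langer_H q) ^ 2) ^ 2)
    with (4 * q / (langer_R q ^ 2) ^ 2) by (field; lra).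
  rewrite Hr2. destruct Hp as [H1 [H2 H3]]. field. lra.
Qed.

(* The suffixes 1 and 2 mark derivatives with respect to [ln cosh mu], not [q = mu^2];
   [inv_speed q] is d (ln cosh mu) / d q. *)

Definition amp_a (r q : R) : R := langer_R q * langer_H q * chq (r ^ 2 * q).
Definition amp_a1 (r q : R) : R :=
  2 * langer_R q ^ 3 * langer_H q *
   ((langer_lR q + langer_lH q) * chq (r ^ 2 * q) + r ^ 2 * shq (r ^ 2 * q) / 2).
Definition amp_a2 (r q : R) : R :=
  4 * langer_R q ^ 5 * langer_H q *
   ((3 * langer_lR q + langer_lH q) *
      ((langer_lR q + langer_lH q) * chq (r ^ 2 * q) + r ^ 2 * shq (r ^ 2 * q) / 2)
    + (langer_lR1 q + langer_lH1 q) * chq (r ^ 2 * q)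
    + (langer_lR q + langer_lH q) * r ^ 2 * shq (r ^ 2 * q) / 2
    + r ^ 4 * phq (r ^ 2 * q) / 4).

(** In terms of mu the amplitudes are R H cosh(r mu) and (R / H) sinh(r mu) / mu. *)
Definition amp_b (r q : R) : R := langer_R q / langer_H q * (r * shq (r ^ 2 * q)).
Definition amp_b1 (r q : R) : R :=
  2 * langer_R q ^ 3 / langer_H q *
   ((langer_lR q - langer_lH q) * (r * shq (r ^ 2 * q)) + r ^ 3 * phq (r ^ 2 * q) / 2).
Definition amp_b2 (r q : R) : R :=
  4 * langer_R q ^ 5 / langer_H q *
   ((3 * langer_lR q - langer_lH q) *
     ((langer_lR q - langer_lH q) * (r * shq (r ^ 2 * q)) + r ^ 3 * phq (r ^ 2 * q) / 2)
    + (langer_lR1 q - langer_lH1 q) * (r * shq (r ^ 2 * q))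
    + (langer_lR q - langer_lH q) * (r ^ 3 * phq (r ^ 2 * q) / 2)
    + r ^ 5 * phq1 (r ^ 2 * q) / 2).

Definition inv_speed (q : R) : R := / (2 * langer_R q ^ 2).

Ltac amp_derive q r Hp :=
  let D1 := fresh "D" in let D2 := fresh "D" in let D3 := fresh "D" in let D4 := fresh "D" in
  let D5 := fresh "D" in let D6 := fresh "D" in let D7 := fresh "D" in
  assert (Hr := langer_R_pos q Hp); assert (Hh := langer_H_pos q);
  assert (D1 := is_derive_langer_H q Hp); assert (D2 := is_derive_langer_R q Hp);
  assert (D3 := is_derive_langer_lH q Hp); assert (D4 := is_derive_langer_lR q Hp);
  assert (D5 := is_derive_chq (r ^ 2 * q)); assert (D6 := is_derive_shq (r ^ 2 * q));
  assert (D7 := is_derive_phq (r ^ 2 * q));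
  cbn [pow] in D5, D6, D7;
  auto_derive;
  [ repeat split; try (eexists; eauto); try lra
  | rewrite_Derive D1; rewrite_Derive D2; try (rewrite_Derive D3); try (rewrite_Derive D4);
    try (rewrite_Derive D5); try (rewrite_Derive D6); try (rewrite_Derive D7);
    unfold inv_speed; cbn [pow]; field; lra ].

Lemma is_derive_amp_a (r q : R) : series_pos q ->
  is_derive (amp_a r) q (inv_speed q * amp_a1 r q).
Proof. intros Hp. unfold amp_a, amp_a1. amp_derive q r Hp. Qed.

Lemma is_derive_amp_b (r q : R) : series_pos q ->
  is_derive (amp_b r) q (inv_speed q * amp_b1 r q).
Proof. intros Hp. unfold amp_b, amp_b1. amp_derive q r Hp. Qed.

Lemma is_derive_amp_a1 (r q : R) : series_pos q ->
  is_derive (amp_a1 r) q (inv_speed q * amp_a2 r q).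
Proof. intros Hp. unfold amp_a1, amp_a2. amp_derive q r Hp. Qed.

Lemma is_derive_amp_b1 (r q : R) : series_pos q ->
  is_derive (amp_b1 r) q (inv_speed q * amp_b2 r q).
Proof. intros Hp. unfold amp_b1, amp_b2. amp_derive q r Hp. Qed.

Lemma is_derive_langer_d (q : R) : series_pos q ->
  is_derive langer_d q (- 2 * langer_d q * (langer_lR q + langer_lH q)).
Proof.
  intros Hp. assert (Hr := langer_R_pos q Hp). assert (Hh := langer_H_pos q).
  assert (D1 := is_derive_langer_H q Hp). assert (D2 := is_derive_langer_R q Hp).
  unfold langer_d. auto_derive.
  - repeat split; try (eexists; eauto).
    assert (0 < langer_R q * langer_H q) by (apply Rmult_lt_0_compat; auto). simpl. nra.
  - rewrite_Derive D1; rewrite_Derive D2. cbn [pow]. field. lra.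
Qed.

(** * The Airy comparison function *)

(** Serves to bound the long amplitude formulas near q = 0 without explicit constants: the property
    passes to sums, products and powers, and inverses are supplied as atoms. *)
Definition nearb (M : R) (f : R -> R -> R) : Prop :=
  exists d B, 0 < d /\ forall r q, Rabs r <= M -> Rabs q < d -> Rabs (f r q) <= B.

Lemma continuous_near (f : R -> R) (x l eps : R) : is_derive f x l -> 0 < eps ->
  exists d, 0 < d /\ forall y, Rabs (y - x) < d -> Rabs (f y - f x) < eps.
Proof.
  intros H He. assert (Hc := cont_of_derive f x l H).
  destruct (Hc (ball (f x) (mkposreal eps He)) (locally_ball _ _)) as [d Hd].
  exists d. split; [apply cond_pos|]. intros y Hy. exact (Hd y Hy).
Qed.

Lemma nearb_q (M : R) (f : R -> R) (l : R) : is_derive f 0 l -> nearb M (fun _ q => f q).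
Proof.
  intros H. destruct (continuous_near f 0 l 1 H Rlt_0_1) as [d [Hd Hf]].
  exists d, (Rabs (f 0) + 1). split; auto. intros r q _ Hq.
  rewrite <- (Rminus_0_r q) in Hq. specialize (Hf q Hq).
  revert Hf. unfold Rabs; repeat destruct Rcase_abs; lra.
Qed.

Lemma nearb_rq (M : R) (f : R -> R) (l : R) : is_derive f 0 l -> nearb M (fun r q => f (r ^ 2 * q)).
Proof.
  intros H. destruct (continuous_near f 0 l 1 H Rlt_0_1) as [d [Hd Hf]].
  assert (HM : 0 < M ^ 2 + 1) by nra.
  exists (d / (M ^ 2 + 1)), (Rabs (f 0) + 1). split; [apply Rdiv_lt_0_compat; auto|].
  intros r q Hr Hq.
  assert (Hrq : Rabs (r ^ 2 * q - 0) < d).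
  { rewrite Rminus_0_r, Rabs_mult, (Rabs_pos_eq (r ^ 2)) by apply pow2_ge_0.
    assert (r ^ 2 <= M ^ 2).
    { rewrite <- (pow2_abs r). apply pow_incr. split; [apply Rabs_pos | auto]. }
    assert (Rabs q * (M ^ 2 + 1) < d).
    { replace d with (d / (M ^ 2 + 1) * (M ^ 2 + 1)) by (field; lra). apply Rmult_lt_compat_r; auto. }
    generalize (Rabs_pos q). nra. }
  specialize (Hf _ Hrq). revert Hf. unfold Rabs; repeat destruct Rcase_abs; lra.
Qed.

Lemma nearb_const (M c : R) : nearb M (fun _ _ => c).
Proof. exists 1, (Rabs c). split; [lra|]. intros; lra. Qed.

Lemma nearb_r (M : R) : nearb M (fun r _ => r).
Proof. exists 1, M. split; [lra|]. auto. Qed.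

Lemma nearb_plus (M : R) (f g : R -> R -> R) :
  nearb M f -> nearb M g -> nearb M (fun r q => f r q + g r q).
Proof.
  intros [d [B [Hd H]]] [d' [B' [Hd' H']]]. exists (Rmin d d'), (B + B').
  split; [apply Rmin_pos; auto|]. intros r q Hr Hq.
  eapply Rle_trans; [apply Rabs_triang|]. apply Rplus_le_compat.
  - apply H; auto. eapply Rlt_le_trans; [apply Hq | apply Rmin_l].
  - apply H'; auto. eapply Rlt_le_trans; [apply Hq | apply Rmin_r].
Qed.

Lemma nearb_mult (M : R) (f g : R -> R -> R) :
  nearb M f -> nearb M g -> nearb M (fun r q => f r q * g r q).
Proof.
  intros [d [B [Hd H]]] [d' [B' [Hd' H']]]. exists (Rmin d d'), (B * B').
  split; [apply Rmin_pos; auto|]. intros r q Hr Hq. rewrite Rabs_mult.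
  apply Rmult_le_compat; try apply Rabs_pos.
  - apply H; auto. eapply Rlt_le_trans; [apply Hq | apply Rmin_l].
  - apply H'; auto. eapply Rlt_le_trans; [apply Hq | apply Rmin_r].
Qed.

Lemma nearb_minus (M : R) (f g : R -> R -> R) :
  nearb M f -> nearb M g -> nearb M (fun r q => f r q - g r q).
Proof.
  intros Hf [d [B [Hd H]]]. apply (nearb_plus M f (fun r q => - g r q)); auto.
  exists d, B. split; auto. intros. rewrite Rabs_Ropp; auto.
Qed.

Lemma nearb_pow (M : R) (f : R -> R -> R) (n : nat) :
  nearb M f -> nearb M (fun r q => f r q ^ n).
Proof.
  intros H. induction n; [exact (nearb_const M 1) | exact (nearb_mult M _ _ H IHn)].
Qed.

Lemma nearb_inv (M : R) (f : R -> R) (l : R) :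
  is_derive f 0 l -> f 0 <> 0 -> nearb M (fun _ q => / f q).
Proof.
  intros H H0. apply (nearb_q M (fun q => / f q) (- l / f 0 ^ 2)).
  apply (is_derive_inv f); auto.
Qed.

Ltac nearb := lazymatch goal with
  | |- nearb _ (fun _ _ => ?c) => exact (nearb_const _ c)
  | |- nearb _ (fun r q => r) => exact (nearb_r _)
  | |- nearb _ (fun r q => _ + _) => apply nearb_plus; nearb
  | |- nearb _ (fun r q => _ - _) => apply nearb_minus; nearb
  | |- nearb _ (fun r q => _ * _) => apply nearb_mult; nearb
  | |- nearb _ (fun r q => _ / _) => apply nearb_mult; nearb
  | |- nearb _ (fun r q => _ ^ _) => apply nearb_pow; nearb
  | |- _ => try assumption
  end.

Lemma series_pos_0 : series_pos 0.
Proof. unfold series_pos. rewrite chq_0, shq_0, phq_0. lra. Qed.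

Lemma amp_bounds (M : R) : exists d B, 0 < d /\ 0 <= B /\ forall r q, Rabs r <= M -> Rabs q < d ->
  Rabs (amp_a r q) <= B /\ Rabs (amp_b r q) <= B /\ Rabs (amp_a2 r q) <= B /\ Rabs (amp_b2 r q) <= B.
Proof.
  assert (P0 := series_pos_0).
  assert (C0 : nearb M (fun _ q => chq q)) by (apply (nearb_q M chq _ (is_derive_chq 0))).
  assert (S0 : nearb M (fun _ q => shq q)) by (apply (nearb_q M shq _ (is_derive_shq 0))).
  assert (Q0 : nearb M (fun _ q => phq q)) by (apply (nearb_q M phq _ (is_derive_phq 0))).
  assert (Q1 : nearb M (fun _ q => phq1 q)) by (apply (nearb_q M phq1 _ (is_derive_phq1 0))).
  assert (Q2 : nearb M (fun _ q => phq2 q)).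
  { apply (nearb_q M phq2 (PSeries (PS_derive (PS_derive (PS_derive phc))) 0)).
    apply is_derive_PSeries. rewrite !CV_radius_derive. apply phc_radius. }
  assert (Ci : nearb M (fun _ q => / chq q)).
  { apply (nearb_inv M chq _ (is_derive_chq 0)). rewrite chq_0; lra. }
  assert (Si : nearb M (fun _ q => / shq q)).
  { apply (nearb_inv M shq _ (is_derive_shq 0)). rewrite shq_0; lra. }
  assert (Qi : nearb M (fun _ q => / phq q)).
  { apply (nearb_inv M phq _ (is_derive_phq 0)). rewrite phq_0; lra. }
  assert (Cc : forall c, nearb M (fun _ q => / (c * chq q))).
  (* For c = 0 the function is the constant [/ 0]. *)
  { intros c. destruct (Req_dec c 0) as [->|Hc].
    - apply (nearb_q M (fun q => / (0 * chq q)) 0).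
      apply (is_derive_ext (fun _ => / 0)); [intros; f_equal; ring | apply @is_derive_const].
    - apply (nearb_inv M (fun q => c * chq q) (c * (shq 0 / 2))).
      + apply (is_derive_scal chq 0 c), is_derive_chq.
      + rewrite chq_0. lra. }
  assert (Sc : forall c, nearb M (fun _ q => / (c * shq q))).
  { intros c. destruct (Req_dec c 0) as [->|Hc].
    - apply (nearb_q M (fun q => / (0 * shq q)) 0).
      apply (is_derive_ext (fun _ => / 0)); [intros; f_equal; ring | apply @is_derive_const].
    - apply (nearb_inv M (fun q => c * shq q) (c * (phq 0 / 2))).
      + apply (is_derive_scal shq 0 c), is_derive_shq.
      + rewrite shq_0. lra. }
  assert (Cr : nearb M (fun r q => chq (r ^ 2 * q))) by (apply (nearb_rq M chq _ (is_derive_chq 0))).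
  assert (Sr : nearb M (fun r q => shq (r ^ 2 * q))) by (apply (nearb_rq M shq _ (is_derive_shq 0))).
  assert (Qr : nearb M (fun r q => phq (r ^ 2 * q))) by (apply (nearb_rq M phq _ (is_derive_phq 0))).
  assert (Qr1 : nearb M (fun r q => phq1 (r ^ 2 * q))) by (apply (nearb_rq M phq1 _ (is_derive_phq1 0))).
  assert (HH : nearb M (fun _ q => langer_H q)) by (apply (nearb_q M _ _ (is_derive_langer_H 0 P0))).
  assert (HR : nearb M (fun _ q => langer_R q)) by (apply (nearb_q M _ _ (is_derive_langer_R 0 P0))).
  assert (Hi : nearb M (fun _ q => / langer_H q)).
  { apply (nearb_inv M _ _ (is_derive_langer_H 0 P0)). generalize (langer_H_pos 0); lra. }
  assert (LH : nearb M (fun _ q => langer_lH q)) by (apply (nearb_q M _ _ (is_derive_langer_lH 0 P0))).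
  assert (LR : nearb M (fun _ q => langer_lR q)) by (apply (nearb_q M _ _ (is_derive_langer_lR 0 P0))).
  assert (LH1 : nearb M (fun _ q => langer_lH1 q)) by (unfold langer_lH1; nearb; auto).
  assert (LR1 : nearb M (fun _ q => langer_lR1 q)) by (unfold langer_lR1; nearb; auto).
  assert (NA : nearb M amp_a) by (unfold amp_a; nearb).
  assert (NB : nearb M amp_b) by (unfold amp_b; nearb).
  assert (NA2 : nearb M amp_a2) by (unfold amp_a2; nearb).
  assert (NB2 : nearb M amp_b2) by (unfold amp_b2; nearb).
  destruct NA as [d1 [B1 [D1 H1]]], NB as [d2 [B2 [D2 H2]]], NA2 as [d3 [B3 [D3 H3]]], NB2 as [d4 [B4 [D4 H4]]].
  exists (Rmin (Rmin d1 d2) (Rmin d3 d4)), (Rabs B1 + Rabs B2 + Rabs B3 + Rabs B4).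
  generalize (Rabs_pos B1) (Rabs_pos B2) (Rabs_pos B3) (Rabs_pos B4)
    (Rle_abs B1) (Rle_abs B2) (Rle_abs B3) (Rle_abs B4). intros.
  split; [repeat apply Rmin_pos; auto|]. split; [lra|].
  intros r q Hr Hq.
  assert (Rabs q < d1 /\ Rabs q < d2 /\ Rabs q < d3 /\ Rabs q < d4) as [E1 [E2 [E3 E4]]].
  { repeat split; (eapply Rlt_le_trans; [apply Hq|]).
    - eapply Rle_trans; [apply Rmin_l | apply Rmin_l].
    - eapply Rle_trans; [apply Rmin_l | apply Rmin_r].
    - eapply Rle_trans; [apply Rmin_r | apply Rmin_l].
    - eapply Rle_trans; [apply Rmin_r | apply Rmin_r]. }
  specialize (H1 r q Hr E1). specialize (H2 r q Hr E2). specialize (H3 r q Hr E3). specialize (H4 r q Hr E4).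
  repeat split; lra.
Qed.

Lemma langer_H_0 : langer_H 0 = 1.
Proof.
  unfold langer_H. rewrite phq_0, chq_0. replace (3 * / 3 / 1) with 1 by field.
  rewrite ln_1, Rmult_0_r. apply exp_0.
Qed.

Lemma langer_R_0 : langer_R 0 = 1.
Proof. unfold langer_R. rewrite shq_0, chq_0. replace (1 / 1) with 1 by field. apply sqrt_1. Qed.

Lemma series_near : exists d, 0 < d <= 1 /\ forall q, Rabs q < d ->
  series_pos q /\ chq q <= 6 / 5 /\ / 2 <= langer_H q ^ 4 <= 2.
Proof.
  destruct (continuous_near chq 0 _ (/ 5) (is_derive_chq 0) ltac:(lra)) as [d1 [D1 H1]].
  destruct (continuous_near shq 0 _ (/ 5) (is_derive_shq 0) ltac:(lra)) as [d2 [D2 H2]].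
  destruct (continuous_near phq 0 _ (/ 6) (is_derive_phq 0) ltac:(lra)) as [d3 [D3 H3]].
  destruct (continuous_near langer_H 0 _ (/ 10) (is_derive_langer_H 0 series_pos_0) ltac:(lra)) as [d4 [D4 H4]].
  rewrite chq_0 in H1. rewrite shq_0 in H2. rewrite phq_0 in H3. rewrite langer_H_0 in H4.
  exists (Rmin 1 (Rmin (Rmin d1 d2) (Rmin d3 d4))). split.
  { split; [repeat apply Rmin_pos; lra | apply Rmin_l]. }
  intros q Hq.
  assert (Rabs (q - 0) < d1 /\ Rabs (q - 0) < d2 /\ Rabs (q - 0) < d3 /\ Rabs (q - 0) < d4) as [E1 [E2 [E3 E4]]].
  { rewrite Rminus_0_r.
    assert (Hq' : Rabs q < Rmin (Rmin d1 d2) (Rmin d3 d4)) by (eapply Rlt_le_trans; [apply Hq | apply Rmin_r]).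
    repeat split; (eapply Rlt_le_trans; [apply Hq'|]).
    - eapply Rle_trans; [apply Rmin_l | apply Rmin_l].
    - eapply Rle_trans; [apply Rmin_l | apply Rmin_r].
    - eapply Rle_trans; [apply Rmin_r | apply Rmin_l].
    - eapply Rle_trans; [apply Rmin_r | apply Rmin_r]. }
  apply H1, Rabs_def2 in E1. apply H2, Rabs_def2 in E2. apply H3, Rabs_def2 in E3. apply H4, Rabs_def2 in E4.
  unfold series_pos. repeat split; try lra.
  - assert (81 / 100 <= langer_H q ^ 2) by nra.
    replace (langer_H q ^ 4) with ((langer_H q ^ 2) ^ 2) by ring. nra.
  - assert (langer_H q ^ 2 <= 121 / 100) by nra.
    assert (0 <= langer_H q ^ 2) by apply pow2_ge_0.
    replace (langer_H q ^ 4) with ((langer_H q ^ 2) ^ 2) by ring. nra.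
Qed.

(** * The comparison function and its differential equation *)

Definition cmp_T (q : R) : R := q * (shq q / chq q) ^ 2.
Definition cmp_T1 (q : R) : R :=
  (shq q / chq q) ^ 2 + q * (shq q / chq q) * (phq q / chq q - (shq q / chq q) ^ 2).

Lemma is_derive_cmp_T (q : R) : series_pos q -> is_derive cmp_T q (cmp_T1 q).
Proof.
  intros [H1 [H2 H3]].
  assert (D1 := is_derive_chq q). assert (D2 := is_derive_shq q).
  unfold cmp_T. auto_derive.
  - repeat split; try (eexists; eauto); try lra.
  - rewrite_Derive D1; rewrite_Derive D2. unfold cmp_T1. field. lra.
Qed.

(** In terms of mu, [cmp_T] is tanh(mu)^2. The inequality q T' <= T comes down to (chq - shq) chq <=
    chq^2 - 1, that is, to shq chq >= 1. *)
Lemma cmp_T_bounds (q : R) : series_pos q -> 0 <= q -> chq q <= 6 / 5 ->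
  q / 2 <= cmp_T q <= 2 * q /\ q * cmp_T1 q <= cmp_T q /\ cmp_T q = 1 - / chq q ^ 2 /\
  0 < inv_speed q <= 1.
Proof.
  intros Hp Hq HC. assert (Hr2 := langer_R2 q Hp). assert (Hid := chq2_shq2 q Hq).
  assert (HC1 := chq_ge_1 q Hq). assert (HS1 := shq_ge_1 q Hq).
  assert (Hdef := chq_shq_phq q). destruct Hp as [H1 [H2 H3]].
  assert (Hr : 1 / (6 / 5) <= shq q / chq q <= 1).
  { split.
    - unfold Rdiv at 1 3. apply Rmult_le_compat; [lra | apply Rlt_le, Rinv_0_lt_compat; lra | lra |].
      apply Rinv_le_contravar; lra.
    - apply Rmult_le_reg_r with (chq q); auto. unfold Rdiv. rewrite Rmult_assoc, Rinv_l, Rmult_1_l by lra.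
      nra. }
  unfold cmp_T, cmp_T1, inv_speed. rewrite Hr2.
  assert (Hsq : / 2 <= (shq q / chq q) ^ 2 <= 1).
  { generalize dependent (shq q / chq q). intros u Hu. nra. }
  repeat split.
  - nra.
  - nra.
  - assert (E : q * ((shq q / chq q) ^ 2 + q * (shq q / chq q) * (phq q / chq q - (shq q / chq q) ^ 2))
      = q * (shq q / chq q) ^ 2 + q * (shq q / chq q) / chq q ^ 2 * (q * phq q * chq q - q * shq q ^ 2)).
    { field. lra. }
    rewrite E. replace (q * phq q) with (chq q - shq q) by lra.
    replace (q * shq q ^ 2) with (chq q ^ 2 - 1) by lra.
    assert (0 <= q * (shq q / chq q) / chq q ^ 2).
    { unfold Rdiv. repeat apply Rmult_le_pos; try lra.
      - apply Rlt_le, Rinv_0_lt_compat; auto.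
      - apply Rlt_le, Rinv_0_lt_compat, pow_lt; auto. }
    assert ((chq q - shq q) * chq q - (chq q ^ 2 - 1) <= 0) by nra. nra.
  - replace (q * (shq q / chq q) ^ 2) with (q * shq q ^ 2 / chq q ^ 2) by (field; lra).
    replace (q * shq q ^ 2) with (chq q ^ 2 - 1) by lra. field. lra.
  - apply Rinv_0_lt_compat. assert (0 < chq q / shq q) by (apply Rdiv_lt_0_compat; auto). lra.
  - rewrite <- Rinv_1. apply Rinv_le_contravar; [lra|].
    assert (E : chq q / shq q * (shq q / chq q) = 1) by (field; lra).
    assert (0 < chq q / shq q) by (apply Rdiv_lt_0_compat; auto). nra.
Qed.

Lemma is_derive_conv (f g : R -> R) (x l l' : R) :
  is_derive f x l -> (forall u, f u = g u) -> l = l' -> is_derive g x l'.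
Proof. intros H E <-. exact (is_derive_ext f g x l E H). Qed.

Definition cmp_X (e q : R) : R := langer_z q / e ^ 2.

(** Real and imaginary part of a Ai(-X) + i e b Ai'(-X); [cmp_p1] and [cmp_p2] are those of its
    derivative in ln cosh mu. *)
Definition cmp_m1 (r e q : R) : R := amp_a r q * AiN (cmp_X e q).
Definition cmp_m2 (r e q : R) : R := e * (amp_b r q * AiN' (cmp_X e q)).
Definition cmp_p1 (r e q : R) : R :=
  amp_a1 r q * AiN (cmp_X e q) - amp_a r q * langer_d q / e ^ 2 * AiN' (cmp_X e q).
Definition cmp_p2 (r e q : R) : R :=
  e * (amp_b1 r q * AiN' (cmp_X e q)
       + amp_b r q * (langer_z q * langer_d q / e ^ 4) * AiN (cmp_X e q)).

Lemma is_derive_cmp_A (e q : R) : 0 < e -> series_pos q ->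
  is_derive (fun q => AiN (cmp_X e q)) q (inv_speed q * (- langer_d q / e ^ 2 * AiN' (cmp_X e q))).
Proof.
  intros He Hp. assert (Hr := langer_R_pos q Hp).
  replace (inv_speed q * (- langer_d q / e ^ 2 * AiN' (cmp_X e q)))
    with (langer_d q / (2 * langer_R q ^ 2) / e ^ 2 * - AiN' (cmp_X e q)).
  - apply (is_derive_comp AiN (cmp_X e)); [apply is_derive_AiN|].
    unfold cmp_X, Rdiv. apply (is_derive_ext (fun q => / e ^ 2 * langer_z q)); [intros; apply Rmult_comm|].
    rewrite (Rmult_comm _ (/ e ^ 2)).
    apply (is_derive_scal langer_z q (/ e ^ 2)). apply is_derive_langer_z; auto.
  - unfold inv_speed. field. lra.
Qed.

Lemma is_derive_cmp_A' (e q : R) : 0 < e -> series_pos q ->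
  is_derive (fun q => AiN' (cmp_X e q)) q
    (inv_speed q * (langer_z q * langer_d q / e ^ 4 * AiN (cmp_X e q))).
Proof.
  intros He Hp. assert (Hr := langer_R_pos q Hp).
  replace (inv_speed q * (langer_z q * langer_d q / e ^ 4 * AiN (cmp_X e q)))
    with (langer_d q / (2 * langer_R q ^ 2) / e ^ 2 * (cmp_X e q * AiN (cmp_X e q))).
  - apply (is_derive_comp AiN' (cmp_X e)); [apply is_derive_AiN'|].
    unfold cmp_X, Rdiv. apply (is_derive_ext (fun q => / e ^ 2 * langer_z q)); [intros; apply Rmult_comm|].
    rewrite (Rmult_comm _ (/ e ^ 2)).
    apply (is_derive_scal langer_z q (/ e ^ 2)). apply is_derive_langer_z; auto.
  - unfold inv_speed, cmp_X. field. lra.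
Qed.

Lemma is_derive_cmp_m1 (r e q : R) : 0 < e -> series_pos q ->
  is_derive (cmp_m1 r e) q (inv_speed q * cmp_p1 r e q).
Proof.
  intros He Hp.
  assert (D := is_derive_multR _ _ _ _ _ (is_derive_amp_a r q Hp) (is_derive_cmp_A e q He Hp)).
  refine (is_derive_conv _ _ _ _ _ D (fun _ => eq_refl) _).
  unfold cmp_p1. field. lra.
Qed.

Lemma is_derive_cmp_m2 (r e q : R) : 0 < e -> series_pos q ->
  is_derive (cmp_m2 r e) q (inv_speed q * cmp_p2 r e q).
Proof.
  intros He Hp.
  assert (D := is_derive_scal _ _ e _ (is_derive_multR _ _ _ _ _ (is_derive_amp_b r q Hp) (is_derive_cmp_A' e q He Hp))).
  refine (is_derive_conv _ _ _ _ _ D (fun _ => eq_refl) _).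
  unfold cmp_p2. unfold mult; simpl. field. lra.
Qed.

(** The AiN' terms match -4 r / e^3 times the imaginary part by the transport equation 2 a_1 d + a
    d_1 = 4 r b, where d is [langer_d] and the index 1 marks derivatives in ln cosh mu. The residue
    a_2 AiN carries no negative power of e. *)
Lemma is_derive_cmp_p1 (r e q : R) : 0 < e -> series_pos q ->
  is_derive (cmp_p1 r e) q (inv_speed q *
    (- 4 * cmp_T q / e ^ 6 * cmp_m1 r e q - 4 * r / e ^ 3 * cmp_m2 r e q
      + amp_a2 r q * AiN (cmp_X e q))).
Proof.
  intros He Hp. assert (Hr := langer_R_pos q Hp). assert (Hh := langer_H_pos q).
  assert (D1 := is_derive_multR _ _ _ _ _ (is_derive_amp_a1 r q Hp) (is_derive_cmp_A e q He Hp)).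
  assert (D2 := is_derive_multR _ _ _ _ _ (is_derive_amp_a r q Hp) (is_derive_langer_d q Hp)).
  assert (D3 := is_derive_scal _ _ (/ e ^ 2) _ (is_derive_multR _ _ _ _ _ D2 (is_derive_cmp_A' e q He Hp))).
  assert (D := is_derive_minus _ _ _ _ _ D1 D3).
  refine (is_derive_conv _ _ _ _ _ D _ _).
  { intros u. unfold cmp_p1, minus, plus, opp, scal, mult; simpl. unfold mult; simpl. field. lra. }
  unfold minus, plus, opp, scal, mult; simpl. unfold mult; simpl.
  assert (ET : 4 * cmp_T q = langer_z q * langer_d q ^ 2).
  { rewrite langer_zd2 by auto. unfold cmp_T. ring. }
  replace (- 4 * cmp_T q) with (- (langer_z q * langer_d q ^ 2)) by lra.
  unfold cmp_m1, cmp_m2, amp_a, amp_a1, amp_b, inv_speed, langer_d.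
  generalize (AiN (cmp_X e q)) (AiN' (cmp_X e q)) (amp_a2 r q) (langer_z q)
    (chq (r ^ 2 * q)) (shq (r ^ 2 * q)) (langer_lR q) (langer_lH q).
  intros. simpl. field. lra.
Qed.

(** Here the transport equation is 2 b_1 z d + b (z d)_1 = 4 r a. It relates shq and phq to chq at
    r^2 q, so chq is first eliminated by [chq_shq_phq]. *)
Lemma is_derive_cmp_p2 (r e q : R) : 0 < e -> series_pos q ->
  is_derive (cmp_p2 r e) q (inv_speed q *
    (- 4 * cmp_T q / e ^ 6 * cmp_m2 r e q + 4 * r / e ^ 3 * cmp_m1 r e q
      + e * (amp_b2 r q * AiN' (cmp_X e q)))).
Proof.
  intros He Hp. assert (Hr := langer_R_pos q Hp). assert (Hh := langer_H_pos q).
  assert (D1 := is_derive_multR _ _ _ _ _ (is_derive_amp_b1 r q Hp) (is_derive_cmp_A' e q He Hp)).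
  assert (Dz : is_derive langer_z q (langer_H q ^ 4 * (1 + 4 * q * langer_lH q))).
  { assert (D := is_derive_langer_H q Hp). unfold langer_z.
    auto_derive; [eexists; eauto|]. rewrite_Derive D. ring. }
  assert (D2 := is_derive_multR _ _ _ _ _ Dz (is_derive_langer_d q Hp)).
  assert (D3 := is_derive_multR _ _ _ _ _ (is_derive_amp_b r q Hp) D2).
  assert (D4 := is_derive_scal _ _ (/ e ^ 4) _ (is_derive_multR _ _ _ _ _ D3 (is_derive_cmp_A e q He Hp))).
  assert (D := is_derive_scal _ _ e _ (is_derive_plus _ _ _ _ _ D1 D4)).
  refine (is_derive_conv _ _ _ _ _ D _ _).
  { intros u. unfold cmp_p2, plus, scal, mult; simpl. unfold mult; simpl. field. lra. }
  unfold plus, scal, mult; simpl. unfold mult; simpl.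
  assert (ET : 4 * cmp_T q = langer_z q * langer_d q ^ 2).
  { rewrite langer_zd2 by auto. unfold cmp_T. ring. }
  replace (- 4 * cmp_T q) with (- (langer_z q * langer_d q ^ 2)) by lra.
  assert (EC : chq (r ^ 2 * q) = shq (r ^ 2 * q) + r ^ 2 * q * phq (r ^ 2 * q)) by apply chq_shq_phq.
  unfold cmp_m1, cmp_m2, amp_a, amp_b1, amp_b, inv_speed, langer_d, langer_z. rewrite EC.
  generalize (AiN (cmp_X e q)) (AiN' (cmp_X e q)) (amp_b2 r q)
    (phq (r ^ 2 * q)) (shq (r ^ 2 * q)) (langer_lR q) (langer_lH q).
  intros. simpl. field. lra.
Qed.

(** * The normalized Bessel function along y = t / cosh mu, t fixed *)

Definition bessel_nu (r e : R) : C := (r, 2 / e ^ 3).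

(** With this factor K_nu is pi e exp(i nu pi / 2) times [nb0], and [nb0] starts at Ai(0) to leading
    order. *)
Definition norm_const (r e : R) : C :=
  Cmult (RtoC (/ (2 * PI * e))) (Cexp (Copp (Cmult (Cmult Ci (bessel_nu r e)) (RtoC (PI / 2))))).

Definition nb0 (r e q : R) : C :=
  Cmult (norm_const r e) (bessel_moment 0 (bessel_nu r e) (2 / e ^ 3 / chq q)).
(** Since y = t / cosh mu, the derivative in ln cosh mu is -y d/dy, which turns the moment of index
    0 into y times that of index 1. *)
Definition nb1 (r e q : R) : C :=
  Cmult (norm_const r e) (Cmult (RtoC (2 / e ^ 3 / chq q))
    (bessel_moment 1 (bessel_nu r e) (2 / e ^ 3 / chq q))).

Lemma dC_comp (f : R -> C) (g : R -> R) (x b : R) (a : C) :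
  dC f (g x) a -> is_derive g x b -> dC (fun u => f (g u)) x (Cmult (RtoC b) a).
Proof.
  intros [H1 H2] Hg. split.
  - replace (Re (Cmult (RtoC b) a)) with (b * Re a) by (unfold Re; simpl; ring).
    apply (is_derive_comp (fun u => Re (f u)) g); auto.
  - replace (Im (Cmult (RtoC b) a)) with (b * Im a) by (unfold Im; simpl; ring).
    apply (is_derive_comp (fun u => Im (f u)) g); auto.
Qed.

Lemma inv_speed_eq (q : R) : series_pos q -> inv_speed q = shq q / (2 * chq q).
Proof.
  intros Hp. unfold inv_speed. rewrite langer_R2 by auto. destruct Hp as [H1 [H2 _]]. field. lra.
Qed.

Lemma is_derive_y (t q : R) : series_pos q ->
  is_derive (fun q => t / chq q) q (- inv_speed q * (t / chq q)).
Proof.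
  intros Hp. rewrite inv_speed_eq by auto. destruct Hp as [H1 [H2 _]].
  assert (D := is_derive_chq q). auto_derive.
  - repeat split; [eexists; eauto | lra].
  - rewrite_Derive D. field. lra.
Qed.

Lemma dC_nb0 (r e q : R) : 0 < e -> series_pos q ->
  dC (nb0 r e) q (Cmult (RtoC (inv_speed q)) (nb1 r e q)).
Proof.
  intros He Hp.
  assert (Hy : 0 < 2 / e ^ 3 / chq q).
  { apply Rdiv_lt_0_compat; [apply Rdiv_lt_0_compat; [lra | apply pow_lt; auto] | apply Hp]. }
  unfold nb0, nb1. eapply dC_eq.
  - apply dC_scal.
    apply (dC_comp (bessel_moment 0 (bessel_nu r e)) (fun q => 2 / e ^ 3 / chq q) q).
    + apply bessel_moment_derive; auto.
    + apply is_derive_y; auto.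
  - generalize (bessel_moment 1 (bessel_nu r e) (2 / e ^ 3 / chq q)) (2 / e ^ 3 / chq q) (inv_speed q)
      (norm_const r e). intros. rewrite !RtoC_mult, RtoC_opp'. ring.
Qed.

(** In the logarithmic variable the first-order term of the Bessel equation disappears; this is
    [bessel_moment_rec] multiplied by [norm_const]. *)
Lemma dC_nb1 (r e q : R) : 0 < e -> series_pos q ->
  dC (nb1 r e) q (Cmult (RtoC (inv_speed q))
    (Cmult (Cplus (RtoC ((2 / e ^ 3 / chq q) ^ 2)) (Cmult (bessel_nu r e) (bessel_nu r e))) (nb0 r e q))).
Proof.
  intros He Hp.
  assert (Hy : 0 < 2 / e ^ 3 / chq q).
  { apply Rdiv_lt_0_compat; [apply Rdiv_lt_0_compat; [lra | apply pow_lt; auto] | apply Hp]. }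
  assert (Hrec := bessel_moment_rec (bessel_nu r e) _ Hy).
  unfold nb0, nb1. eapply dC_eq.
  - apply dC_scal. apply dC_mult.
    + apply dC_real. apply (is_derive_y (2 / e ^ 3) q Hp).
    + apply (dC_comp (bessel_moment 1 (bessel_nu r e)) (fun q => 2 / e ^ 3 / chq q) q).
      * apply bessel_moment_derive; auto.
      * apply is_derive_y; auto.
  - cbv beta. revert Hrec.
    change (S 1) with 2%nat.
    generalize (2 / e ^ 3 / chq q) (inv_speed q) (norm_const r e) (bessel_nu r e).
    intros y s c nu Hrec.
    transitivity (Cmult c (Cmult (RtoC s) (Cminus (Cmult (RtoC (y ^ 2)) (bessel_moment 2 nu y))
      (Cmult (RtoC y) (bessel_moment 1 nu y))))).
    + rewrite !RtoC_mult, RtoC_opp', RtoC_pow. ring.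
    + rewrite Hrec. ring.
Qed.

(** * Initial data at mu = 0 *)

Definition kap (r : R) : R := r / 15 - r ^ 3 / 6.

Lemma bessel_integral_norm (j : nat) (r e : R) : 0 < e <= 1 ->
  Cmult (norm_const r e) (bessel_moment j (bessel_nu r e) (2 / e ^ 3)) =
  Cmult (RtoC (/ (2 * PI)))
    (cint (fun s => Cmult (Cpow (Cmult Ci (Csh (scaled e s))) j) (bessel_integrand r e s))).
Proof.
  intros He. unfold bessel_nu. rewrite bessel_moment_scaled by auto.
  unfold norm_const, bessel_nu.
  generalize (cint (fun s => Cmult (Cpow (Cmult Ci (Csh (scaled e s))) j) (bessel_integrand r e s))).
  intros I. set (w := Cmult (Cmult Ci (r, 2 / e ^ 3)) (RtoC (PI / 2))).
  transitivity (Cmult (Cmult (RtoC (/ (2 * PI * e) * e)) (Cmult (Cexp (Copp w)) (Cexp w))) I).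
  - rewrite RtoC_mult. ring.
  - rewrite <- Cexp_plus. replace (Cplus (Copp w) w) with (RtoC 0) by ring. rewrite Cexp_0.
    replace (/ (2 * PI * e) * e) with (/ (2 * PI)) by (field; split; [lra | apply PI_neq0]). ring.
Qed.

Lemma langer_logs_0 : langer_lH 0 = - / 15 /\ langer_lR 0 = / 6.
Proof.
  unfold langer_lH, langer_lR. rewrite phq1_0, phq_0, chq_0, shq_0. split; field.
Qed.

Lemma amp_0 (r : R) : amp_a r 0 = 1 /\ amp_b r 0 = r /\ amp_a1 r 0 = r ^ 2 + / 5 /\
  amp_b1 r 0 = 7 / 15 * r + r ^ 3 / 3 /\ langer_d 0 = 2 /\ langer_z 0 = 0.
Proof.
  destruct langer_logs_0 as [E1 E2].
  unfold amp_a, amp_b, amp_a1, amp_b1, langer_d, langer_z.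
  rewrite !Rmult_0_r, langer_H_0, langer_R_0, E1, E2, chq_0, shq_0, phq_0.
  repeat split; field.
Qed.

Lemma Cmod_parts (z : C) (a b : R) : Rabs (Re z) <= a -> Rabs (Im z) <= b -> Cmod z <= a + b.
Proof. intros. eapply Rle_trans; [apply Cmod_le|]. lra. Qed.

Definition cmp_W0 (r e q : R) : C :=
  Cmult (1, e ^ 3 * kap r) (cmp_m1 r e q, cmp_m2 r e q).
Definition cmp_W1 (r e q : R) : C :=
  Cmult (1, e ^ 3 * kap r) (cmp_p1 r e q, cmp_p2 r e q).

Lemma Rabs_prod_le (c A B : R) : Rabs c <= A -> 0 <= B -> Rabs (c * B) <= A * B.
Proof. intros. rewrite Rabs_mult, (Rabs_pos_eq B) by auto. apply Rmult_le_compat_r; auto. Qed.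

Lemma kap_bound (M r : R) : Rabs r <= M -> Rabs (kap r) <= M + M ^ 3.
Proof.
  intros Hr. unfold kap.
  assert (Rabs (r ^ 3) <= M ^ 3).
  { rewrite <- RPow_abs. apply pow_incr. split; [apply Rabs_pos | auto]. }
  assert (0 <= Rabs (r ^ 3)) by apply Rabs_pos. assert (0 <= Rabs r) by apply Rabs_pos.
  revert Hr H H0 H1. unfold Rabs; repeat destruct Rcase_abs; intros; lra.
Qed.

(** The e^3 terms of [main0] and of [main1] are both matched by the factor 1 + i e^3 [kap]. The
    derivative is known only to e^2 because y sinh(e v) puts 1 / e^2 in front of an expansion with
    error e^4; squared, these are the orders that [energy_estimate] asks for. *)
Lemma initial_data (M : R) : 0 <= M -> exists K, 0 <= K /\
  forall r e, Rabs r <= M -> 0 < e <= 1 ->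
  Cmod (Cminus (nb0 r e 0) (cmp_W0 r e 0)) <= K * e ^ 4 /\
  Cmod (Cminus (nb1 r e 0) (cmp_W1 r e 0)) <= K * e ^ 2.
Proof.
  intros HM.
  destruct (integral_expansion_0 M HM) as [K0 [HK0 H0]].
  destruct (integral_expansion_1 M HM) as [K1 [HK1 H1]].
  set (U := (M + M ^ 3) * (M + M ^ 3 + 1)).
  assert (HU : 0 <= M ^ 3) by (apply pow_le; auto).
  assert (HU' : 0 <= U) by (unfold U; nra).
  (* [D] bounds the products of [kap] with the data of the comparison function, the surplus created
     by the factor: order e^4 in the value, order e^3 in the derivative. *)
  set (D := (Rabs (Ai 0) + Rabs (Ai' 0)) * ((M + M ^ 3) * (M ^ 3 + M ^ 2 + M + 1))).
  assert (HA : 0 <= Rabs (Ai 0) /\ 0 <= Rabs (Ai' 0)) by (split; apply Rabs_pos).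
  assert (HD : 0 <= D).
  { unfold D. assert (0 <= M ^ 2) by apply pow2_ge_0. repeat apply Rmult_le_pos; lra. }
  exists (K0 + K1 + 2 * D). split; [lra|].
  intros r e Hr He. specialize (H0 r e Hr He). destruct (H1 r e Hr He) as [Hdom H1']. clear H1.
  assert (HP : 1 < PI / 2) by (generalize PI2_3_2; lra).
  assert (Hk := kap_bound M r Hr).
  assert (He4 : 0 < e ^ 4) by (apply pow_lt; lra).
  assert (He3 : 0 < e ^ 3) by (apply pow_lt; lra).
  assert (He2 : 0 < e ^ 2) by (apply pow_lt; lra).
  assert (He42 : e ^ 4 <= e ^ 2).
  { replace (e ^ 4) with (e ^ 2 * e ^ 2) by ring. assert (e ^ 2 <= 1) by (rewrite <- (pow1 2); apply pow_incr; lra). nra. }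
  destruct (amp_0 r) as [A1 [A2 [A3 [A4 [A5 A6]]]]].
  assert (AX : AiN (cmp_X e 0) = Ai 0 /\ AiN' (cmp_X e 0) = Ai' 0).
  { unfold AiN, AiN', cmp_X. rewrite A6. replace (- (0 / e ^ 2)) with 0 by (field; lra). auto. }
  destruct AX as [X1 X2].
  assert (HP2 : Rabs (/ (2 * PI)) <= 1).
  { rewrite Rabs_pos_eq by (apply Rlt_le, Rinv_0_lt_compat; lra).
    rewrite <- Rinv_1. apply Rinv_le_contravar; lra. }
  assert (HM2 : 0 <= M ^ 2) by apply pow2_ge_0.
  assert (Hr2 : r ^ 2 <= M ^ 2).
  { rewrite <- (pow2_abs r). apply pow_incr. split; [apply Rabs_pos | auto]. }
  assert (Hr2' : 0 <= r ^ 2) by apply pow2_ge_0.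
  assert (HD1 : forall c u, (u = Ai 0 \/ u = Ai' 0) -> Rabs c <= (M ^ 3 + M ^ 2 + M + 1) -> Rabs (kap r * c * u) <= D).
  { intros c u Hu Hc. rewrite !Rabs_mult. unfold D. rewrite (Rmult_comm (_ + _)).
    assert (0 <= Rabs (kap r)) by apply Rabs_pos. assert (0 <= Rabs c) by apply Rabs_pos.
    apply Rmult_le_compat; [apply Rmult_le_pos; auto | apply Rabs_pos | |].
    - apply Rmult_le_compat; lra.
    - destruct Hu; subst u; lra. }
  split.
  - unfold nb0. rewrite chq_0, Rdiv_1_r, bessel_integral_norm by auto.
    rewrite (cint_ext _ (bessel_integrand r e)) by (intros; simpl; ring).
    set (I := cint (bessel_integrand r e)) in *.
    replace (Cminus (Cmult (RtoC (/ (2 * PI))) I) (cmp_W0 r e 0)) with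
      (Cplus (Cmult (RtoC (/ (2 * PI))) (Cminus I (main0 r e)))
        (RtoC (kap r * r * Ai' 0 * e ^ 4))).
    + eapply Rle_trans; [apply Cmod_triangle|]. rewrite Cmod_mult, !Cmod_R.
      assert (Rabs (/ (2 * PI)) * Cmod (Cminus I (main0 r e)) <= K0 * e ^ 4).
      { generalize (Cmod_ge_0 (Cminus I (main0 r e))) (Rabs_pos (/ (2 * PI))). nra. }
      assert (Rabs (kap r * r * Ai' 0 * e ^ 4) <= D * e ^ 4).
      { apply Rabs_prod_le; [|lra]. apply HD1; [auto | lra]. }
      nra.
    + unfold main0, cmp_W0, cmp_m1, cmp_m2. rewrite A1, A2, X1, X2, airy_moment_0, airy_moment_1.
      unfold kap. generalize (Ai 0) (Ai' 0). intros a b. destruct I as [i1 i2].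
      apply Ceq; unfold Re, Im; simpl; field; apply PI_neq0.
  - unfold nb1. rewrite chq_0, Rdiv_1_r.
    rewrite Cmult_assoc, (Cmult_comm (norm_const r e)), <- Cmult_assoc, bessel_integral_norm by auto.
    rewrite (cint_ext _ (fun s => Cmult (Cmult Ci (RtoC e))
       (Cmult (Cmult (RtoC (/ e)) (Csh (scaled e s))) (bessel_integrand r e s)))).
    2:{ intros s. simpl. transitivity (Cmult (RtoC (e * / e)) (Cmult (Cmult Ci (Csh (scaled e s))) (bessel_integrand r e s))).
        - rewrite Rinv_r by lra. ring.
        - rewrite RtoC_mult. ring. }
    rewrite cint_scal by exact Hdom.
    set (I := cint (fun s => Cmult (Cmult (RtoC (/ e)) (Csh (scaled e s))) (bessel_integrand r e s))) in *.
    replace (Cminus _ (cmp_W1 r e 0)) with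
      (Cplus (Cmult (Cmult Ci (RtoC (/ PI * / e ^ 2))) (Cminus I (main1 r e)))
        (kap r * (7 / 15 * r + r ^ 3 / 3) * Ai' 0 * e ^ 4, - (kap r * (r ^ 2 + / 5) * Ai 0 * e ^ 3))).
    + eapply Rle_trans; [apply Cmod_triangle|]. rewrite !Cmod_mult, Cmod_Ci, Cmod_R, Rmult_1_l.
      assert (HPi : 0 < / PI <= 1).
      { split; [apply Rinv_0_lt_compat; lra|]. rewrite <- Rinv_1. apply Rinv_le_contravar; lra. }
      assert (B1 : Rabs (/ PI * / e ^ 2) * Cmod (Cminus I (main1 r e)) <= K1 * e ^ 2).
      { assert (0 < / e ^ 2) by (apply Rinv_0_lt_compat; auto).
        rewrite Rabs_pos_eq by (apply Rmult_le_pos; lra).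
        apply Rle_trans with (1 * / e ^ 2 * (K1 * e ^ 4)).
        - apply Rmult_le_compat; [apply Rmult_le_pos; lra | apply Cmod_ge_0 | | exact H1'].
          apply Rmult_le_compat_r; lra.
        - right. field. lra. }
      assert (Hr3 : Rabs (r ^ 3) <= M ^ 3).
      { rewrite <- RPow_abs. apply pow_incr. split; [apply Rabs_pos | auto]. }
      assert (C1 : Rabs (7 / 15 * r + r ^ 3 / 3) <= M ^ 3 + M ^ 2 + M + 1).
      { apply Rabs_le_between in Hr. apply Rabs_le_between in Hr3. apply Rabs_le. lra. }
      assert (C2 : Rabs (r ^ 2 + / 5) <= M ^ 3 + M ^ 2 + M + 1) by (rewrite Rabs_pos_eq; lra).
      assert (B2 := HD1 _ (Ai' 0) ltac:(auto) C1). assert (B3 := HD1 _ (Ai 0) ltac:(auto) C2).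
      apply (Rabs_prod_le _ _ (e ^ 4)) in B2; [|lra]. apply (Rabs_prod_le _ _ (e ^ 3)) in B3; [|lra].
      assert (He32 : e ^ 3 <= e ^ 2).
      { replace (e ^ 3) with (e * e ^ 2) by ring. nra. }
      assert (B4 : Cmod (kap r * (7 / 15 * r + r ^ 3 / 3) * Ai' 0 * e ^ 4,
         - (kap r * (r ^ 2 + / 5) * Ai 0 * e ^ 3)) <= D * e ^ 4 + D * e ^ 3).
      { apply Cmod_parts; unfold Re, Im; cbn [fst snd]; [exact B2 | rewrite Rabs_Ropp; exact B3]. }
      assert (D * e ^ 4 <= D * e ^ 2) by (apply Rmult_le_compat_l; lra).
      assert (D * e ^ 3 <= D * e ^ 2) by (apply Rmult_le_compat_l; lra).
      assert (0 <= K0 * e ^ 2) by (apply Rmult_le_pos; lra). lra.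
    + unfold main1, cmp_W1, cmp_p1, cmp_p2. rewrite A1, A2, A3, A4, A5, A6, X1, X2, airy_moment_0, airy_moment_1.
      unfold kap. generalize (Ai 0) (Ai' 0). intros a b. destruct I as [i1 i2].
      apply Ceq; unfold Re, Im; simpl; field; split; try lra; apply PI_neq0.
Qed.

Lemma sq_le (a b : R) : 0 <= b -> a ^ 2 <= b ^ 2 -> a <= b.
Proof. intros Hb H. destruct (Rle_dec a b); auto. nra. Qed.

(** The energy estimate is applied to the difference from 1 + i e^3 [kap] times the comparison
    function, and the lower bound of [Airy_envelope] converts its result. *)
Lemma Airy_comparison (M : R) : 0 <= M -> exists q0 K, 0 < q0 <= 1 /\ 0 <= K /\
  forall r e q, Rabs r <= M -> 0 < e <= 1 -> 0 <= q <= q0 -> series_pos q /\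
  Cmod (Cminus (nb0 r e q) (cmp_m1 r e q, cmp_m2 r e q))
    <= K * (e ^ 3 * Rabs (AiN (cmp_X e q)) + e ^ 4 * Rabs (AiN' (cmp_X e q))).
Proof.
  intros HM.
  destruct (amp_bounds M) as [d1 [B [Hd1 [HB Hamp]]]].
  destruct series_near as [d2 [Hd2 Hnear]].
  destruct Airy_envelope as [c [Ke [Hc [HKe Henv]]]].
  destruct (initial_data M HM) as [K0 [HK0 Hini]].
  set (k0 := M + M ^ 3).
  assert (Hk0 : 0 <= k0) by (unfold k0; assert (0 <= M ^ 3) by (apply pow_le; auto); lra).
  set (B1 := (M ^ 2 + 1) * (1 + k0) * B).
  assert (HM2 : 0 <= M ^ 2) by apply pow2_ge_0.
  assert (HB1 : 0 <= B1) by (unfold B1; repeat apply Rmult_le_pos; lra).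
  set (Bt := 16 * B1 ^ 2 * Ke + K0 ^ 2).
  assert (HB12 : 0 <= B1 ^ 2 * Ke) by (apply Rmult_le_pos; [apply pow2_ge_0 | lra]).
  assert (HBt : 0 <= Bt) by (unfold Bt; generalize (pow2_ge_0 K0); lra).
  destruct (energy_estimate M Bt HBt) as [Kn [HKn Hen]].
  set (K3 := 6 * Kn / c + 1).
  assert (HK3 : 1 <= K3).
  { unfold K3. enough (0 <= 6 * Kn / c) by lra.
    apply Rmult_le_pos; [lra | apply Rlt_le, Rinv_0_lt_compat; auto]. }
  set (q0 := Rmin d1 d2 / 2).
  assert (Hq0 : 0 < Rmin d1 d2) by (apply Rmin_pos; lra).
  assert (Hq1 : q0 < d1) by (unfold q0; generalize (Rmin_l d1 d2); lra).
  assert (Hq2 : q0 < d2) by (unfold q0; generalize (Rmin_r d1 d2); lra).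
  exists q0, (K3 + k0 * B). split; [unfold q0 in *; lra|].
  split; [assert (0 <= k0 * B) by (apply Rmult_le_pos; auto); lra|].
  intros r e q Hr He Hq.
  assert (Hpos : forall x, 0 <= x <= q0 -> series_pos x /\ chq x <= 6 / 5 /\ / 2 <= langer_H x ^ 4 <= 2).
  { intros x Hx. apply Hnear. rewrite Rabs_pos_eq; lra. }
  split; [apply Hpos; auto|].
  assert (He2 : 0 < e ^ 2) by (apply pow_lt; lra).
  assert (He3 : 0 < e ^ 3) by (apply pow_lt; lra).
  assert (He3' : e ^ 3 <= 1) by (rewrite <- (pow1 3); apply pow_incr; lra).
  assert (He2' : e ^ 2 <= 1) by (rewrite <- (pow1 2); apply pow_incr; lra).
  assert (Hk := kap_bound M r Hr). fold k0 in Hk.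
  assert (Hr2 : 0 <= r ^ 2 <= M ^ 2).
  { split; [apply pow2_ge_0|]. rewrite <- (pow2_abs r). apply pow_incr. split; [apply Rabs_pos | auto]. }
  set (k := e ^ 3 * kap r).
  assert (Hkk : Rabs k <= e ^ 3 * k0).
  { unfold k. rewrite Rabs_mult, (Rabs_pos_eq (e ^ 3)) by lra. apply Rmult_le_compat_l; lra. }
  assert (Hkk1 : Rabs k <= k0) by nra.
  set (A := fun x => AiN (cmp_X e x)). set (A' := fun x => AiN' (cmp_X e x)).
  (* The equation in [energy_estimate] contains r^2, that of the comparison function does not; hence
     r^2 times the comparison function joins the residues a_2 and b_2 in the source. *)
  set (s1 := fun x => r ^ 2 * (cmp_m1 r e x - k * cmp_m2 r e x) - amp_a2 r x * A x + k * (e * (amp_b2 r x * A' x))).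
  set (s2 := fun x => r ^ 2 * (cmp_m2 r e x + k * cmp_m1 r e x) - e * (amp_b2 r x * A' x) - k * (amp_a2 r x * A x)).
  assert (HXz : forall x, 0 <= x <= q0 -> x / (2 * e ^ 2) <= cmp_X e x <= 2 * x / e ^ 2).
  { intros x Hx. destruct (Hpos x Hx) as [_ [_ HH]]. unfold cmp_X, langer_z. split.
    - replace (x / (2 * e ^ 2)) with (x * / 2 / e ^ 2) by (field; lra).
      apply Rmult_le_compat_r; [apply Rlt_le, Rinv_0_lt_compat; auto|]. apply Rmult_le_compat_l; lra.
    - apply Rmult_le_compat_r; [apply Rlt_le, Rinv_0_lt_compat; auto|]. rewrite Rmult_comm.
      apply Rmult_le_compat_r; lra. }
  assert (HX0 : forall x, 0 <= x <= q0 -> 0 <= cmp_X e x).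
  { intros x Hx. eapply Rle_trans; [|apply HXz; auto].
    apply Rmult_le_pos; [lra | apply Rlt_le, Rinv_0_lt_compat; lra]. }
  assert (Hmb : forall x, 0 <= x <= q0 ->
     Rabs (cmp_m1 r e x) <= B * Rabs (A x) /\ Rabs (cmp_m2 r e x) <= B * (e * Rabs (A' x)) /\
     Rabs (amp_a2 r x * A x) <= B * Rabs (A x) /\ Rabs (e * (amp_b2 r x * A' x)) <= B * (e * Rabs (A' x))).
  { intros x Hx. destruct (Hamp r x Hr ltac:(rewrite Rabs_pos_eq; lra)) as [H1 [H2 [H3 H4]]].
    unfold cmp_m1, cmp_m2. fold (A x) (A' x).
    rewrite !Rabs_mult, (Rabs_pos_eq e) by lra.
    generalize (Rabs_pos (A x)) (Rabs_pos (A' x)). intros P1 P2.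
    repeat split; try (apply Rmult_le_compat_r; auto).
    - replace (B * (e * Rabs (A' x))) with (e * (B * Rabs (A' x))) by ring.
      apply Rmult_le_compat_l; [lra|]. apply Rmult_le_compat_r; auto.
    - replace (B * (e * Rabs (A' x))) with (e * (B * Rabs (A' x))) by ring.
      apply Rmult_le_compat_l; [lra|]. apply Rmult_le_compat_r; auto. }
  assert (Hsb : forall x, 0 <= x <= q0 ->
     s1 x ^ 2 + s2 x ^ 2 <= 4 * B1 ^ 2 * (A x ^ 2 + e ^ 2 * A' x ^ 2)).
  { intros x Hx. destruct (Hmb x Hx) as [H1 [H2 [H3 H4]]].
    set (u := Rabs (A x) + e * Rabs (A' x)).
    assert (P1 : 0 <= Rabs (A x)) by apply Rabs_pos.
    assert (P2 : 0 <= e * Rabs (A' x)) by (apply Rmult_le_pos; [lra | apply Rabs_pos]).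
    assert (Hu : 0 <= u) by (unfold u; lra).
    assert (HBA : 0 <= B * Rabs (A x)) by (apply Rmult_le_pos; auto).
    assert (HBA' : 0 <= B * (e * Rabs (A' x))) by (apply Rmult_le_pos; auto).
    assert (Hkm : forall v w, 0 <= w -> Rabs v <= w -> Rabs (k * v) <= k0 * w).
    { intros v w Hw Hv. rewrite Rabs_mult. apply Rmult_le_compat; auto; apply Rabs_pos. }
    assert (Hrm : forall v w, 0 <= w -> Rabs v <= w -> Rabs (r ^ 2 * v) <= M ^ 2 * w).
    { intros v w Hw Hv. rewrite Rabs_mult, (Rabs_pos_eq (r ^ 2)) by lra.
      apply Rmult_le_compat; try lra. apply Rabs_pos. }
    assert (K1 := Hkm _ _ HBA H1). assert (K2 := Hkm _ _ HBA' H2).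
    assert (K4 := Hkm _ _ HBA H3). assert (K5 := Hkm _ _ HBA' H4).
    assert (S1 : Rabs (s1 x) <= B1 * u).
    { assert (R1 : Rabs (cmp_m1 r e x - k * cmp_m2 r e x) <= B * Rabs (A x) + k0 * (B * (e * Rabs (A' x)))).
      { eapply Rle_trans; [apply Rabs_triang|]. rewrite Rabs_Ropp. lra. }
      apply Hrm in R1; [|assert (0 <= k0 * (B * (e * Rabs (A' x)))) by (apply Rmult_le_pos; auto); lra].
      unfold s1. eapply Rle_trans; [apply Rabs_triang|].
      eapply Rle_trans; [apply Rplus_le_compat_r, Rabs_triang|]. rewrite Rabs_Ropp.
      apply Rle_trans with ((M ^ 2 + 1) * (B * Rabs (A x) + k0 * (B * (e * Rabs (A' x))))); [lra|].
      unfold B1, u. rewrite !Rmult_assoc. apply Rmult_le_compat_l; [lra|].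
      assert (0 <= k0 * (B * Rabs (A x))) by (apply Rmult_le_pos; auto). lra. }
    assert (S2 : Rabs (s2 x) <= B1 * u).
    { assert (R1 : Rabs (cmp_m2 r e x + k * cmp_m1 r e x) <= B * (e * Rabs (A' x)) + k0 * (B * Rabs (A x))).
      { eapply Rle_trans; [apply Rabs_triang|]. lra. }
      apply Hrm in R1; [|assert (0 <= k0 * (B * Rabs (A x))) by (apply Rmult_le_pos; auto); lra].
      unfold s2. eapply Rle_trans; [apply Rabs_triang|].
      eapply Rle_trans; [apply Rplus_le_compat_r, Rabs_triang|]. rewrite !Rabs_Ropp.
      apply Rle_trans with ((M ^ 2 + 1) * (B * (e * Rabs (A' x)) + k0 * (B * Rabs (A x)))); [lra|].
      unfold B1, u. rewrite !Rmult_assoc. apply Rmult_le_compat_l; [lra|].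
      assert (0 <= k0 * (B * (e * Rabs (A' x)))) by (apply Rmult_le_pos; auto). lra. }
    assert (Hu2 : u ^ 2 <= 2 * (A x ^ 2 + e ^ 2 * A' x ^ 2)).
    { unfold u. rewrite <- (pow2_abs (A x)), <- (pow2_abs (A' x)).
      generalize (Rabs (A x)) (Rabs (A' x)). intros a b.
      assert (0 <= (a - e * b) ^ 2) by apply pow2_ge_0. nra. }
    assert (T1 : s1 x ^ 2 <= (B1 * u) ^ 2) by (rewrite <- pow2_abs; apply pow_incr; split; [apply Rabs_pos | auto]).
    assert (T2 : s2 x ^ 2 <= (B1 * u) ^ 2) by (rewrite <- pow2_abs; apply pow_incr; split; [apply Rabs_pos | auto]).
    assert (B1 ^ 2 * u ^ 2 <= B1 ^ 2 * (2 * (A x ^ 2 + e ^ 2 * A' x ^ 2)))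
      by (apply Rmult_le_compat_l; [apply pow2_ge_0 | auto]).
    rewrite Rpow_mult_distr in T1, T2. lra. }
  assert (HE : forall x, 0 <= x <= q0 ->
    (Re (nb0 r e x) - (cmp_m1 r e x - k * cmp_m2 r e x)) ^ 2
    + (Im (nb0 r e x) - (cmp_m2 r e x + k * cmp_m1 r e x)) ^ 2 <= Kn * e ^ 8 * sqrt (1 + x / e ^ 2)).
  { intros x Hx.
    refine (Hen q0 r e (fun x => Re (nb0 r e x) - (cmp_m1 r e x - k * cmp_m2 r e x))
      (fun x => Im (nb0 r e x) - (cmp_m2 r e x + k * cmp_m1 r e x))
      (fun x => Re (nb1 r e x) - (cmp_p1 r e x - k * cmp_p2 r e x))
      (fun x => Im (nb1 r e x) - (cmp_p2 r e x + k * cmp_p1 r e x))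
      s1 s2 cmp_T cmp_T1 inv_speed Hr He _ _ _ _ _ x Hx); clear x Hx.
    - unfold q0 in *; lra.
    - intros x Hx. destruct (Hpos x Hx) as [Px [Cx Hx4]].
      destruct (cmp_T_bounds x Px (proj1 Hx) Cx) as [T1 [T2 [T3 T4]]].
      destruct (dC_nb0 r e x (proj1 He) Px) as [N1 N2].
      destruct (dC_nb1 r e x (proj1 He) Px) as [N3 N4].
      assert (M1 := is_derive_cmp_m1 r e x (proj1 He) Px).
      assert (M2 := is_derive_cmp_m2 r e x (proj1 He) Px).
      assert (M3 := is_derive_cmp_p1 r e x (proj1 He) Px).
      assert (M4 := is_derive_cmp_p2 r e x (proj1 He) Px).
      assert (ET : (2 / e ^ 3 / chq x) ^ 2 = 4 / e ^ 6 - 4 * cmp_T x / e ^ 6).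
      { rewrite T3. destruct Px as [P1 _]. field. lra. }
      rewrite ET in N3, N4. clear ET.
      refine (conj _ (conj _ (conj _ (conj _ (conj _ (conj _ (conj _ (conj _ _)))))))).
      + refine (is_derive_conv _ _ _ _ _ (is_derive_minus _ _ _ _ _ N1
          (is_derive_minus _ _ _ _ _ M1 (is_derive_scal _ _ k _ M2))) (fun _ => eq_refl) _).
        unfold minus, plus, opp, scal, Re, Im; simpl; unfold mult; simpl. ring.
      + refine (is_derive_conv _ _ _ _ _ (is_derive_minus _ _ _ _ _ N2
          (is_derive_plus _ _ _ _ _ M2 (is_derive_scal _ _ k _ M1))) (fun _ => eq_refl) _).
        unfold minus, plus, opp, scal, Re, Im; simpl; unfold mult; simpl. ring.
      + refine (is_derive_conv _ _ _ _ _ (is_derive_minus _ _ _ _ _ N3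
          (is_derive_minus _ _ _ _ _ M3 (is_derive_scal _ _ k _ M4))) (fun _ => eq_refl) _).
        unfold s1, A, A', bessel_nu. unfold minus, plus, opp, scal, Re, Im; simpl; unfold mult; simpl. field. split; [lra | apply PI_neq0].
      + refine (is_derive_conv _ _ _ _ _ (is_derive_minus _ _ _ _ _ N4
          (is_derive_plus _ _ _ _ _ M4 (is_derive_scal _ _ k _ M3))) (fun _ => eq_refl) _).
        unfold s2, A, A', bessel_nu. unfold minus, plus, opp, scal, Re, Im; simpl; unfold mult; simpl. field. split; [lra | apply PI_neq0].
      + apply is_derive_cmp_T; auto.
      + exact T2.
      + exact T4.
      + exact T1.
      + eapply Rle_trans; [apply (Hsb x Hx)|].
        destruct (Henv _ (HX0 x Hx)) as [V1 [V2 _]]. fold (A x) in V1. fold (A' x) in V2.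
        assert (HX := HXz x Hx). set (X := cmp_X e x) in *.
        assert (Hs1 : 1 <= sqrt (1 + X)) by (apply sqrt_ge_1; generalize (HX0 x Hx); fold X; lra).
        assert (Hs2 : sqrt (1 + X) * sqrt (1 + X) = 1 + X) by (apply sqrt_sqrt; generalize (HX0 x Hx); fold X; lra).
        assert (HeX : e ^ 2 * (1 + X) <= 3).
        { assert (e ^ 2 * X <= 2 * x).
          { replace (2 * x) with (e ^ 2 * (2 * x / e ^ 2)) by (field; lra). apply Rmult_le_compat_l; lra. }
          unfold q0 in *. lra. }
        assert (W1 : A x ^ 2 <= Ke) by (generalize (pow2_ge_0 (A x)); nra).
        assert (W2 : e ^ 2 * A' x ^ 2 <= 3 * Ke).
        { apply Rle_trans with (e ^ 2 * (Ke * (1 + X))).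
          - apply Rmult_le_compat_l; [lra|]. eapply Rle_trans; [apply V2|]. apply Rmult_le_compat_l; nra.
          - nra. }
        unfold Bt. assert (4 * B1 ^ 2 * (A x ^ 2 + e ^ 2 * A' x ^ 2) <= 4 * B1 ^ 2 * (4 * Ke)).
        { apply Rmult_le_compat_l; [generalize (pow2_ge_0 B1); lra | lra]. }
        generalize (pow2_ge_0 K0). lra.
    (* Here X is comparable to rho^4 / e^2, so AiN^2 is of order e / rho^2, and e^2 AiN'^2 of order
       e rho^2, which is no larger because rho <= 1. *)
    - intros rho Hrho Herho Hrq. set (x := rho ^ 4) in *.
      assert (Hx : 0 <= x <= q0) by (split; [unfold x; apply pow_le; lra | auto]).
      assert (Hp2 : 0 < rho ^ 2) by (apply pow_lt; auto).
      assert (Hxr : x = rho ^ 2 * rho ^ 2) by (unfold x; ring).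
      apply Rle_trans with (4 * B1 ^ 2 * (A x ^ 2 + e ^ 2 * A' x ^ 2) * rho ^ 2).
      { apply Rmult_le_compat_r; [lra | apply (Hsb x Hx)]. }
      destruct (Henv _ (HX0 x Hx)) as [V1 [V2 _]]. fold (A x) in V1. fold (A' x) in V2.
      assert (HX := HXz x Hx). assert (HX0' := HX0 x Hx). set (X := cmp_X e x) in *.
      assert (Hs0 : 0 <= sqrt (1 + X)) by apply sqrt_pos.
      assert (Hs2 : sqrt (1 + X) ^ 2 = 1 + X) by (apply pow2_sqrt; lra).
      assert (L1 : rho ^ 2 / (2 * e) <= sqrt (1 + X)).
      { apply sq_le; auto. rewrite Hs2.
        apply Rle_trans with (x / (2 * e ^ 2)); [|lra].
        replace ((rho ^ 2 / (2 * e)) ^ 2) with (/ 2 * (x / (2 * e ^ 2))) by (rewrite Hxr; field; lra).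
        assert (0 <= x / (2 * e ^ 2)) by (apply Rmult_le_pos; [lra | apply Rlt_le, Rinv_0_lt_compat; lra]). lra. }
      assert (L2 : sqrt (1 + X) <= 2 * (rho ^ 2 / e)).
      { assert (0 < rho ^ 2 / e) by (apply Rdiv_lt_0_compat; lra).
        apply sq_le; [lra|]. rewrite Hs2.
        replace ((2 * (rho ^ 2 / e)) ^ 2) with (2 * (2 * x / e ^ 2)) by (rewrite Hxr; field; lra).
        assert (1 <= 2 * x / e ^ 2).
        { apply Rmult_le_reg_r with (e ^ 2); auto. unfold Rdiv. rewrite Rmult_assoc, Rinv_l by lra. nra. }
        lra. }
      assert (W1 : A x ^ 2 * rho ^ 2 <= 2 * Ke * e).
      { replace (rho ^ 2) with (2 * e * (rho ^ 2 / (2 * e))) by (field; lra).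
        assert (A x ^ 2 * (rho ^ 2 / (2 * e)) <= A x ^ 2 * sqrt (1 + X)) by (apply Rmult_le_compat_l; [apply pow2_ge_0 | auto]).
        nra. }
      assert (W2 : e ^ 2 * A' x ^ 2 * rho ^ 2 <= 2 * Ke * e).
      { apply Rle_trans with (e ^ 2 * (Ke * (2 * (rho ^ 2 / e))) * rho ^ 2).
        - apply Rmult_le_compat_r; [lra|]. apply Rmult_le_compat_l; [lra|].
          eapply Rle_trans; [apply V2|]. apply Rmult_le_compat_l; lra.
        - replace (e ^ 2 * (Ke * (2 * (rho ^ 2 / e))) * rho ^ 2) with (2 * Ke * e * x) by (rewrite Hxr; field; lra).
          rewrite <- (Rmult_1_r (2 * Ke * e)) at 2. apply Rmult_le_compat_l; [|unfold q0 in *; lra].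
          apply Rmult_le_pos; lra. }
      unfold Bt.
      assert (4 * B1 ^ 2 * (A x ^ 2 * rho ^ 2 + e ^ 2 * A' x ^ 2 * rho ^ 2) <= 4 * B1 ^ 2 * (4 * Ke * e)).
      { apply Rmult_le_compat_l; [generalize (pow2_ge_0 B1); lra | lra]. }
      assert (0 <= K0 ^ 2 * e) by (apply Rmult_le_pos; [apply pow2_ge_0 | lra]). lra.
    - destruct (Hini r e Hr He) as [I1 _].
      set (z := Cminus (nb0 r e 0) (cmp_W0 r e 0)) in *.
      assert (EI : Re z ^ 2 + Im z ^ 2 <= (K0 * e ^ 4) ^ 2).
      { rewrite <- Cmod2_alt. apply pow_incr. split; [apply Cmod_ge_0 | auto]. }
      apply Rle_trans with (Re z ^ 2 + Im z ^ 2).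
      + right. unfold z, cmp_W0, k. unfold Re, Im; simpl. ring.
      + eapply Rle_trans; [apply EI|]. replace ((K0 * e ^ 4) ^ 2) with (K0 ^ 2 * e ^ 8) by ring.
        apply Rmult_le_compat_r; [apply pow_le; lra|]. unfold Bt. lra.
    - destruct (Hini r e Hr He) as [_ I1].
      set (z := Cminus (nb1 r e 0) (cmp_W1 r e 0)) in *.
      assert (EI : Re z ^ 2 + Im z ^ 2 <= (K0 * e ^ 2) ^ 2).
      { rewrite <- Cmod2_alt. apply pow_incr. split; [apply Cmod_ge_0 | auto]. }
      apply Rle_trans with (Re z ^ 2 + Im z ^ 2).
      + right. unfold z, cmp_W1, k. unfold Re, Im; simpl. ring.
      + eapply Rle_trans; [apply EI|]. replace ((K0 * e ^ 2) ^ 2) with (K0 ^ 2 * e ^ 4) by ring.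
        apply Rmult_le_compat_r; [apply pow_le; lra|]. unfold Bt. lra. }
  specialize (HE q Hq).
  set (z := (Re (nb0 r e q) - (cmp_m1 r e q - k * cmp_m2 r e q),
     Im (nb0 r e q) - (cmp_m2 r e q + k * cmp_m1 r e q)) : C).
  destruct (Hmb q Hq) as [H1 [H2 _]].
  fold (A q) (A' q).
  assert (P1 : 0 <= Rabs (A q)) by apply Rabs_pos.
  assert (P2 : 0 <= Rabs (A' q)) by apply Rabs_pos.
  assert (Hz : Cmod z <= K3 * (e ^ 3 * Rabs (A q) + e ^ 4 * Rabs (A' q))).
  { assert (Q1 : 0 <= e ^ 3 * Rabs (A q)) by (apply Rmult_le_pos; lra).
    assert (Q2 : 0 <= e ^ 4 * Rabs (A' q)) by (apply Rmult_le_pos; [apply pow_le; lra | auto]).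
    apply sq_le; [apply Rmult_le_pos; lra|].
    rewrite Cmod2_alt.
    (* The envelope trades sqrt(1 + X) for (1 + X) AiN^2 + AiN'^2, and e^2 (1 + X) <= 3 lowers e^8
       (1 + X) to 3 e^6. The constant 6 is this 3 times the 2 lost in comparing q / e^2 with X. *)
    apply Rle_trans with (6 * Kn / c * (e ^ 6 * A q ^ 2 + e ^ 8 * A' q ^ 2)).
    - eapply Rle_trans; [exact HE|].
      destruct (Henv _ (HX0 q Hq)) as [_ [_ V3]]. fold (A q) (A' q) in V3.
      assert (HX := HXz q Hq). assert (HX0' := HX0 q Hq). set (X := cmp_X e q) in *.
      assert (Hs0 : 0 <= sqrt (1 + X)) by apply sqrt_pos.
      assert (L : sqrt (1 + q / e ^ 2) <= 2 * sqrt (1 + X)).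
      { replace (q / e ^ 2) with (2 * (q / (2 * e ^ 2))) by (field; lra).
        assert (0 <= q / (2 * e ^ 2)) by (apply Rmult_le_pos; [lra | apply Rlt_le, Rinv_0_lt_compat; lra]).
        apply sq_le; [lra|]. rewrite Rpow_mult_distr, !pow2_sqrt by lra. lra. }
      assert (HeX : e ^ 2 * (1 + X) <= 3).
      { assert (e ^ 2 * X <= 2 * q).
        { replace (2 * q) with (e ^ 2 * (2 * q / e ^ 2)) by (field; lra). apply Rmult_le_compat_l; lra. }
        unfold q0 in *. lra. }
      assert (He8 : 0 <= e ^ 8) by (apply pow_le; lra).
      apply Rle_trans with (Kn * e ^ 8 * (2 / c * ((1 + X) * A q ^ 2 + A' q ^ 2))).
      + apply Rmult_le_compat_l; [apply Rmult_le_pos; auto|].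
        eapply Rle_trans; [apply L|].
        replace (2 * sqrt (1 + X)) with (2 / c * (c * sqrt (1 + X))) by (field; lra).
        apply Rmult_le_compat_l; [apply Rlt_le, Rdiv_lt_0_compat; lra | auto].
      + replace (Kn * e ^ 8 * (2 / c * ((1 + X) * A q ^ 2 + A' q ^ 2)))
          with (2 * Kn / c * (e ^ 6 * A q ^ 2 * (e ^ 2 * (1 + X)) + e ^ 8 * A' q ^ 2)) by (field; lra).
        replace (6 * Kn / c * (e ^ 6 * A q ^ 2 + e ^ 8 * A' q ^ 2))
          with (2 * Kn / c * (e ^ 6 * A q ^ 2 * 3 + 3 * (e ^ 8 * A' q ^ 2))) by (field; lra).
        apply Rmult_le_compat_l.
        { apply Rmult_le_pos; [lra | apply Rlt_le, Rinv_0_lt_compat; auto]. }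
        assert (0 <= e ^ 8 * A' q ^ 2) by (apply Rmult_le_pos; [auto | apply pow2_ge_0]).
        assert (0 <= e ^ 6 * A q ^ 2) by (apply Rmult_le_pos; [apply pow_le; lra | apply pow2_ge_0]).
        assert (e ^ 6 * A q ^ 2 * (e ^ 2 * (1 + X)) <= e ^ 6 * A q ^ 2 * 3) by (apply Rmult_le_compat_l; auto).
        lra.
    - rewrite <- (pow2_abs (A q)), <- (pow2_abs (A' q)).
      replace (e ^ 6 * Rabs (A q) ^ 2 + e ^ 8 * Rabs (A' q) ^ 2)
        with ((e ^ 3 * Rabs (A q)) ^ 2 + (e ^ 4 * Rabs (A' q)) ^ 2) by ring.
      revert Q1 Q2. generalize (e ^ 3 * Rabs (A q)) (e ^ 4 * Rabs (A' q)). intros a b Ha Hb.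
      replace (6 * Kn / c) with (K3 - 1) by (unfold K3; ring).
      assert (0 <= a ^ 2) by apply pow2_ge_0. assert (0 <= b ^ 2) by apply pow2_ge_0.
      assert (0 <= a * b) by (apply Rmult_le_pos; auto).
      apply Rle_trans with (K3 ^ 2 * (a ^ 2 + b ^ 2)).
      + apply Rmult_le_compat_r; nra.
      + replace ((K3 * (a + b)) ^ 2) with (K3 ^ 2 * (a ^ 2 + b ^ 2 + 2 * (a * b))) by ring.
        apply Rmult_le_compat_l; [apply pow2_ge_0 | lra]. }
  (* Dropping the factor 1 + i k adds i k times the comparison function, with |k| <= k0 e^3. *)
  replace (Cminus (nb0 r e q) (cmp_m1 r e q, cmp_m2 r e q)) with
    (Cplus z (Cmult (0, k) (cmp_m1 r e q, cmp_m2 r e q)))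
    by (unfold z; apply Ceq; unfold Re, Im; simpl; ring).
  eapply Rle_trans; [apply Cmod_triangle|]. rewrite Cmod_mult.
  assert (Ck : Cmod (0, k) <= e ^ 3 * k0).
  { replace ((0, k) : C) with (Cmult Ci (RtoC k)) by (apply Ceq; simpl; ring).
    rewrite Cmod_mult, Cmod_Ci, Cmod_R, Rmult_1_l. auto. }
  assert (Cm : Cmod (cmp_m1 r e q, cmp_m2 r e q) <= B * Rabs (A q) + B * (e * Rabs (A' q)))
    by (apply Cmod_parts; auto).
  assert (Cmod (0, k) * Cmod (cmp_m1 r e q, cmp_m2 r e q)
    <= e ^ 3 * k0 * (B * Rabs (A q) + B * (e * Rabs (A' q))))
    by (apply Rmult_le_compat; auto; apply Cmod_ge_0).
  rewrite Rmult_plus_distr_r.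
  replace (k0 * B * (e ^ 3 * Rabs (A q) + e ^ 4 * Rabs (A' q)))
    with (e ^ 3 * k0 * (B * Rabs (A q) + B * (e * Rabs (A' q)))) by ring.
  lra.
Qed.

(** * Identification of the coefficients *)

Lemma pow_inj_pos (n : nat) (a b : R) : 0 <= a -> 0 <= b -> a ^ S n = b ^ S n -> a = b.
Proof.
  intros Ha Hb H. destruct (Rtotal_order a b) as [Hlt|[He|Hgt]]; auto; exfalso.
  - assert (a ^ S n < b ^ S n); [|lra]. simpl.
    apply Rle_lt_trans with (a * b ^ n).
    + apply Rmult_le_compat_l; auto. apply pow_incr; lra.
    + apply Rmult_lt_compat_r; auto. apply pow_lt; lra.
  - assert (b ^ S n < a ^ S n); [|lra]. simpl.
    apply Rle_lt_trans with (b * a ^ n).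
    + apply Rmult_le_compat_l; auto. apply pow_incr; lra.
    + apply Rmult_lt_compat_r; auto. apply pow_lt; lra.
Qed.

Lemma Rpower_pow_nat (x a : R) (n : nat) : Rpower x a ^ n = Rpower x (INR n * a).
Proof.
  unfold Rpower. rewrite exp_INR_mult. f_equal. ring.
Qed.

Lemma rpow_nonneg (x a : R) : 0 <= rpow x a.
Proof. unfold rpow. destruct (Rlt_dec 0 x); [apply Rlt_le, exp_pos | lra]. Qed.

(** The ratio of e to y^(-1/3) when 2 / e^3 = y cosh mu. *)
Definition langer_omega (q : R) : R := Rpower (2 / chq q) (1 / 3).

Lemma langer_omega_pos (q : R) : 0 < langer_omega q.
Proof. apply exp_pos. Qed.

Lemma langer_omega3 (q : R) : series_pos q -> langer_omega q ^ 3 = 2 / chq q.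
Proof.
  intros [H _]. unfold langer_omega. rewrite Rpower_pow_nat.
  replace (INR 3 * (1 / 3)) with 1 by (simpl; field).
  apply Rpower_1, Rdiv_lt_0_compat; lra.
Qed.

Lemma zeta_nonpos (mu : R) : zeta mu <= 0.
Proof. unfold zeta. generalize (rpow_nonneg (3 / 2 * (mu * cosh mu - sinh mu)) (2 / 3)). lra. Qed.

Lemma zeta_base (mu : R) :
  3 / 2 * (mu * cosh mu - sinh mu) = 3 / 2 * (mu ^ 3 * phq (mu ^ 2)).
Proof. rewrite cosh_chq, sinh_shq, chq_shq_phq. ring. Qed.

(** This links the two parametrizations: with e = omega y^(-1/3) it says y^(2/3) zeta = -z / e^2. At
    mu = 0 both sides vanish, on the left by the case distinction in [rpow]. *)
Lemma zeta_eq (mu : R) : 0 <= mu -> series_pos (mu ^ 2) ->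
  zeta mu = - (mu * langer_H (mu ^ 2) ^ 2 / langer_omega (mu ^ 2)) ^ 2.
Proof.
  intros Hmu Hp. unfold zeta. f_equal. rewrite zeta_base.
  assert (Ho := langer_omega_pos (mu ^ 2)). assert (Ho3 := langer_omega3 _ Hp).
  assert (HH := langer_H_pos (mu ^ 2)). assert (HH6 := langer_H6 _ Hp).
  destruct Hp as [H1 [H2 H3]].
  destruct (Req_dec mu 0) as [->|Hn].
  - unfold rpow. destruct Rlt_dec as [r|r].
    + exfalso. replace (0 ^ 3) with 0 in r by ring. lra.
    + field. lra.
  - assert (Hm : 0 < mu) by lra.
    assert (Hx : 0 < 3 / 2 * (mu ^ 3 * phq (mu ^ 2))).
    { apply Rmult_lt_0_compat; [lra|]. apply Rmult_lt_0_compat; auto. apply pow_lt; auto. }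
    unfold rpow. destruct Rlt_dec as [r|r]; [|contradiction].
    (* The index 2 stands for third powers. *)
    apply (pow_inj_pos 2); [apply Rlt_le, exp_pos | apply pow2_ge_0 |].
    rewrite Rpower_pow_nat. replace (INR 3 * (2 / 3)) with (INR 2) by (simpl; field).
    rewrite Rpower_pow by auto.
    replace (((mu * langer_H (mu ^ 2) ^ 2 / langer_omega (mu ^ 2)) ^ 2) ^ 3)
      with (mu ^ 6 * (langer_H (mu ^ 2) ^ 6) ^ 2 / (langer_omega (mu ^ 2) ^ 3) ^ 2) by (field; lra).
    rewrite HH6, Ho3. field. lra.
Qed.

Definition coef_root_fun (q : R) : R := langer_omega q * langer_R q * langer_H q / sqrt 2.
Definition coef_sinh_fun (r q : R) : R := r * shq (r ^ 2 * q) * langer_omega q / langer_H q ^ 2.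

(** Both sides are positive, and their fourth powers agree by the closed forms of omega^3 and
    R^2. *)
Lemma coef_root_pos (mu : R) : 0 < mu -> series_pos (mu ^ 2) ->
  rpow (zeta mu / - (sinh mu) ^ 2) (1 / 4) = coef_root_fun (mu ^ 2).
Proof.
  intros Hm Hp. rewrite zeta_eq by (auto; lra).
  assert (Ho := langer_omega_pos (mu ^ 2)). assert (Ho3 := langer_omega3 _ Hp).
  assert (HH := langer_H_pos (mu ^ 2)).
  assert (HR := langer_R_pos _ Hp). assert (HR2 := langer_R2 _ Hp).
  assert (Hs2 : 0 < sqrt 2) by (apply sqrt_lt_R0; lra).
  assert (Hs22 : sqrt 2 ^ 2 = 2) by (apply pow2_sqrt; lra).
  destruct Hp as [H1 [H2 H3]].
  rewrite sinh_shq.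
  replace (- (mu * langer_H (mu ^ 2) ^ 2 / langer_omega (mu ^ 2)) ^ 2 / - (mu * shq (mu ^ 2)) ^ 2)
    with ((langer_H (mu ^ 2) ^ 2 / (langer_omega (mu ^ 2) * shq (mu ^ 2))) ^ 2)
    by (field; lra).
  assert (Hx : 0 < (langer_H (mu ^ 2) ^ 2 / (langer_omega (mu ^ 2) * shq (mu ^ 2))) ^ 2).
  { apply pow_lt, Rdiv_lt_0_compat; [apply pow_lt; auto | apply Rmult_lt_0_compat; auto]. }
  unfold rpow. destruct Rlt_dec as [l|l]; [|contradiction].
  assert (Hg : 0 < coef_root_fun (mu ^ 2)).
  { unfold coef_root_fun. apply Rdiv_lt_0_compat; auto. repeat apply Rmult_lt_0_compat; auto. }
  apply (pow_inj_pos 3); [apply Rlt_le, exp_pos | lra |].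
  rewrite Rpower_pow_nat. replace (INR 4 * (1 / 4)) with 1 by (simpl; field).
  rewrite Rpower_1 by auto. unfold coef_root_fun.
  replace ((langer_omega (mu ^ 2) * langer_R (mu ^ 2) * langer_H (mu ^ 2) / sqrt 2) ^ 4)
    with ((langer_omega (mu ^ 2) ^ 3) ^ 2 / langer_omega (mu ^ 2) ^ 2 * (langer_R (mu ^ 2) ^ 2) ^ 2
       * langer_H (mu ^ 2) ^ 4 / (sqrt 2 ^ 2) ^ 2) by (field; lra).
  rewrite HR2, Hs22, Ho3. field. lra.
Qed.

(** The factor -i is 1 / i from the principal square root; it turns the minus sign of the Ai' term
    into the + i e b of the comparison function. *)
Lemma coef_sinh_pos (r mu : R) : 0 < mu -> series_pos (mu ^ 2) ->
  Cdiv (RtoC (sinh (r * mu))) (zeta_sqrt mu) = (0, - coef_sinh_fun r (mu ^ 2)).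
Proof.
  intros Hm Hp. unfold zeta_sqrt. rewrite zeta_eq by (auto; lra).
  assert (Ho := langer_omega_pos (mu ^ 2)). assert (HH := langer_H_pos (mu ^ 2)).
  rewrite Rabs_Ropp, (Rabs_pos_eq (_ ^ 2)) by apply pow2_ge_0.
  assert (Hp2 : 0 < mu * langer_H (mu ^ 2) ^ 2 / langer_omega (mu ^ 2)).
  { apply Rdiv_lt_0_compat; auto. apply Rmult_lt_0_compat; auto. apply pow_lt; auto. }
  rewrite sqrt_pow2 by lra. rewrite sinh_shq.
  replace ((r * mu) ^ 2) with (r ^ 2 * mu ^ 2) by ring.
  unfold coef_sinh_fun.
  set (v := mu * langer_H (mu ^ 2) ^ 2 / langer_omega (mu ^ 2)) in *.
  replace (r * shq (r ^ 2 * mu ^ 2) * langer_omega (mu ^ 2) / langer_H (mu ^ 2) ^ 2)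
    with (r * mu * shq (r ^ 2 * mu ^ 2) / v) by (unfold v; field; lra).
  generalize (r * mu * shq (r ^ 2 * mu ^ 2)). intros u.
  apply Ceq; unfold Re, Im, Cdiv, Cinv, Cmult, RtoC, Ci; simpl; field; lra.
Qed.

Lemma continuous_sqr_0 (f : R -> R) : continuous f 0 ->
  filterlim (fun m => f (m ^ 2)) (at_right 0) (locally (f 0)).
Proof.
  intros H.
  assert (Hc : continuous (fun m => f (m ^ 2)) 0).
  { apply (continuous_comp (fun m => m ^ 2) f).
    - apply (cont_of_derive (fun m => m ^ 2) 0 (INR 2 * 1 * 0 ^ 1)). auto_derive; trivial. simpl; ring.
    - replace (0 ^ 2) with 0 by ring. exact H. }
  unfold continuous in Hc. replace (0 ^ 2) with 0 in Hc by ring.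
  eapply filterlim_filter_le_1; [|exact Hc].
  intros P [d Hd]. exists d. intros y Hy _. apply Hd; auto.
Qed.

Lemma continuous_langer (r : R) :
  continuous coef_root_fun 0 /\ continuous (coef_sinh_fun r) 0.
Proof.
  assert (P0 := series_pos_0).
  assert (D1 := is_derive_langer_R 0 P0). assert (D2 := is_derive_langer_H 0 P0).
  assert (D3 := is_derive_chq 0). assert (D4 := is_derive_shq (r ^ 2 * 0)).
  assert (H0 := langer_H_pos 0).
  assert (D5 : exists l, is_derive langer_omega 0 l).
  { unfold langer_omega, Rpower. eexists. auto_derive; [|reflexivity].
    rewrite chq_0. repeat split; try lra. eexists; eauto. }
  destruct D5 as [l D5].
  split; eapply cont_of_derive.
  - unfold coef_root_fun. auto_derive; [|reflexivity]. repeat split; eexists; eauto.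
  - unfold coef_sinh_fun. auto_derive; [|reflexivity].
    cbn [pow] in D4. repeat split; try (eexists; eauto). nra.
Qed.

(** At mu = 0 the coefficient is a limit from the right; it is identified by the formula in q =
    mu^2, which is continuous there and valid for small positive mu. *)
Lemma coef_root_eq (mu0 mu : R) : 0 < mu0 ->
  (forall m, 0 <= m <= mu0 -> series_pos (m ^ 2)) -> 0 <= mu <= mu0 ->
  coef_root mu = coef_root_fun (mu ^ 2).
Proof.
  intros H0 Hp Hmu. unfold coef_root, limit_at_0. destruct Req_EM_T as [->|Hn].
  - replace (0 ^ 2) with 0 by ring.
    apply (iota_filterlim_locally (V := R_CompleteNormedModule)).
    apply (filterlim_ext_loc (fun m => coef_root_fun (m ^ 2))).
    + exists (mkposreal mu0 H0). intros y Hy Hy0. symmetry. apply coef_root_pos; auto.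
      apply Hp. apply Rabs_def2 in Hy. unfold minus, plus, opp in Hy; simpl in Hy. lra.
    + apply continuous_sqr_0, (continuous_langer 0).
  - apply coef_root_pos; [lra|]. apply Hp; auto.
Qed.

Lemma coef_sinh_eq (r mu0 mu : R) : 0 < mu0 ->
  (forall m, 0 <= m <= mu0 -> series_pos (m ^ 2)) -> 0 <= mu <= mu0 ->
  coef_sinh r mu = (0, - coef_sinh_fun r (mu ^ 2)).
Proof.
  intros H0 Hp Hmu. unfold coef_sinh, limit_at_0. destruct Req_EM_T as [->|Hn].
  - replace (0 ^ 2) with 0 by ring.
    refine (iota_filterlim_locally (V := C_R_CompleteNormedModule) (F := at_right 0) _
       ((0, - coef_sinh_fun r 0) : C_R_CompleteNormedModule) _).
    apply (filterlim_ext_loc (fun m => (0, - coef_sinh_fun r (m ^ 2)))).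
    + exists (mkposreal mu0 H0). intros y Hy Hy0. symmetry. apply coef_sinh_pos; auto.
      apply Hp. apply Rabs_def2 in Hy. unfold minus, plus, opp in Hy; simpl in Hy. lra.
    + assert (L := continuous_sqr_0 _ (proj2 (continuous_langer r))).
      intros P [eps HP].
      generalize (L (ball (coef_sinh_fun r 0) eps) (locally_ball _ _)).
      unfold filtermap. apply filter_imp. intros m Hm. apply HP. split; simpl.
      * apply ball_center.
      * change (Rabs (- coef_sinh_fun r (m ^ 2) - - coef_sinh_fun r 0) < eps).
        change (Rabs (coef_sinh_fun r (m ^ 2) - coef_sinh_fun r 0) < eps) in Hm.
        rewrite <- Rabs_Ropp. replace (- _) with (coef_sinh_fun r (m ^ 2) - coef_sinh_fun r 0) by ring.
        exact Hm.
  - apply coef_sinh_pos; [lra|]. apply Hp; auto.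
Qed.

(** The error is divided in the proportion |a| : |b|, so each part inherits its own bound; if a and
    b both vanish, so does the error. *)
Lemma split_error (Err : C) (a b c : R) : 0 <= c ->
  Cmod Err <= c * (Rabs a + Rabs b) ->
  exists E1 E2 : C, Err = Cplus E1 E2 /\ Cmod E1 <= c * Rabs a /\ Cmod E2 <= c * Rabs b.
Proof.
  intros Hc H. assert (Ha := Rabs_pos a). assert (Hb := Rabs_pos b).
  destruct (Req_dec (Rabs a + Rabs b) 0) as [E|E].
  - exists Err, (RtoC 0). rewrite Cmod_0, E, Rmult_0_r in *.
    split; [ring|]. split; [|apply Rmult_le_pos; auto].
    apply Rle_trans with 0; [auto | apply Rmult_le_pos; auto].
  - assert (Hs : 0 < Rabs a + Rabs b) by lra.
    assert (Hsi : 0 < / (Rabs a + Rabs b)) by (apply Rinv_0_lt_compat; auto).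
    exists (Cmult (RtoC (Rabs a / (Rabs a + Rabs b))) Err), (Cmult (RtoC (Rabs b / (Rabs a + Rabs b))) Err).
    split.
    + rewrite <- Cmult_plus_distr_r, <- RtoC_plus.
      replace (Rabs a / (Rabs a + Rabs b) + Rabs b / (Rabs a + Rabs b)) with 1 by (field; lra). ring.
    + assert (Hx : forall x, 0 <= x -> x / (Rabs a + Rabs b) * Cmod Err <= c * x).
      { intros x Hx. replace (c * x) with (x / (Rabs a + Rabs b) * (c * (Rabs a + Rabs b))) by (field; lra).
        apply Rmult_le_compat_l; auto. apply Rmult_le_pos; lra. }
      split; rewrite Cmod_mult, Cmod_R, Rabs_pos_eq; auto; apply Rmult_le_pos; lra.
Qed.

Lemma BesselK_norm (r e y : R) : 0 < e -> 0 < y ->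
  forall q, series_pos q -> y = 2 / e ^ 3 / chq q ->
  BesselK (bessel_nu r e) y =
  Cmult (Cmult (RtoC (PI * e)) (Cexp (Cmult (Cmult Ci (bessel_nu r e)) (RtoC (PI / 2))))) (nb0 r e q).
Proof.
  intros He Hy q Hp E. rewrite BesselK_eq by auto. unfold nb0, norm_const. rewrite <- E.
  generalize (bessel_moment 0 (bessel_nu r e) y). intros b.
  set (w := Cmult (Cmult Ci (bessel_nu r e)) (RtoC (PI / 2))).
  transitivity (Cmult (Cmult (RtoC (PI * e * / (2 * PI * e))) (Cmult (Cexp w) (Cexp (Copp w)))) b).
  - rewrite <- Cexp_plus. replace (Cplus w (Copp w)) with (RtoC 0) by ring. rewrite Cexp_0.
    replace (PI * e * / (2 * PI * e)) with (/ 2) by (field; split; [lra | apply PI_neq0]). ring.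
  - rewrite RtoC_mult. ring.
Qed.

Theorem theorem1p6 :
  forall M : R, 0 <= M ->
  exists mu0 : R, 0 < mu0 /\
  (forall mu : R, 0 <= mu <= mu0 -> zeta mu <= 0) /\
  exists (c Y : R), 0 < c /\ 0 < Y /\
  forall (mu r y t : R) (nu : C),
    0 <= mu <= mu0 -> Rabs r <= M -> 0 < y -> Y <= y ->
    t = y * cosh mu ->
    nu = Cplus (RtoC r) (Cmult Ci (RtoC t)) ->
    exists E1 E2 : C,
      BesselK nu y
        = Cplus (Cplus (Cminus (main_Ai r mu y) (main_Ai' r mu y)) E1) E2 /\
      Cmod E1 <= c * Rabs (err_Ai mu y) /\
      Cmod E2 <= c * Rabs (err_Ai' mu y).
Proof.
  intros M HM. destruct (Airy_comparison M HM) as [q0 [K [Hq0 [HK Hcmp]]]].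
  assert (Hmu0 : 0 < sqrt q0) by (apply sqrt_lt_R0; lra).
  assert (Hmq : forall m, 0 <= m <= sqrt q0 -> 0 <= m ^ 2 <= q0).
  { intros m Hm. split; [apply pow2_ge_0|]. rewrite <- (pow2_sqrt q0) by lra. apply pow_incr; lra. }
  assert (Hser : forall m, 0 <= m <= sqrt q0 -> series_pos (m ^ 2)).
  { intros m Hm. apply (Hcmp 0 1 (m ^ 2)); [rewrite Rabs_R0; auto | lra | auto]. }
  exists (sqrt q0). split; auto. split; [intros; apply zeta_nonpos|].
  (* Y = 2 ensures e^3 = 2 / (y cosh mu) <= 1. In the constant, pi K comes from the normalization
     and 32 = 2^5 from omega <= 2 in the bounds of e^4 and e^5; the added 1 makes it positive even
     if K = 0. *)
  exists (PI * K * 32 + 1), 2.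
  assert (HPI : 0 < PI) by apply PI_RGT_0.
  assert (HPK : 0 <= PI * K) by (apply Rmult_le_pos; lra).
  split; [lra|]. split; [lra|].
  intros mu r y t nu Hmu Hr Hy HY Ht Hnu.
  set (q := mu ^ 2). assert (Hq := Hmq mu Hmu). assert (Hp := Hser mu Hmu). fold q in Hq, Hp.
  assert (HC := chq_ge_1 q (proj1 Hq)).
  set (u := Rpower y (1 / 3)).
  assert (Hu : 0 < u) by apply exp_pos.
  (* All fractional powers of y become integer powers of u = y^(1/3), which makes the remaining
     identities rational. *)
  assert (Hpw : forall n a, INR n = 3 * a -> Rpower y a = u ^ n).
  { intros n a Ha. unfold u. rewrite Rpower_pow_nat. f_equal. lra. }
  assert (Hu3 : u ^ 3 = y).
  { rewrite <- (Hpw 3%nat 1) by (simpl; lra). apply Rpower_1; auto. }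
  assert (Hu2 : Rpower y (2 / 3) = u ^ 2) by (apply Hpw; simpl; lra).
  assert (Hu4 : Rpower y (4 / 3) = u ^ 4) by (apply Hpw; simpl; lra).
  assert (Hu5 : Rpower y (5 / 3) = u ^ 5) by (apply Hpw; simpl; lra).
  assert (Ho := langer_omega_pos q). assert (Ho3 := langer_omega3 q Hp).
  assert (HH := langer_H_pos q). assert (HR := langer_R_pos q Hp).
  set (w := langer_omega q) in *.
  (* This choice gives 2 / e^3 = y cosh mu = t. *)
  set (e := w / u).
  assert (He : 0 < e) by (apply Rdiv_lt_0_compat; auto).
  assert (He3 : e ^ 3 = 2 / (y * chq q)).
  { unfold e. replace ((w / u) ^ 3) with (w ^ 3 / u ^ 3) by (field; lra). rewrite Ho3, Hu3. field. lra. }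
  assert (Htq : t = y * chq q) by (rewrite Ht, cosh_chq; auto).
  assert (Het : 2 / e ^ 3 = t) by (rewrite He3, Htq; field; lra).
  assert (He1 : e <= 1).
  { destruct (Rle_dec e 1) as [l|l]; auto. exfalso.
    assert (1 < e ^ 3) by (rewrite <- (pow1 3); apply Rlt_le_trans with (e * 1 ^ 2); [simpl; lra|];
      replace (e ^ 3) with (e * e ^ 2) by ring; apply Rmult_le_compat_l; [lra | apply pow_incr; lra]).
    assert (2 / (y * chq q) <= 1).
    { apply Rmult_le_reg_r with (y * chq q); [nra|]. unfold Rdiv. rewrite Rmult_assoc, Rinv_l by nra. nra. }
    lra. }
  assert (Hw : w <= 2).
  { destruct (Rle_dec w 2) as [l|l]; auto. exfalso.
    assert (2 ^ 3 <= w ^ 3) by (apply pow_incr; lra).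
    assert (2 / chq q <= 2).
    { apply Rmult_le_reg_r with (chq q); [lra|]. unfold Rdiv. rewrite Rmult_assoc, Rinv_l by lra. lra. }
    lra. }
  assert (Enu : nu = bessel_nu r e).
  { rewrite Hnu. unfold bessel_nu. rewrite Het. apply Ceq; unfold Re, Im; simpl; ring. }
  assert (EX : Rpower y (2 / 3) * zeta mu = - cmp_X e q).
  { rewrite Hu2, zeta_eq by (auto; apply Hmu). fold q. fold w. unfold cmp_X, langer_z, e, q. field. lra. }
  assert (EA : Ai (Rpower y (2 / 3) * zeta mu) = AiN (cmp_X e q)) by (rewrite EX; reflexivity).
  assert (EA' : Ai' (Rpower y (2 / 3) * zeta mu) = AiN' (cmp_X e q)) by (rewrite EX; reflexivity).
  set (EF := exp_factor r mu y).
  assert (EEF : Cexp (Cmult (Cmult Ci (bessel_nu r e)) (RtoC (PI / 2))) = EF).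
  { unfold EF, exp_factor, bessel_nu. rewrite Het, Ht. f_equal. apply Ceq; unfold Re, Im; simpl; ring. }
  assert (MEF : Cmod EF = exp (- y * (PI / 2) * cosh mu)).
  { unfold EF, exp_factor. rewrite Cmod_Cexp. f_equal. unfold Re; simpl. ring. }
  assert (Hs2 : 0 < sqrt 2) by (apply sqrt_lt_R0; lra).
  assert (Hs22 : sqrt 2 ^ 2 = 2) by (apply pow2_sqrt; lra).
  (* An exact identity: the claimed main term is the comparison function, rescaled by the same
     factor as K_nu. *)
  assert (EM : Cminus (main_Ai r mu y) (main_Ai' r mu y) =
     Cmult (Cmult (RtoC (PI * e)) EF) (cmp_m1 r e q, cmp_m2 r e q)).
  { unfold main_Ai, main_Ai'. rewrite EA, EA'. fold EF.
    rewrite (coef_root_eq (sqrt q0) mu Hmu0 Hser Hmu), (coef_sinh_eq r (sqrt q0) mu Hmu0 Hser Hmu).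
    fold q. fold u. rewrite Hu2, (cosh_chq (r * mu)).
    replace ((r * mu) ^ 2) with (r ^ 2 * q) by (unfold q; ring).
    unfold cmp_m1, cmp_m2, amp_a, amp_b, coef_root_fun, coef_sinh_fun. fold w.
    destruct EF as [f1 f2]. unfold e.
    generalize (AiN (cmp_X (w / u) q)) (AiN' (cmp_X (w / u) q)). intros a a'.
    apply Ceq; unfold Re, Im; simpl; field; lra. }
  assert (EK : BesselK nu y = Cmult (Cmult (RtoC (PI * e)) EF) (nb0 r e q)).
  { rewrite Enu, (BesselK_norm r e y He Hy q Hp); [rewrite EEF; auto|]. rewrite Het, Htq. field. lra. }
  destruct (Hcmp r e q Hr ltac:(lra) Hq) as [_ HB].
  set (Err := Cmult (Cmult (RtoC (PI * e)) EF) (Cminus (nb0 r e q) (cmp_m1 r e q, cmp_m2 r e q))).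
  assert (HErr : Cmod Err <= (PI * K * 32 + 1) * (Rabs (err_Ai mu y) + Rabs (err_Ai' mu y))).
  { unfold Err, err_Ai, err_Ai'. rewrite EA, EA', Hu4, Hu5.
    rewrite !Cmod_mult, MEF, Cmod_R, (Rabs_pos_eq (PI * e)) by (apply Rmult_le_pos; lra).
    assert (Hex := exp_pos (- y * (PI / 2) * cosh mu)).
    set (ex := exp (- y * (PI / 2) * cosh mu)) in *.
    unfold Rdiv. rewrite !Rabs_mult, !Rabs_inv, (Rabs_pos_eq ex), (Rabs_pos_eq (u ^ 4)), (Rabs_pos_eq (u ^ 5))
      by (try apply pow_le; lra).
    set (a := Rabs (AiN (cmp_X e q))) in *. set (b := Rabs (AiN' (cmp_X e q))) in *.
    assert (Ha : 0 <= a) by apply Rabs_pos. assert (Hb : 0 <= b) by apply Rabs_pos.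
    assert (P4 : 0 < / u ^ 4) by (apply Rinv_0_lt_compat, pow_lt; auto).
    assert (P5 : 0 < / u ^ 5) by (apply Rinv_0_lt_compat, pow_lt; auto).
    assert (Q4 : e ^ 4 <= 32 * / u ^ 4).
    { unfold e. replace ((w / u) ^ 4) with (w ^ 4 * / u ^ 4) by (field; lra).
      apply Rmult_le_compat_r; [lra|]. apply Rle_trans with (2 ^ 4); [apply pow_incr; lra | lra]. }
    assert (Q5 : e ^ 5 <= 32 * / u ^ 5).
    { unfold e. replace ((w / u) ^ 5) with (w ^ 5 * / u ^ 5) by (field; lra).
      apply Rmult_le_compat_r; [lra|]. apply Rle_trans with (2 ^ 5); [apply pow_incr; lra | lra]. }
    apply Rle_trans with (PI * e * ex * (K * (e ^ 3 * a + e ^ 4 * b))).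
    { apply Rmult_le_compat_l; auto. apply Rmult_le_pos; [apply Rmult_le_pos|]; lra. }
    replace (PI * e * ex * (K * (e ^ 3 * a + e ^ 4 * b))) with (PI * K * (ex * (a * e ^ 4 + b * e ^ 5))) by ring.
    apply Rle_trans with (PI * K * (ex * (a * (32 * / u ^ 4) + b * (32 * / u ^ 5)))).
    { apply Rmult_le_compat_l; auto. apply Rmult_le_compat_l; [lra|].
      apply Rplus_le_compat; apply Rmult_le_compat_l; auto. }
    assert (0 <= a * ex * / u ^ 4) by (repeat apply Rmult_le_pos; lra).
    assert (0 <= b * ex * / u ^ 5) by (repeat apply Rmult_le_pos; lra).
    lra. }
  assert (Hc0 : 0 <= PI * K * 32 + 1) by lra.
  destruct (split_error Err _ _ _ Hc0 HErr) as [F1 [F2 [EE [B1 B2]]]].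
  exists F1, F2. split; auto.
  rewrite EK, EM, <- Cplus_assoc, <- EE. unfold Err. ring.
Qed.
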